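(* Let $K\in\mathbb R$ and let $(X,\mathsf d,\mathfrak m)$ be an $\mathsf{RCD}(K,\infty)$ metric measure space with $\mathfrak m(X)<\infty$, with $X$ containing at least two points. Assume that $(X,\mathsf d,\mathfrak m)$ admits a superlinear isoperimetric profile (this is always satisfied if $\mathrm{diam}(X)<\infty$ or $K>0$). Then equality in Cheeger's inequality is never attained, i.e. $$\lambda_1>\frac14\,h(X)^2 ,$$ where $h(X)$ is the Cheeger constant of $X$ and $\lambda_1=\lambda_{1,2}(X)$.
   Context: A metric measure space $(X,\mathsf d,\mathfrak m)$ is a complete separable metric space with a $\sigma$-finite non-negative Borel measure $\mathfrak m$ such that $\operatorname{supp}\mathfrak m=X$ and, for some $x_0\in X$, $M>0$, $c\ge 0$, $\mathfrak m(B_r(x_0))\le M e^{cr^2}$ for all $r\ge 0$. Slope: $\mathrm{lip}(f)(x)=\limsup_{y\to x}|f(y)-f(x)|/\mathsf d(x,y)$ ($=0$ at isolated points). $\mathsf{Lip}_{bs}(X)$: real Lipschitz functions with bounded support; $\mathsf{Lip}_{loc}(X)$: functions that are Lipschitz on bounded sets. $\mathcal P_2(X)$ is the space of probability measures with finite second moment, with Kantorovich–Wasserstein distance $W_2$. $\mathsf{Ent}_{\mathfrak m}(\mu)=\int\rho\log\rho\,d\mathfrak m$ if $\mu=\rho\mathfrak m$ with $(\rho\log\rho)^-\in L^1(X,\mathfrak m)$, and $+\infty$ otherwise; $D(\mathsf{Ent}_{\mathfrak m})=\{\mu\in\mathcal P_2(X):\mathsf{Ent}_{\mathfrak m}(\mu)\in\mathbb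 R\}$. The space is $\mathsf{CD}(K,\infty)$ if for all $\mu_0,\mu_1\in D(\mathsf{Ent}_{\mathfrak m})$ there is a $W_2$-geodesic $(\mu_t)_{t\in[0,1]}$ joining them with $\mathsf{Ent}_{\mathfrak m}(\mu_t)\le(1-t)\mathsf{Ent}_{\mathfrak m}(\mu_0)+t\,\mathsf{Ent}_{\mathfrak m}(\mu_1)-\frac K2 t(1-t)W_2^2(\mu_0,\mu_1)$ for all $t$. The Cheeger energy is $\mathsf{Ch}_{\mathfrak m,2}(f)=\inf\{\liminf_n\frac12\int_X\mathrm{lip}(f_n)^2d\mathfrak m: f_n\in\mathsf{Lip}_{bs}(X),\ f_n\to f\text{ in }L^2(X,\mathfrak m)\}$. The space is $\mathsf{RCD}(K,\infty)$ if it is $\mathsf{CD}(K,\infty)$ and $\mathsf{Ch}_{\mathfrak m,2}$ is a quadratic form. For $\mathfrak m(X)<\infty$: $\lambda_1=\inf\big\{\int_X\mathrm{lip}(f)^2d\mathfrak m\big/\int_X f^2d\mathfrak m:\ 0\not\equiv f\in\mathsf{Lip}_{bs}(X),\ \int_X f\,d\mathfrak m=0\big\}$. $\mathrm{Per}(A)=\inf\{\liminf_n\int_X\mathrm{lip}(f_n)\,d\mathfrak m: f_n\in\mathsf{Lip}_{loc}(X),\ f_n\to\chi_A\text{ in }L^1(X,\mathfrak m)\}$ for Borel $A$; $h(X)=\inf\{\mathrm{Per}(A)/\mathfrak m(A): A\subset X\text{ Borel},\ 0<\mathfrak m(A)\le\mathfrak m(X)/2\}$. A space with $\mathfrak m(X)=1$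 admits a superlinear isoperimetric profile if there is a function $\omega:(0,\infty)\to(0,1/2]$ such that for all $\varepsilon>0$ and all Borel $E\subset X$: $\mathfrak m(E)\le\omega(\varepsilon)\Rightarrow\mathfrak m(E)\le\varepsilon\,\mathrm{Per}(E)$. A space with $0<\mathfrak m(X)<\infty$ admits one if the normalized space $(X,\mathsf d,\mathfrak m/\mathfrak m(X))$ does. *)

(* Defs.v *)
From HB Require Import structures.
From mathcomp Require Import all_boot all_order all_algebra.
From mathcomp Require Import all_classical all_reals all_analysis.

Set Implicit Arguments.
Unset Strict Implicit.
Unset Printing Implicit Defensive.

Import Order.TTheory GRing.Theory Num.Theory.
Import numFieldNormedType.Exports.

Local Open Scope classical_set_scope.
Local Open Scope ring_scope.

#[short(type="completeMetricType")]
HB.structure Definition CompleteMetric (R : numDomainType) :=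
  {T of Metric R T & Complete T}.

Notation borel X := (g_sigma_algebraType (@open X)).

Section metric_notions.
Context (R : realType) (X : completeMetricType R).
Implicit Types (f : X -> R) (B : set X).
Local Open Scope ereal_scope.

Definition separable := exists2 D : set X, countable D & dense D.

Definition diam B : \bar R :=
  ereal_sup [set (mdist p.1 p.2)%:E | p in B `*` B].

Definition mbounded B := diam B < +oo.

Definition slope f (x : X) : \bar R :=
  if `[< isolated [set: X] x >] then 0
  else limf_esup (fun y => (`|f y - f x| / mdist x y)%:E) x^'.

Definition lipschitz_in B f := exists L : R,
  forall x y, B x -> B y -> (`|f x - f y| <= L * mdist x y)%R.

Definition Lip_bs f :=
  lipschitz_in setT f /\ mbounded (closure [set x | f x != 0%R]).

Definition Lip_loc f := forall B, mbounded B -> lipschitz_in B f.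

End metric_notions.

Section metric_measure_spaces.
Context (R : realType) (X : completeMetricType R).
Variable m : {measure set (borel X) -> \bar R}.
Local Open Scope ereal_scope.

Definition msupport : set X :=
  [set x | forall U : set X, open U -> U x -> 0 < m U].

Definition gaussian_growth := exists (x0 : X) (M c : R),
  [/\ (0 < M)%R, (0 <= c)%R &
    forall r : R, (0 <= r)%R -> m (ball x0 r) <= (M * expR (c * r ^+ 2))%:E].

(* Completeness is carried by the type of X. *)
Definition metric_measure_space :=
  [/\ separable X, sigma_finite [set: borel X] m,
      msupport = setT & gaussian_growth].

End metric_measure_spaces.

Section wasserstein.
Context (R : realType) (X : completeMetricType R).
Implicit Types mu nu : probability (borel X) R.
Local Open Scope ereal_scope.

Definition P2 mu :=
  exists x0 : X, \int[mu]_x (mdist x0 x ^+ 2)%:E < +oo.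

(* X being separable, the product of the Borel sigma-algebras is the Borel
   sigma-algebra of X * X. *)
Definition coupling mu nu (pi : probability (borel X * borel X)%type R) :=
  forall A : set (borel X), measurable A ->
    pi (A `*` setT) = mu A /\ pi (setT `*` A) = nu A.

Definition W2 mu nu : \bar R :=
  sqrte (ereal_inf
    [set \int[pi]_p (mdist (p.1 : X) (p.2 : X) ^+ 2)%:E | pi in coupling mu nu]).

(* Bundled measures also take (irrelevant) values on non-measurable sets, so
   the endpoints are identified on measurable sets only. *)
Definition W2_geodesic mu0 mu1 (mu_ : R -> probability (borel X) R) :=
  [/\ forall t, (0 <= t <= 1)%R -> P2 (mu_ t),
      forall A : set (borel X), measurable A ->
        mu_ 0%R A = mu0 A /\ mu_ 1%R A = mu1 A &
      forall s t, (0 <= s <= 1)%R -> (0 <= t <= 1)%R ->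
        W2 (mu_ s) (mu_ t) = `|t - s|%:E * W2 mu0 mu1].

End wasserstein.

Section curvature_dimension.
Context (R : realType) (X : completeMetricType R).
Variable m : {measure set (borel X) -> \bar R}.
Implicit Types mu : probability (borel X) R.
Local Open Scope ereal_scope.

Definition density mu (rho : borel X -> R) :=
  [/\ measurable_fun setT rho, forall x, (0 <= rho x)%R &
      forall A, measurable A -> mu A = \int[m]_(x in A) (rho x)%:E].

Definition rho_log_rho (rho : borel X -> R) : borel X -> R :=
  fun x => (rho x * ln (rho x))%R.

(* The density is m-a.e. unique, m being sigma-finite, so the infimum ranges
   over at most one value; it is +oo when there is no admissible density. *)
Definition Ent mu : \bar R :=
  ereal_inf [set \int[m]_x (rho_log_rho rho x)%:E | rho in
    [set rho | density mu rho /\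
      m.-integrable setT (EFin \o (rho_log_rho rho)^\-%R)]].

Definition dom_Ent mu := P2 mu /\ Ent mu \is a fin_num.

Definition CD_infty (K : R) := forall mu0 mu1, dom_Ent mu0 -> dom_Ent mu1 ->
  exists2 mu_ : R -> probability (borel X) R, W2_geodesic mu0 mu1 mu_ &
  forall t : R, (0 <= t <= 1)%R ->
    Ent (mu_ t) <= (1 - t)%:E * Ent mu0 + t%:E * Ent mu1
                   - (K / 2 * t * (1 - t))%:E * W2 mu0 mu1 ^+ 2.

Definition cvg_Lp (p : R) (f_ : nat -> X -> R) (f : X -> R) :=
  'N[m]_p%:E [(fun x => (f_ n x - f x)%:E)] @[n --> \oo] --> (0 : \bar R).

Definition Cheeger (f : X -> R) : \bar R :=
  ereal_inf [set limn_einf (fun n => 2^-1%:E * \int[m]_x slope (f_ n) x ^+ 2) |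
    f_ in [set f_ : nat -> X -> R | (forall n, Lip_bs (f_ n)) /\ cvg_Lp 2 f_ f]].

(* Parallelogram identity; Cheeger is 2-homogeneous by definition. *)
Definition Cheeger_quadratic :=
  forall f g : borel X -> R, f \in Lfun m 2%:E -> g \in Lfun m 2%:E ->
    Cheeger (f \+ g)%R + Cheeger (f \- g)%R = 2%:E * Cheeger f + 2%:E * Cheeger g.

Definition RCD_infty (K : R) :=
  [/\ metric_measure_space m, CD_infty K & Cheeger_quadratic].

End curvature_dimension.

Section cheeger_constant.
Context (R : realType) (X : completeMetricType R).
Variable m : {measure set (borel X) -> \bar R}.
Local Open Scope ereal_scope.

Definition lambda1 : \bar R :=
  ereal_inf [set (\int[m]_x slope f x ^+ 2) / (\int[m]_x (f x ^+ 2)%:E) |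
    f in [set f : X -> R |
      [/\ Lip_bs f, exists x, f x <> 0%R & \int[m]_x (f x)%:E = 0]]].

Definition Per (A : set (borel X)) : \bar R :=
  ereal_inf [set limn_einf (fun n => \int[m]_x slope (f_ n) x) |
    f_ in [set f_ : nat -> X -> R |
      (forall n, Lip_loc (f_ n)) /\ cvg_Lp m 1 f_ \1_A]].

Definition cheeger_constant : \bar R :=
  ereal_inf [set Per A / m A | A in [set A : set (borel X) |
    [/\ measurable A, 0 < m A & m A <= m setT / 2%:E]]].

Definition superlinear_profile_prob := exists omega : R -> R,
  (forall e : R, (0 < e)%R -> (0 < omega e <= 2^-1)%R) /\
  forall (e : R) (E : set (borel X)), (0 < e)%R -> measurable E ->
    m E <= (omega e)%:E -> m E <= e%:E * Per E.

Definition total_mass_inv : {nonneg R} :=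
  NngNum (etrans (invr_ge0 _) (fine_ge0 (measure_ge0 m setT))).

End cheeger_constant.

Definition superlinear_profile (R : realType) (X : completeMetricType R)
    (m : {measure set (borel X) -> \bar R}) :=
  superlinear_profile_prob (mscale (total_mass_inv m) m).

(* Main.v *)
From HB Require Import structures.
Require Import Defs.
From mathcomp Require Import all_boot all_order all_algebra.
From mathcomp Require Import all_classical all_reals all_analysis.
From mathcomp Require Import measurable_realfun ring lra.

Set Implicit Arguments.
Unset Strict Implicit.
Unset Printing Implicit Defensive.

Import Order.TTheory GRing.Theory Num.Theory.
Import numFieldNormedType.Exports.

Local Open Scope classical_set_scope.
Local Open Scope ring_scope.

(** The strict inequality is Cheeger's argument with a quantitative gain. A test
    function for [lambda1] is split at its median into two nonnegative pieces
    supported on sets of measure at most half ([lambda1_ge]), and it suffices to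
    bound the Rayleigh quotient of each piece [g] from below.

    If [h > 0], apply the coarea inequality for the relaxed perimeter
    ([coarea_per]) to [g ^+ 2]. Superlevel sets obey [h * m A <= Per A], and the
    superlinear profile doubles this bound as soon as [m A] is below some [om].
    Equality in Cauchy-Schwarz would force [sl g] to be [h / 2 * g], but the
    doubled bound does not allow [g] to exceed its [om]-quantile by much while
    [g] is above the quantile on a set of measure [om]; comparing with the
    truncation of [g] at the quantile gives [onesided_gap], with an explicit
    excess over [h ^+ 2 / 4].

    If [h = 0], the claim is that [lambda1] is positive. The profile shows that a
    function [g] of small energy is of the size of its [L^2] norm on a set [A] of
    measure at least [om], while it vanishes on a set [B] of measure at least
    half. Such a [g] has large energy by an HWI-type inequality ([hwi],
    [capacity]): let [mu0] have density proportional to [g ^+ 2] and let [mu1]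
    be [mu0] with a fraction [sg] of the mass of [A] moved to [B]. The entropy
    drops by a multiple of [sg * ln (sg^-1)], whereas the squared Wasserstein
    distance is at most a multiple of [sg], so the entropy has a definite
    negative slope at [mu0] along the geodesic given by the curvature condition.
    On the other hand this slope is controlled by the integral of
    [sl g ^+ 2], by testing the entropy at time [t] against the Hopf-Lax
    evolution of [ln (g ^+ 2)] ([ent_near]). Only the distribution at time zero
    enters, and the bound depends on [A] and [B] but not on the support of [g], so
    that a far away cutoff is harmless.

    The profile itself follows from the Brunn-Minkowski inequality. Along the
    geodesic from the uniform measure on a small set [A] to the uniform measure on
    a ball, the measure at time [t] is carried by an enlargement of [A]
    ([midpoint_plan], [set_interpolation]), and the convexity of the entropy makes
    this enlargement grow at a rate proportional to [m A * ln (1 / m A)]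
    ([set_growth_rate]). A Minkowski version of the coarea inequality
    ([coarea_minkowski]) turns the growth of the superlevel sets of functions
    close to the indicator of [E] into a lower bound for [Per E]
    ([small_set_perimeter]). The rate degrades with the radius of the region
    considered, which is fixed when the space is bounded; for [K > 0] Gaussian
    concentration ([gaussian_concentration]) makes a small multiple of
    [ln (1 / m E)] a sufficient radius.

    The Cheeger constant is finite because some small ball has finite perimeter
    ([cheeger_fin_num]). *)

(** * Borel sets, continuity and slopes *)

Section borel_sets.
Context (R : realType) (X : completeMetricType R).
Implicit Types (f : X -> R) (x y : X).

Lemma borel_open (A : set X) : open A -> measurable (A : set (borel X)).
Proof. by move=> oA; exact: sub_sigma_algebra. Qed.

Lemma borel_closed (A : set X) : closed A -> measurable (A : set (borel X)).
Proof.
move=> cA; rewrite -(setCK A); apply: measurableC.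
by apply: borel_open; exact: closed_openC.
Qed.

Lemma mopenP (A : set X) :
  (forall x, A x -> exists2 r, 0 < r & forall y, mdist x y < r -> A y) ->
  open A.
Proof.
move=> h; rewrite openE => x /h[r r0 rA]; apply/nbhs_ballP; exists r => //=.
by move=> y; rewrite ballEmdist => /rA.
Qed.

Lemma open_mdist (A : set X) x : open A -> A x ->
  exists2 r, 0 < r & forall y, mdist x y < r -> A y.
Proof.
rewrite openE => oA /oA /nbhs_ballP[r /= r0 rA]; exists r => // y xy.
by apply: rA; rewrite ballEmdist.
Qed.

Lemma mdist_distl x y z : `|mdist x y - mdist x z| <= mdist y z.
Proof.
rewrite ler_distl; apply/andP; split.
  by rewrite lerBlDr (le_trans (metric_triangle _ y _))// lexx.
by rewrite (le_trans (metric_triangle _ z _))// (metric_sym z).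
Qed.

Definition mcontinuous f := forall x e, 0 < e ->
  exists2 r, 0 < r & forall y, mdist x y < r -> `|f x - f y| < e.

Lemma mcontinuous_open_gt f c : mcontinuous f -> open [set x | c < f x].
Proof.
move=> cf; apply: mopenP => x /= cx.
have [r r0 h] := cf x (f x - c) ltac:(by rewrite subr_gt0).
exists r => // y /h; rewrite ltr_distlC; lra.
Qed.

Lemma mcontinuous_open_lt f c : mcontinuous f -> open [set x | f x < c].
Proof.
move=> cf; apply: mopenP => x /= cx.
have [r r0 h] := cf x (c - f x) ltac:(by rewrite subr_gt0).
exists r => // y /h; rewrite ltr_distlC; lra.
Qed.

Lemma mcontinuous_measurable f : mcontinuous f ->
  measurable_fun setT (f : borel X -> R).
Proof.
move=> cf; apply: (measurability _ (RGenOInfty.measurableE R)).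
move=> _ /= [_ [r ->] <-]; rewrite setTI; apply: borel_open.
rewrite [X in open X](_ : _ = [set x | r < f x]); first exact: mcontinuous_open_gt.
by apply/seteqP; split => x /=; rewrite in_itv/= andbT.
Qed.

Lemma lipschitz_mcontinuous f : lipschitz_in setT f -> mcontinuous f.
Proof.
move=> [L fL] x e e0; exists (e / (`|L| + 1)).
  by rewrite divr_gt0// ltr_wpDl.
move=> y xy; rewrite (le_lt_trans (fL _ _ I I))//.
rewrite (@le_lt_trans _ _ ((`|L| + 1) * mdist x y))//.
  by rewrite ler_wpM2r ?mdist_ge0// (le_trans (ler_norm _))// lerDl.
by rewrite mulrC -ltr_pdivlMr// ltr_wpDl.
Qed.

Lemma mboundedP (A : set X) (D : R) :
  (forall x y, A x -> A y -> mdist x y <= D) -> mbounded A.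
Proof.
move=> h; apply: (@le_lt_trans _ _ D%:E); last exact: ltry.
by apply: ge_ereal_sup => _ [[a b] [/= Aa Ab] <-]; rewrite lee_fin; exact: h.
Qed.

Lemma mbounded_ball x r : mbounded [set y | mdist x y < r].
Proof.
apply: (@mboundedP _ (r + r)) => a b /= xa xb.
rewrite (le_trans (metric_triangle _ x _))// (metric_sym a).
by rewrite lerD// ltW.
Qed.

Lemma mbounded_diam (A : set X) : mbounded A ->
  exists2 D : R, 0 < D & forall x y, A x -> A y -> mdist x y <= D.
Proof.
rewrite /mbounded => dA; exists (`|fine (diam A)| + 1); first by rewrite ltr_wpDl.
move=> x y Ax Ay; have xyA : ((mdist x y)%:E <= diam A)%E.
  by apply: ereal_sup_ubound; exists (x, y).
have dAf : diam A \is a fin_num.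
  by rewrite fin_numElt dA andbT (lt_le_trans _ xyA)// ltNyr.
rewrite -lee_fin (le_trans xyA)// -[leLHS]fineK// lee_fin.
by rewrite (le_trans (ler_norm _))// lerDl.
Qed.

Lemma lip_loc_mcontinuous f : Lip_loc f -> mcontinuous f.
Proof.
move=> fL x e e0; have [L hL] := fL _ (mbounded_ball x 1).
exists (Num.min 1 (e / (`|L| + 1))).
  by rewrite lt_min ltr01 divr_gt0// ltr_wpDl.
move=> y; rewrite lt_min => /andP[y1 xy].
rewrite (le_lt_trans (hL _ _ _ _))//= ?mdistxx//.
rewrite (@le_lt_trans _ _ ((`|L| + 1) * mdist x y))//.
  by rewrite ler_wpM2r ?mdist_ge0// (le_trans (ler_norm _))// lerDl.
by rewrite mulrC -ltr_pdivlMr// ltr_wpDl.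
Qed.

Lemma lipschitz_lip_loc f : lipschitz_in setT f -> Lip_loc f.
Proof. by move=> [L fL] B _; exists L => x y _ _; exact: fL. Qed.

End borel_sets.

Section slope_theory.
Context (R : realType) (X : completeMetricType R).
Implicit Types (f g : X -> R) (x y : X).
Local Open Scope ereal_scope.

Lemma dnbhs0_isolated x : x^' set0 -> isolated [set: X] x.
Proof.
rewrite /dnbhs /within /= => h; split; first by rewrite inE.
exists [set y | y != x -> set0 y] => //; rewrite setIT; apply/seteqP; split => y /=.
  by case: (eqVneq y x) => // _ /(_ isT).
by move=> ->; rewrite eqxx.
Qed.

Lemma slope_ge0 f x : 0 <= slope f x.
Proof.
rewrite /slope; case: asboolP => // iso; apply: limf_esup_ge0.
  by move/dnbhs0_isolated.
by move=> y; rewrite lee_fin divr_ge0// mdist_ge0.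
Qed.

Lemma slope_le f x (r C : R) : (0 < r)%R -> (0 <= C)%R ->
  (forall y, (mdist x y < r)%R -> (`|f y - f x| <= C * mdist x y)%R) ->
  slope f x <= C%:E.
Proof.
move=> r0 C0 h; rewrite /slope; case: asboolP => [_|_]; first by rewrite lee_fin.
rewrite limf_esupE.
apply: (@le_trans _ _ (ereal_sup ((fun y => (`|f y - f x| / mdist x y)%:E) @`
    [set y | (mdist x y < r)%R /\ y != x]))).
  apply: ereal_inf_lbound; exists [set y | (mdist x y < r)%R /\ y != x] => //.
  rewrite /dnbhs /within /=; apply/nbhs_ballP; exists r => //= y.
  by rewrite ballEmdist.
apply: ge_ereal_sup => _ [y [/= yr yx] <-]; rewrite lee_fin ler_pdivrMr; first exact: h.
by rewrite mdist_gt0 eq_sym.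
Qed.

Lemma slope_lt f x (c : R) : slope f x < c%:E ->
  exists2 r, (0 < r)%R &
    forall y, (mdist x y < r)%R -> (`|f y - f x| <= c * mdist x y)%R.
Proof.
move=> sc; have c0 : (0 < c)%R by rewrite -lte_fin (le_lt_trans (slope_ge0 f x)).
move: sc; rewrite /slope; case: asboolP => [[_ [V /nbhs_ballP[r /= r0 rV] Vx]] _|_].
  exists r => // y xy; have : (V `&` setT) y by split => //; apply: rV; rewrite ballEmdist.
  by rewrite Vx => ->; rewrite subrr normr0 mulr_ge0 ?mdist_ge0// ltW.
rewrite limf_esupE => /ereal_inf_lt[_ [V + <-]] Vc.
rewrite /dnbhs /within /= => /nbhs_ballP[r /= r0 rV]; exists r => // y xy.
have [->|yx] := eqVneq y x.
  by rewrite subrr normr0 mulr_ge0 ?mdist_ge0// ltW.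
have Vy : V y by apply: rV => //=; rewrite ballEmdist.
rewrite -ler_pdivrMr; last by rewrite mdist_gt0 eq_sym.
rewrite -lee_fin (le_trans _ (ltW Vc))//.
by apply: ereal_sup_ubound; exists y.
Qed.

(** The slope is an infimum over scales [1/n] of suprema over small balls, and
    each sublevel set of these suprema is closed by continuity. *)
Lemma measurable_slope f : mcontinuous f ->
  measurable_fun setT (slope f : borel X -> \bar R).
Proof.
move=> cf; apply: (measurability _ (ErealGenInftyO.measurableE R)).
move=> _ /= [_ [c ->] <-]; rewrite setTI.
pose F (q : R) (n : nat) := [set x | forall y, (mdist x y < n.+1%:R^-1)%R ->
  (`|f y - f x| <= q * mdist x y)%R].
have cF q n : closed (F q n).
  rewrite -[F q n]setCK; apply: open_closedC; apply: mopenP => x /existsNP[y].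
  move=> /not_implyP[xy /negP]; rewrite -ltNge => qf.
  pose e := (`|f y - f x| - q * mdist x y)%R.
  have e0 : (0 < e)%R by rewrite subr_gt0.
  have [r r0 hr] := cf x (e / 2)%R ltac:(by rewrite divr_gt0).
  pose r' := Num.min r (Num.min (n.+1%:R^-1 - mdist x y)%R (e / 2 / (`|q| + 1))%R).
  have q1 : (0 < `|q| + 1)%R by rewrite ltr_wpDl.
  exists r'; first by rewrite !lt_min r0 subr_gt0 xy/= !divr_gt0.
  move=> z; rewrite !lt_min => /andP[/hr xz /andP[zn ze]] /(_ y).
  have zy : (mdist z y <= mdist z x + mdist x y)%R by exact: metric_triangle.
  have dxyz : (`|mdist x y - mdist z y| <= mdist x z)%R by rewrite !(metric_sym _ y); exact: mdist_distl.
  apply/not_implyP; split; first by rewrite (le_lt_trans zy)// (metric_sym z x) -ltrBrDr.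
  apply/negP; rewrite -ltNge.
  have qd : (q * mdist z y <= q * mdist x y + e / 2)%R.
    rewrite -lerBlDl -mulrBr (le_trans (ler_norm _))// normrM.
    rewrite (@le_trans _ _ ((`|q| + 1) * mdist x z)%R)//.
      by apply: ler_pM => //; [rewrite lerDl | rewrite distrC; exact: dxyz].
    by rewrite mulrC -ler_pdivlMr// ltW.
  have := ler_distD (f z) (f y) (f x); move: xz; rewrite (distrC (f x)) /e => xz hd.
  by move: qd; rewrite /e in xz *; lra.
rewrite [X in _.-measurable X](_ : _ = \bigcup_(q : rat)
    (if (0 <= ratr q :> R)%R && (ratr q < c)%R then \bigcup_n F (ratr q) n else set0)).
  apply: bigcupT_measurable_rat => q; case: ifP => // _.
  by apply: bigcup_measurable => n _; exact: borel_closed.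
apply/seteqP; split => x /=; rewrite in_itv/=.
  move=> sc; have sf : slope f x \is a fin_num.
    by rewrite ge0_fin_numE ?slope_ge0// (lt_trans sc)// ltry.
  have := sc; rewrite -(fineK sf) lte_fin => /rat_in_itvoo[q]; rewrite in_itv/=.
  move=> /andP[sq qc]; exists q => //.
  have q0 : (0 <= ratr q :> R)%R by rewrite (le_trans _ (ltW sq))// fine_ge0// slope_ge0.
  rewrite q0 qc/=; have : slope f x < (ratr q)%:E by rewrite -(fineK sf) lte_fin.
  move=> /slope_lt[r r0 hr]; have [n nr] : exists n, (n.+1%:R^-1 < r)%R.
    by have := near_infty_natSinv_lt (PosNum r0) => -[n _ /(_ n (leqnn n))]; exists n.
  by exists n => // y yn; apply: hr; exact: lt_trans nr.
move=> [q _]; case: ifP => // /andP[q0 qc] [n _ Fn].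
by rewrite (@le_lt_trans _ _ (ratr q)%:E) ?lte_fin//; exact: slope_le Fn.
Qed.

End slope_theory.

(** * Real-valued slopes and bounded measurable functions *)

Section real_slope.
Context (R : realType) (X : completeMetricType R).
Implicit Types (f g : X -> R) (x y : X).

(** Only meaningful where the slope is finite; [lip_loc_slE] provides this for
    the functions in use. *)
Definition sl f x : R := fine (slope f x).

Lemma sl_ge0 f x : 0 <= sl f x.
Proof. by rewrite fine_ge0// slope_ge0. Qed.

Lemma sl_le f x (r C : R) : 0 < r -> 0 <= C ->
  (forall y, mdist x y < r -> `|f y - f x| <= C * mdist x y) ->
  slope f x = (sl f x)%:E /\ sl f x <= C.
Proof.
move=> r0 C0 h; have sC := slope_le r0 C0 h.
have sE : slope f x = (sl f x)%:E.
  by rewrite /sl fineK// ge0_fin_numE ?slope_ge0// (le_lt_trans sC)// ltry.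
by split => //; rewrite -lee_fin -sE.
Qed.

Lemma lip_loc_slE f x : Lip_loc f -> slope f x = (sl f x)%:E.
Proof.
move=> fL; have [L hL] := fL _ (mbounded_ball x 1).
have [|//] := @sl_le f x 1 `|L| ltr01 (normr_ge0 _).
move=> y xy; rewrite metric_sym (le_trans (hL _ _ _ _))//= ?mdistxx//.
by rewrite ler_wpM2r ?mdist_ge0// ler_norm.
Qed.

Lemma lipschitz_sl_le f x (L : R) : 0 <= L ->
  (forall x y, `|f x - f y| <= L * mdist x y) -> sl f x <= L.
Proof.
move=> L0 h; have [] // := @sl_le f x 1 L ltr01 L0.
by move=> y _; rewrite metric_sym.
Qed.

Lemma sl_lt f x (c : R) : slope f x = (sl f x)%:E -> sl f x < c ->
  exists2 r, 0 < r & forall y, mdist x y < r -> `|f y - f x| <= c * mdist x y.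
Proof. by move=> sE sc; apply: slope_lt; rewrite sE lte_fin. Qed.

(** All the calculus rules for slopes come from this comparison. *)
Lemma sl_comp_le f g x (r c e : R) : slope f x = (sl f x)%:E ->
  0 < r -> 0 <= c -> 0 <= e ->
  (forall y, mdist x y < r ->
     `|g y - g x| <= c * `|f y - f x| + e * mdist x y) ->
  slope g x = (sl g x)%:E /\ sl g x <= c * sl f x + e.
Proof.
move=> fE r0 c0 e0 h.
have H (b : R) : 0 < b -> slope g x = (sl g x)%:E /\ sl g x <= c * (sl f x + b) + e.
  move=> b0; have sb : sl f x < sl f x + b by rewrite ltrDl.
  have [s s0 hs] := sl_lt fE sb.
  apply: (@sl_le g x (Num.min r s)); first by rewrite lt_min r0.
    by rewrite addr_ge0// mulr_ge0// addr_ge0 ?sl_ge0// ltW.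
  move=> y; rewrite lt_min => /andP[/h yr /hs ys].
  by rewrite (le_trans yr)// mulrDl lerD2r -mulrA ler_wpM2l.
have [gE _] := H 1 ltr01; split => //.
apply/ler_addgt0Pr => b b0; have [_] := H (b / (c + 1)) ltac:(by rewrite divr_gt0// ltr_wpDl).
move=> /le_trans; apply; rewrite mulrDr addrAC lerD2l.
by rewrite mulrCA ger_pMr// ler_pdivrMr ?ltr_wpDl// mul1r lerDl.
Qed.

Lemma measurable_sl f : mcontinuous f -> measurable_fun setT (sl f : borel X -> R).
Proof. by move=> cf; apply: measurableT_comp => //; exact: measurable_slope. Qed.

End real_slope.

Lemma indic_ite (T : Type) (R : pzRingType) (b : T -> bool) x :
  \1_[set y | b y] x = (if b x then 1 else 0) :> R.
Proof.
rewrite indicE; case: ifPn => h; first by rewrite mem_set.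
by rewrite memNset//=; exact/negP.
Qed.

Section bounded_measurable.
Context d (T : measurableType d) (R : realType).
Implicit Types (f g : T -> R).

(** This class is closed under the operations below and consists of integrable
    functions for every finite measure, so that integrals of its members can be
    manipulated as real numbers. *)
Definition bmf f := measurable_fun setT f /\ exists C : R, forall x, `|f x| <= C.

Lemma bmf_cst c : bmf (cst c).
Proof. by split => //; exists `|c|. Qed.

Lemma bmfD f g : bmf f -> bmf g -> bmf (fun x => f x + g x).
Proof.
move=> [mf [C fC]] [mg [D gD]]; split; first exact: measurable_funD.
by exists (C + D) => x; rewrite (le_trans (ler_normD _ _))// lerD.
Qed.

Lemma bmfN f : bmf f -> bmf (fun x => - f x).
Proof.
move=> [mf [C fC]]; split; first exact: measurableT_comp.
by exists C => x; rewrite normrN.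
Qed.

Lemma bmfB f g : bmf f -> bmf g -> bmf (fun x => f x - g x).
Proof. by move=> bf bg; apply: bmfD => //; exact: bmfN. Qed.

Lemma bmfM f g : bmf f -> bmf g -> bmf (fun x => f x * g x).
Proof.
move=> [mf [C fC]] [mg [D gD]]; split; first exact: measurable_funM.
by exists (C * D) => x; rewrite normrM ler_pM.
Qed.

Lemma bmfX f n : bmf f -> bmf (fun x => f x ^+ n).
Proof.
move=> bf; elim: n => [|n IH]; first exact: (bmf_cst 1).
by under eq_fun do rewrite exprS; exact: bmfM.
Qed.

Lemma bmf_max f g : bmf f -> bmf g -> bmf (fun x => Num.max (f x) (g x)).
Proof.
move=> [mf [C fC]] [mg [D gD]]; split; first exact: measurable_maxr.
exists (C + D) => x; rewrite maxEle; case: ifP => _; move: (fC x) (gD x) (normr_ge0 (f x)) (normr_ge0 (g x)); lra.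
Qed.

Lemma bmf_indic (A : set T) : measurable A -> bmf (\1_A : T -> R).
Proof.
move=> mA; split; first exact: measurable_indic.
by exists 1 => x; rewrite indicE; case: (_ \in _); rewrite ?normr1// normr0.
Qed.

Variable mu : {measure set T -> \bar R}.
Hypothesis mufin : (mu setT < +oo)%E.

Lemma bmf_integrable f : bmf f -> mu.-integrable setT (EFin \o f).
Proof.
move=> [mf [C fC]]; apply: measurable_bounded_integrable => //.
exists C; split; first by rewrite num_real.
by move=> x Cx y _; exact: le_trans (fC y) (ltW Cx).
Qed.

Lemma RintE f : bmf f -> (\int[mu]_x f x)%:E = (\int[mu]_x (f x)%:E)%E.
Proof.
move=> bf; rewrite /Rintegral fineK//.
by apply: integrable_fin_num => //; exact: (bmf_integrable bf).
Qed.

Lemma RintD f g : bmf f -> bmf g ->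
  \int[mu]_x (f x + g x) = \int[mu]_x f x + \int[mu]_x g x.
Proof. by move=> bf bg; rewrite RintegralD//; exact: bmf_integrable. Qed.

Lemma RintB f g : bmf f -> bmf g ->
  \int[mu]_x (f x - g x) = \int[mu]_x f x - \int[mu]_x g x.
Proof. by move=> bf bg; rewrite RintegralB//; exact: bmf_integrable. Qed.

Lemma RintZ c f : bmf f -> \int[mu]_x (c * f x) = c * \int[mu]_x f x.
Proof. by move=> bf; rewrite RintegralZl//; exact: bmf_integrable. Qed.

Lemma Rint_le f g : bmf f -> bmf g -> (forall x, f x <= g x) ->
  \int[mu]_x f x <= \int[mu]_x g x.
Proof. by move=> bf bg fg; apply: le_Rintegral => //; exact: bmf_integrable. Qed.

Lemma Rint_cst c : \int[mu]_x c = c * fine (mu setT).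
Proof. by rewrite Rintegral_cst. Qed.

Lemma mu_fin (A : set T) : measurable A -> mu A \is a fin_num.
Proof.
move=> mA; rewrite ge0_fin_numE//; apply: le_lt_trans mufin.
by apply: le_measure => //; rewrite inE.
Qed.

Lemma Rint_indic (A : set T) : measurable A ->
  \int[mu]_x (\1_A x : R) = fine (mu A).
Proof. by move=> mA; rewrite /Rintegral integral_indic// setIT. Qed.

Lemma fine_mu_le (A B : set T) : measurable A -> measurable B -> A `<=` B ->
  fine (mu A) <= fine (mu B).
Proof.
by move=> mA mB AB; rewrite fine_le ?mu_fin//; apply: le_measure => //; rewrite inE.
Qed.

Lemma fine_muD (A B : set T) : measurable A -> measurable B -> A `<=` B ->
  fine (mu (B `\` A)) = fine (mu B) - fine (mu A).
Proof.
move=> mA mB AB; rewrite measureD//; last by rewrite ltey_eq mu_fin.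
by rewrite (setIidr AB) fineB// mu_fin.
Qed.

(** The theorem in the form needed for layer-cake arguments: [mu] is only assumed
    to be finite and is repackaged as a finite measure. *)
Lemma tonelli_lebesgue (F : R * T -> R) : measurable_fun setT F ->
  (forall z, 0 <= F z) ->
  (\int[lebesgue_measure]_s \int[mu]_x (F (s, x))%:E =
   \int[mu]_x \int[lebesgue_measure]_s (F (s, x))%:E)%E.
Proof.
move=> mF F0.
pose nu : {finite_measure set T -> \bar R} := mfrestr measurableT mufin.
have numu (f : T -> \bar R) : (\int[mu]_x f x = \int[nu]_x f x)%E.
  by apply: eq_measure_integral => A mA _; rewrite /nu/= /mfrestr/= /mrestr setIT.
rewrite numu; transitivity (\int[lebesgue_measure]_s \int[nu]_x (F (s, x))%:E)%E.
  by apply: eq_integral => s _; exact: numu.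
apply: (@fubini_tonelli _ _ _ _ _ lebesgue_measure nu (EFin \o F)) => /=.
  exact/measurable_EFinP.
by move=> z; rewrite lee_fin.
Qed.

Lemma measurable_int_lebesgue (F : R * T -> R) : measurable_fun setT F ->
  (forall z, 0 <= F z) ->
  measurable_fun setT (fun s => \int[mu]_x (F (s, x))%:E)%E.
Proof.
move=> mF F0.
pose nu : {finite_measure set T -> \bar R} := mfrestr measurableT mufin.
have numu (f : T -> \bar R) : (\int[mu]_x f x = \int[nu]_x f x)%E.
  by apply: eq_measure_integral => A mA _; rewrite /nu/= /mfrestr/= /mrestr setIT.
under eq_fun do rewrite numu.
apply: (@measurable_fun_fubini_tonelli_F _ _ _ _ _ nu (EFin \o F)) => /=.
  exact/measurable_EFinP.
by move=> z; rewrite lee_fin.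
Qed.

End bounded_measurable.

(** * Layer cake and the coarea inequality for the perimeter *)

Lemma measurable_ite d (T : measurableType d) (R : realType) (b : T -> bool) (c : R) :
  measurable_fun setT b -> measurable_fun setT (fun x => if b x then c else 0).
Proof. by move=> mb; apply: measurable_fun_ifT. Qed.

Lemma lebesgue_itv_real (R : realType) (a b : R) (x y : bool) : a <= b ->
  lebesgue_measure [set` Interval (BSide x a) (BSide y b)] = (b - a)%:E.
Proof.
move=> ab; rewrite lebesgue_measure_itv/= lte_fin.
case: ltP => [_|ba]; first by rewrite EFinB.
have -> : a = b by apply/eqP; rewrite eq_le ab ba.
by rewrite subrr.
Qed.

Lemma integral_itv_ite (R : realType) (a b c : R) (x y : bool) : a <= b ->
  (\int[lebesgue_measure]_s
    (if s \in Interval (BSide x a) (BSide y b) then c else 0)%:E = (c * (b - a))%:E)%E.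
Proof.
move=> ab; transitivity (\int[lebesgue_measure]_(s in [set` Interval (BSide x a) (BSide y b)]) (c%:E : \bar R))%E.
  rewrite [RHS]integral_mkcond; apply: eq_integral => s _.
  by rewrite patchE mem_setE; case: ifP.
by rewrite integral_cst//= lebesgue_itv_real// EFinM.
Qed.

Section layer_cake.
Context d (T : measurableType d) (R : realType).
Variable mu : {measure set T -> \bar R}.
Hypothesis mufin : (mu setT < +oo)%E.

Lemma measurable_superlevel (f : T -> R) s : measurable_fun setT f ->
  measurable [set x | s < f x].
Proof.
move=> mf; rewrite -[X in measurable X]setTI (_ : [set x | s < f x] = f @^-1` `]s, +oo[).
  exact: mf.
by apply/seteqP; split => x /=; rewrite in_itv/= andbT.
Qed.

Lemma layer_cake (f : T -> R) (a : R) : measurable_fun setT f ->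
  (\int[lebesgue_measure]_(s in `]a, +oo[) mu [set x | s < f x]%R =
   \int[mu]_x (Num.max (f x - a) 0)%:E)%E.
Proof.
move=> mf; pose F (z : R * T) : R := if (a < z.1) && (z.1 < f z.2) then 1 else 0.
have mfs : measurable_fun setT (fun z : R * T => f z.2) by exact: measurableT_comp.
have mF : measurable_fun setT F.
  apply: measurable_ite; apply: measurable_and; apply: measurable_fun_ltr => //.
have F0 z : 0 <= F z by rewrite /F; case: ifP.
have E := tonelli_lebesgue mufin mF F0.
rewrite [LHS]integral_mkcond; rewrite [LHS](_ : _ = \int[lebesgue_measure]_s \int[mu]_x (F (s, x))%:E)%E.
  rewrite E; apply: eq_integral => x _; rewrite /F/=.
  case: (ltP a (f x)) => [af|fa].
    have <- : (1 * (f x - a))%:E = (Num.max (f x - a) 0)%:E :> \bar R.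
      by rewrite mul1r max_l// subr_ge0 ltW.
    rewrite -(@integral_itv_ite _ a (f x) 1 false true (ltW af)).
    by apply: eq_integral => s _; rewrite in_itv.
  rewrite max_r ?subr_le0// integral0_eq// => s _.
  by case: ifP => // /andP[as_ sf]; move: (lt_trans as_ sf); rewrite ltNge fa.
apply: eq_integral => s _; rewrite patchE mem_setE in_itv/= andbT /F/=.
case: ifP => _ /=; last by rewrite integral0.
rewrite [RHS](_ : _ = \int[mu]_x (\1_[set x | (s < f x)%R] x)%:E)%E.
  by rewrite integral_indic ?setIT//; exact: measurable_superlevel.
by apply: eq_integral => x _; rewrite indicE; case: ifP => [h|/negbT h]; [rewrite mem_set|rewrite memNset//=; exact/negP].
Qed.

Lemma measurable_ccdf (f : T -> R) : measurable_fun setT f ->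
  measurable_fun setT (fun s : R => mu [set x | s < f x]).
Proof.
move=> mf; have mfs : measurable_fun setT (fun z : R * T => f z.2) by exact: measurableT_comp.
rewrite (_ : (fun s => _) = (fun s => \int[mu]_x (if (s < f x)%R then 1 else 0)%:E)%E).
  apply: (@measurable_int_lebesgue _ _ _ mu mufin (fun z => if z.1 < f z.2 then 1 else 0)).
    by apply: measurable_ite; apply: measurable_fun_ltr.
  by move=> z; case: ifP.
apply/funext => s; rewrite [RHS](_ : _ = \int[mu]_x (\1_[set x | (s < f x)%R] x)%:E)%E.
  by rewrite integral_indic ?setIT//; exact: measurable_superlevel.
by apply: eq_integral => x _; rewrite indicE; case: ifP => [h|/negbT h]; [rewrite mem_set|rewrite memNset//=; exact/negP].
Qed.

End layer_cake.

Lemma le_limn_einf (R : realType) (u v : (\bar R)^nat) :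
  (forall n, u n <= v n)%E -> (limn_einf u <= limn_einf v)%E.
Proof.
move=> uv; rewrite -![limn_einf _]/(limf_einf _ \oo) !limf_einfE; apply: ge_ereal_sup => _ [V FV <-].
apply: (@le_trans _ _ (ereal_inf (v @` V))).
  apply: le_ereal_inf_tmp => _ [n Vn <-]; apply: le_trans (uv n).
  by apply: ereal_inf_lbound; exists n.
by apply: ereal_sup_ubound; exists V.
Qed.

Lemma limn_einf_cst (R : realType) (c : \bar R) : limn_einf (fun _ : nat => c) = c.
Proof.
have h : (fun _ : nat => c) @ \oo --> c by exact: cvg_cst.
by rewrite is_cvg_limn_einfE; [exact: cvg_lim h|apply/cvg_ex; exists c].
Qed.

Section coarea_per.
Context (R : realType) (X : completeMetricType R).
Variable m : {measure set (borel X) -> \bar R}.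
Hypothesis mfin : (m setT < +oo)%E.
Implicit Types (g : X -> R).

Definition ramp n (s : R) g (x : X) : R :=
  Num.min 1 (Num.max 0 (n.+1%:R * (g x - s))).

Lemma ramp_ge0 n s g x : 0 <= ramp n s g x <= 1.
Proof. by rewrite /ramp le_min ler01 le_max lexx/= ge_min lexx. Qed.

Lemma clamp_dist (a b : R) :
  `|Num.min 1 (Num.max 0 a) - Num.min 1 (Num.max 0 b)| <= `|a - b|.
Proof.
wlog ab : a b / a <= b => [h|].
  by have [/h//|/ltW/h] := leP a b; rewrite distrC (distrC a).
rewrite !(distrC _ (Num.min 1 (Num.max 0 b))) (distrC a) [leRHS]ger0_norm ?subr_ge0//.
rewrite ger0_norm.
  rewrite !minEle !maxEle; repeat case: ifPn; rewrite -?ltNge => *; lra.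
rewrite subr_ge0 !minEle !maxEle; repeat case: ifPn; rewrite -?ltNge => *; lra.
Qed.

Lemma ramp_lip n s g x y : `|ramp n s g y - ramp n s g x| <= n.+1%:R * `|g y - g x|.
Proof.
rewrite (le_trans (clamp_dist _ _))//.
have -> : n.+1%:R * (g y - s) - n.+1%:R * (g x - s) = n.+1%:R * (g y - g x) by ring.
by rewrite normrM ger0_norm.
Qed.

Lemma sl_ramp n s g x : mcontinuous g -> slope g x = (sl g x)%:E ->
  (slope (ramp n s g) x <=
  (if (s <= g x)%R && (g x <= s + n.+1%:R^-1)%R then n.+1%:R * sl g x else 0)%:E)%E.
Proof.
move=> cg gE; case: ifPn => [_|].
  have h y : mdist x y < 1 ->
      `|ramp n s g y - ramp n s g x| <= n.+1%:R * `|g y - g x| + 0 * mdist x y.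
    by rewrite mul0r addr0 => _; exact: ramp_lip.
  have [-> + ] := sl_comp_le gE ltr01 (ler0n _ _) (lexx 0) h.
  by rewrite addr0 lee_fin.
rewrite negb_and -!ltNge => /orP sg.
have [r r0 hr] : exists2 r, 0 < r & forall y, mdist x y < r -> ramp n s g y = ramp n s g x.
  case: sg => [gs|gs].
    have [r r0 hr] := open_mdist (mcontinuous_open_lt s cg) gs.
    exists r => // y /hr /= ys; rewrite /ramp.
    by rewrite !(@max_l _ _ 0)// pmulr_rle0// subr_le0 ltW.
  have [r r0 hr] := open_mdist (mcontinuous_open_gt (s + n.+1%:R^-1) cg) gs.
  exists r => // y /hr /= ys; rewrite /ramp.
  have H z : s + n.+1%:R^-1 < g z -> Num.min 1 (Num.max 0 (n.+1%:R * (g z - s))) = 1.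
    move=> sz; apply: min_l; rewrite le_max; apply/orP; right.
    by rewrite -ler_pdivrMl// mulr1 lerBrDl ltW.
  by rewrite !H.
apply: (@slope_le _ _ _ _ r) => // y /hr ->.
by rewrite subrr normr0 mul0r.
Qed.

Lemma mcontinuous_ramp n s g : mcontinuous g -> mcontinuous (ramp n s g).
Proof.
move=> cg x e e0; have [r r0 hr] := cg x (e / n.+1%:R) ltac:(by rewrite divr_gt0).
exists r => // y /hr; rewrite ltr_pdivlMr// => ge.
rewrite (le_lt_trans (ramp_lip _ _ _ _ _))// mulrC; exact: ge.
Qed.

Lemma measurable_ramp n s g : mcontinuous g -> measurable_fun setT (ramp n s g : borel X -> R).
Proof. by move=> cg; apply: mcontinuous_measurable; exact: mcontinuous_ramp. Qed.

Lemma ramp_cvg s g : mcontinuous g ->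
  cvg_Lp m 1 (fun n => ramp n s g) (\1_([set x | s < g x] : set (borel X))).
Proof.
move=> cg; rewrite /cvg_Lp; under eq_fun do rewrite Lnorm1.
set A : set (borel X) := [set x | s < g x].
have mA : measurable A by apply: borel_open; exact: mcontinuous_open_gt.
pose f_ n (x : borel X) : \bar R := (ramp n s g x - \1_A x)%:E.
have mf_ n : measurable_fun setT (f_ n).
  apply/measurable_EFinP; apply: measurable_funB; first exact: measurable_ramp.
  exact: measurable_indic.
have [] // := @dominated_convergence _ (borel X) R m setT measurableT f_ (cst 0%E) (cst 1%E) mf_.
- apply: aeW => x _; apply: cvg_near_cst; rewrite /f_; have [sx|sx] := ltP s (g x).
    have sx0 : 0 < g x - s by rewrite subr_gt0.
    have [N _ HN] := near_infty_natSinv_lt (PosNum sx0).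
    exists N => // n /= /HN/= sn; rewrite indicE mem_set// /ramp min_l ?subrr//.
    by rewrite le_max -ler_pdivrMl// mulr1 (ltW sn) orbT.
  exists 0%N => // n _; rewrite indicE memNset//=; last by apply/negP; rewrite -leNgt.
  by rewrite /ramp max_l ?min_r ?subr0// pmulr_rle0// subr_le0.
- exact: (@bmf_integrable _ (borel X) R m mfin _ (@bmf_cst _ (borel X) R 1)).
- apply: aeW => x n _; rewrite /f_/= lee_fin indicE.
  have /andP[r0 r1] := ramp_ge0 n s g x.
  by case: (_ \in _); rewrite ?mulr1n ?mulr0n ler_norml; apply/andP; split; lra.
move=> _ + _; under eq_fun do under eq_integral do rewrite sube0.
by [].
Qed.

(** The ramps climbing from [0] to [1] between the levels [s] and [s + 1/n] are
    admissible in the definition of [Per]. *)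
Lemma per_superlevel_le s g : lipschitz_in setT g ->
  (Per m [set x | (s < g x)%R] <= limn_einf (fun n =>
   \int[m]_x (if (s <= g x)%R && (g x <= s + n.+1%:R^-1)%R
              then n.+1%:R * sl g x else 0)%:E))%E.
Proof.
move=> lg; have cg := lipschitz_mcontinuous lg.
apply: (@le_trans _ _ (limn_einf (fun n => \int[m]_x slope (ramp n s g) x)%E)).
  apply: ereal_inf_lbound; exists (fun n => ramp n s g) => //; split; last exact: ramp_cvg.
  move=> n; apply: lipschitz_lip_loc; have [L gL] := lg.
  exists (n.+1%:R * L) => x y _ _; rewrite (le_trans (ramp_lip _ _ _ _ _))//.
  by rewrite -mulrA ler_wpM2l// gL.
apply: le_limn_einf => n; apply: ge0_le_integral => //.
- by move=> x _; exact: slope_ge0.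
- by apply: measurable_slope; exact: mcontinuous_ramp.
- apply/measurable_EFinP; apply: measurable_fun_ifT => //.
    apply: measurable_and; apply: measurable_fun_ler => //; exact: mcontinuous_measurable.
  by apply: measurable_funM => //; exact: measurable_sl.
- by move=> x _; apply: sl_ramp => //; apply: lip_loc_slE; exact: lipschitz_lip_loc.
Qed.

(** Coarea inequality for the relaxed perimeter: Fatou's lemma and Tonelli's
    theorem applied to the slopes of the ramps between [s] and [s + 1/n]. *)
Lemma coarea_per g (psi : R -> \bar R) : lipschitz_in setT g ->
  measurable_fun setT psi -> (forall s, 0 <= psi s)%E ->
  (forall s, psi s <= Per m [set x | (s < g x)%R])%E ->
  (\int[lebesgue_measure]_s psi s <= \int[m]_x (sl g x)%:E)%E.
Proof.
move=> lg mpsi psi0 psiP; have cg := lipschitz_mcontinuous lg.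
have mg := mcontinuous_measurable cg; have ms := measurable_sl cg.
pose F n (z : R * borel X) : R := if (z.1 <= g z.2) && (g z.2 <= z.1 + n.+1%:R^-1)
  then n.+1%:R * sl g z.2 else 0.
have mF n : measurable_fun setT (F n).
  have mg2 : measurable_fun setT (fun z : R * borel X => g z.2) by exact: measurableT_comp.
  apply: measurable_fun_ifT => //.
    apply: measurable_and; apply: measurable_fun_ler => //.
    by apply: measurable_funD.
  by apply: measurable_funM => //; exact: (measurableT_comp ms).
have F0 n z : 0 <= F n z by rewrite /F; case: ifP => // _; rewrite mulr_ge0// sl_ge0.
apply: (@le_trans _ _ (\int[lebesgue_measure]_s limn_einf (fun n => \int[m]_x (F n (s, x))%:E))%E).
  apply: ge0_le_integral => //.
  - apply: measurableT_comp => //; apply: measurable_fun_limn_esup => n.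
    by apply: measurableT_comp => //; exact: measurable_int_lebesgue.
  - by move=> s _; rewrite (le_trans (psiP s))// per_superlevel_le.
apply: (le_trans (fatou _ _ _ _)) => //.
- by move=> n; exact: measurable_int_lebesgue.
- by move=> n s _; apply: integral_ge0 => x _; rewrite lee_fin.
rewrite (_ : (fun n => _) = fun _ => \int[m]_x (sl g x)%:E)%E ?limn_einf_cst//.
apply/funext => n; rewrite tonelli_lebesgue//; apply: eq_integral => x _.
have gn : g x - n.+1%:R^-1 <= g x by rewrite gerBl.
have := @integral_itv_ite _ _ _ (n.+1%:R * sl g x) true false gn.
rewrite subKr mulrAC mulfV// mul1r => <-; apply: eq_integral => s _; rewrite in_itv/= /F/=.
by rewrite andbC lerBlDr.
Qed.

End coarea_per.

(** * Cheeger's inequality with a gain *)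

Lemma maxr_dist (R : realType) (c a b : R) : `|Num.max a c - Num.max b c| <= `|a - b|.
Proof.
wlog ab : a b / a <= b => [h|].
  by have [/h//|/ltW/h] := leP a b; rewrite distrC (distrC a).
rewrite !(distrC _ (Num.max b c)) (distrC a) [leRHS]ger0_norm ?subr_ge0//.
rewrite ger0_norm.
  rewrite !maxEle; repeat case: ifPn; rewrite -?ltNge => *; lra.
rewrite subr_ge0 !maxEle; repeat case: ifPn; rewrite -?ltNge => *; lra.
Qed.

Lemma minr_dist (R : realType) (c a b : R) : `|Num.min a c - Num.min b c| <= `|a - b|.
Proof.
wlog ab : a b / a <= b => [h|].
  by have [/h//|/ltW/h] := leP a b; rewrite distrC (distrC a).
rewrite !(distrC _ (Num.min b c)) (distrC a) [leRHS]ger0_norm ?subr_ge0//.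
rewrite ger0_norm.
  rewrite !minEle; repeat case: ifPn; rewrite -?ltNge => *; lra.
rewrite subr_ge0 !minEle; repeat case: ifPn; rewrite -?ltNge => *; lra.
Qed.

Section coarea_square.
Context (R : realType) (X : completeMetricType R).
Variable m : {measure set (borel X) -> \bar R}.
Hypothesis mfin : (m setT < +oo)%E.
Let V := fine (m setT).
Variables (h q om : R).
Hypothesis h0 : 0 <= h.
Hypothesis q0 : 0 <= q.
Hypothesis hP : forall A : set (borel X), measurable A ->
  (m A <= (V / 2)%:E -> h%:E * m A <= Per m A)%E.
Hypothesis omP : forall A : set (borel X), measurable A ->
  (m A <= om%:E -> (h + q)%:E * m A <= Per m A)%E.
Implicit Types (g f : X -> R).

Lemma lipschitz_bmf_sl g : lipschitz_in setT g -> @bmf _ (borel X) R (sl g).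
Proof.
move=> [L gL]; split; first by apply: measurable_sl; apply: lipschitz_mcontinuous; exists L.
exists `|L| => x; rewrite ger0_norm ?sl_ge0//; apply: lipschitz_sl_le => // a b.
by rewrite (le_trans (gL a b I I))// ler_wpM2r ?mdist_ge0// ler_norm.
Qed.

Lemma lipschitz_bmf g M : lipschitz_in setT g -> (forall x, `|g x| <= M) ->
  @bmf _ (borel X) R g.
Proof.
by move=> lg gM; split; [apply: mcontinuous_measurable; exact: lipschitz_mcontinuous|exists M].
Qed.

Lemma lipschitz_sqr g M : lipschitz_in setT g -> (forall x, `|g x| <= M) ->
  lipschitz_in setT (fun x => g x ^+ 2).
Proof.
move=> [L gL] gM; exists (L * (M + M)) => x y _ _; rewrite subr_sqr normrM.
have L0 : `|g x - g y| <= L * mdist x y by exact: gL.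
rewrite (@le_trans _ _ ((L * mdist x y) * (M + M)))//; last by rewrite mulrAC.
apply: ler_pM => //; exact: le_trans (ler_normD _ _) (lerD _ _).
Qed.

Lemma sl_sqr_le g x : lipschitz_in setT g -> sl (fun x => g x ^+ 2) x <= 2 * `|g x| * sl g x.
Proof.
move=> lg; have gE := lip_loc_slE x (lipschitz_lip_loc lg).
apply/ler_addgt0Pr => e e0.
have s0 := sl_ge0 g x; have s1 : 0 < sl g x + 1 by rewrite ltr_wpDl.
have cg := lipschitz_mcontinuous lg.
have [r r0 hr] := cg x (e / (sl g x + 1)) ltac:(by rewrite divr_gt0).
have c0 : 0 <= 2 * `|g x| + e / (sl g x + 1) by apply: addr_ge0; [rewrite mulr_ge0|apply: divr_ge0; exact: ltW].
have H y : mdist x y < r -> `|g y ^+ 2 - g x ^+ 2| <=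
    (2 * `|g x| + e / (sl g x + 1)) * `|g y - g x| + 0 * mdist x y.
  move=> /hr gxy; rewrite mul0r addr0 subr_sqr normrM mulrC ler_wpM2r//.
  have -> : g y + g x = (g y - g x) + 2 * g x by ring.
  rewrite (le_trans (ler_normD _ _))// normrM (ger0_norm (ler0n _ _)) addrC lerD2l.
  by rewrite distrC ltW.
have [_] := sl_comp_le gE r0 c0 (lexx 0) H; rewrite addr0 => /le_trans; apply.
rewrite mulrDl lerD2l mulrAC ler_pdivrMr// ler_wpM2l ?lerDl// ltW//.
Qed.

(** Integrating the isoperimetric bounds over the superlevel sets of [g^2]:
    above the level [T], where the sets are small, the better bound applies. *)
Lemma coarea_sqr g M T : lipschitz_in setT g -> (forall x, 0 <= g x <= M) -> 0 <= T ->
  (m [set x | 0 < g x]%R <= (V / 2)%:E)%E -> (m [set x | T < g x]%R <= om%:E)%E ->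
  h * \int[m]_x (g x ^+ 2) + q * \int[m]_x Num.max (g x ^+ 2 - T ^+ 2) 0 <=
  \int[m]_x sl (fun x => g x ^+ 2) x.
Proof.
move=> lg gM T0 mV mT.
have gM' x : `|g x| <= M by have /andP[? ?] := gM x; rewrite ger0_norm.
have bg := lipschitz_bmf lg gM'; have mg := bg.1.
have lg2 := lipschitz_sqr lg gM'.
have bg2 : @bmf _ (borel X) R (fun x => g x ^+ 2) by exact: bmfX.
have bs := lipschitz_bmf_sl lg2.
have bmx a : @bmf _ (borel X) R (fun x => Num.max (g x ^+ 2 - a) 0).
  by apply: bmf_max; [apply: bmfB => //; exact: bmf_cst|exact: bmf_cst].
rewrite -lee_fin RintE//.
pose ch (k a s : R) : \bar R := (k%:E * (if (a < s)%R then m [set x | (s < g x ^+ 2)%R] else 0))%E.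
have ch0 k a s : 0 <= k -> (0 <= ch k a s)%E by move=> k0; apply: mule_ge0; [rewrite lee_fin|case: ifP].
have mch k a : measurable_fun setT (ch k a).
  apply: measurable_funeM; apply: measurable_fun_ifT => //; first exact: measurable_fun_ltr.
  exact: (measurable_ccdf mfin bg2.1).
have Ich k a : 0 <= k -> (\int[lebesgue_measure]_s ch k a s = (k * \int[m]_x Num.max (g x ^+ 2 - a) 0)%:E)%E.
  move=> k0; rewrite ge0_integralZl//; last first.
  - by move=> s _; case: ifP.
  - apply: measurable_fun_ifT => //; first exact: measurable_fun_ltr.
    exact: (measurable_ccdf mfin bg2.1).
  rewrite EFinM RintE// -(layer_cake mfin a bg2.1); congr (_ * _)%E.
  by rewrite [RHS]integral_mkcond; apply: eq_integral => s _; rewrite patchE mem_setE in_itv/= andbT.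
apply: (@le_trans _ _ (\int[lebesgue_measure]_s (ch h 0%R s + ch q (T ^+ 2)%R s))%E).
  rewrite ge0_integralD//; try exact: mch; try by move=> *; exact: ch0.
  rewrite !Ich// -EFinD lee_fin lerD2r; apply: ler_wpM2l => //.
  by apply: Rint_le => // x; rewrite subr0 le_max lexx.
apply: (@coarea_per _ _ m mfin _ (fun s => ch h 0%R s + ch q (T ^+ 2)%R s)%E lg2) => [|s|s].
- exact: emeasurable_funD.
- by rewrite adde_ge0// ch0.
rewrite /ch; case: ifPn => [s0|]; last first.
  rewrite -leNgt => s0; rewrite ifF ?mule0 ?adde0; last first.
    by apply/negbTE; rewrite -leNgt (le_trans s0)// sqr_ge0.
  by apply: le_ereal_inf_tmp => _ [f_ _ <-]; rewrite -[leLHS]limn_einf_cst; apply: le_limn_einf => n; apply: integral_ge0 => x _; exact: slope_ge0.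
have mA : measurable ([set x | s < g x ^+ 2] : set (borel X)).
  exact: measurable_superlevel bg2.1.
have sub0 : [set x | s < g x ^+ 2] `<=` [set x | 0 < g x].
  move=> x /= sx; have /andP[g0 _] := gM x; rewrite lt_neqAle g0 andbT eq_sym.
  by apply: contraTneq sx => ->; rewrite expr0n/= -leNgt ltW.
case: ifPn => [Ts|_].
  apply: (le_trans _ (omP mA _)).
    by rewrite EFinD ge0_muleDl// lee_fin.
  apply: le_trans mT; apply: le_measure => /=; rewrite ?inE//.
    exact: measurable_superlevel mg.
  move=> x /= sx; rewrite -(@ltr_pXn2r _ 2)// ?nnegrE//; first exact: lt_trans sx.
  by have /andP[] := gM x.
rewrite mule0 adde0; apply: hP => //; apply: le_trans mV; apply: le_measure => //=; rewrite ?inE//.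
exact: measurable_superlevel mg.
Qed.

End coarea_square.

Section quantiles.
Context (R : realType) (X : completeMetricType R).
Variable m : {measure set (borel X) -> \bar R}.
Variable om : R.
Hypothesis om0 : 0 < om.
Implicit Types (g : X -> R).

(** The quantile of [g] at [om] need not satisfy both bounds when [g] has level
    sets of positive measure; two nearby levels on its two sides do. *)
Lemma quantile_pair g M eta : measurable_fun setT (g : borel X -> R) ->
  (forall x, 0 <= g x <= M) -> 0 < eta ->
  exists t T, [/\ 0 <= t <= T, T ^+ 2 - t ^+ 2 <= eta,
    (m [set x | T < g x]%R <= om%:E)%E &
    t = 0 \/ (om%:E <= m [set x | t < g x]%R)%E].
Proof.
move=> mg gM eta0; pose S := [set t | 0 <= t /\ (om%:E < m [set x | t < g x]%R)%E].
have [S0|/set0P[s0 Ss0]] := eqVneq S set0.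
  exists 0, 0; split; [by rewrite lexx|by rewrite subrr ltW| |by left].
  rewrite leNgt; apply/negP => mo; have : S 0 by split.
  by rewrite S0.
have SM s : S s -> s <= M.
  move=> [_ oms]; rewrite leNgt; apply/negP => Ms; move: oms.
  rewrite (_ : [set x | _] = set0) ?measure0 ?lte_fin ?ltNge ?ltW//.
  by apply/seteqP; split => x //= sx; move: (lt_trans Ms sx); have /andP[_ +] := gM x; rewrite leNgt => /negP.
have hS : has_sup S by split; [exists s0|exists M => s; exact: SM].
have M0 : 0 <= M by rewrite (le_trans _ (SM _ Ss0))//; case: Ss0.
pose e := Num.min 1 (eta / (4 * (M + 1))).
have M4 : 0 < 4 * (M + 1) by rewrite mulr_gt0// ltr_wpDl.
have e0 : 0 < e by rewrite lt_min ltr01 divr_gt0.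
have [t St te] := sup_adherent e0 hS.
have supM : sup S <= M by apply: ge_sup; [exists s0|exact: SM].
have tsup : t <= sup S by apply: ub_le_sup => //; case: hS.
exists t, (sup S + e); split.
- by case: (St) => -> _/=; rewrite (le_trans tsup)// lerDl ltW.
- have e1 : e <= 1 by rewrite ge_min lexx.
  have : e * (4 * (M + 1)) <= eta by rewrite -ler_pdivlMr// ge_min lexx orbT.
  have t0 : 0 <= t by case: St.
  rewrite subr_sqr; set a := sup S in te supM tsup *; move=> he.
  have : (a + e - t) * (a + e + t) <= (2 * e) * (2 * (M + 1)).
    apply: ler_pM; lra.
  lra.
- rewrite leNgt; apply/negP => h1; suff : sup S + e <= sup S by rewrite gerDl leNgt e0.
  apply: ub_le_sup; first by case: hS.
  by split => //; rewrite addr_ge0 ?(ltW e0)// (le_trans _ tsup)//; case: St.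
- by right; case: St => _ /ltW.
Qed.

End quantiles.

(** An explicit excess over [h ^+ 2 / 4], where [om] is the measure below which
    the isoperimetric bound doubles; it is far from sharp. *)
Definition cheeger_gain (R : realType) (V h om : R) : R :=
  h ^+ 2 / 64 * Num.min 1 (om / (V + 1)).

Lemma cheeger_gain_gt0 (R : realType) (V h om : R) : 0 <= V -> 0 < h -> 0 < om ->
  0 < cheeger_gain V h om.
Proof.
by move=> V0 h0 om0; rewrite mulr_gt0 ?divr_gt0 ?exprn_gt0// lt_min ltr01 divr_gt0// ltr_wpDl.
Qed.

(** Assume that the Rayleigh quotient is smaller, and let [N] be the integral of
    [g ^+ 2]. Cheeger's argument with the bound doubled above [T], combined with
    Cheeger's inequality for the truncation [min g t], shows that the parts of [N]
    above the level [T] and over the set [g > t] are both a small multiple of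
    [N * min 1 (om / (V + 1))]. But [g > t] has measure at least [om], so the
    second part is at least [t ^+ 2 * om], whereas [N] is at most [T ^+ 2 * V] plus
    the first part; this is contradictory for [t] close to [T]. *)
Lemma onesided_gap (R : realType) (X : completeMetricType R)
    (m : {measure set (borel X) -> \bar R}) (h om : R) (g : X -> R) (M : R) :
  (m setT < +oo)%E -> 0 < h -> 0 < om ->
  (forall A : set (borel X), measurable A ->
    (m A <= (fine (m setT) / 2)%:E -> h%:E * m A <= Per m A)%E) ->
  (forall A : set (borel X), measurable A ->
    (m A <= om%:E -> (h + h)%:E * m A <= Per m A)%E) ->
  lipschitz_in setT g -> (forall x, 0 <= g x <= M) ->
  (m [set x | 0 < g x]%R <= (fine (m setT) / 2)%:E)%E ->
  (h ^+ 2 / 4 + cheeger_gain (fine (m setT)) h om) * \int[m]_x (g x ^+ 2) <=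
  \int[m]_x (\1_[set x | 0 < g x] x * sl g x ^+ 2).
Proof.
move=> mfin h0 om0 hP omP lg gM; set V := fine (m setT) in hP *; move=> mV.
have V0 : 0 <= V by exact: fine_ge0.
have th0 := cheeger_gain_gt0 V0 h0 om0; set theta := cheeger_gain V h om in th0 *.
have gM' x : `|g x| <= M by have /andP[? ?] := gM x; rewrite ger0_norm.
have bg := lipschitz_bmf lg gM'; have mg := bg.1.
have bg2 : @bmf _ (borel X) R (fun x => g x ^+ 2) by exact: bmfX.
have bs := lipschitz_bmf_sl lg.
have bs2 : @bmf _ (borel X) R (fun x => sl g x ^+ 2) by exact: bmfX.
have mS s : measurable ([set x | s < g x] : set (borel X)) by exact: measurable_superlevel mg.
set N := \int[m]_x (g x ^+ 2); set E := (X in _ <= X).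
rewrite leNgt; apply/negP => Elt.
have bE : @bmf _ (borel X) R (fun x => \1_[set x | 0 < g x] x * sl g x ^+ 2).
  by apply: bmfM => //; exact: bmf_indic.
have E0 : 0 <= E.
  by apply: Rintegral_ge0 => x _; rewrite mulr_ge0 ?sqr_ge0// indicE.
have H0 : 0 < h ^+ 2 by rewrite exprn_gt0.
have N0 : 0 < N.
  have c0 : 0 < h ^+ 2 / 4 + theta by rewrite addr_gt0// divr_gt0.
  by rewrite -(pmulr_rgt0 _ c0) (le_lt_trans E0).
suff key eta : 0 < eta -> N <= 3 / 8 * N + eta.
  by have := key (N / 4) ltac:(by rewrite divr_gt0); lra.
move=> eta0.
pose r := Num.min 1 (om / (V + 1)).
have V1 : 0 < V + 1 by rewrite ltr_wpDl.
have r0 : 0 < r by rewrite lt_min ltr01 divr_gt0.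
have r1 : r <= 1 by rewrite ge_min lexx.
have rV : r * (V + 1) <= om by rewrite -ler_pdivlMr// ge_min lexx orbT.
have Vom : 0 < 4 * (V + 1 + om) by rewrite mulr_gt0// addr_gt0.
have ep : 0 < eta * r / (4 * (V + 1 + om)) by rewrite divr_gt0// mulr_gt0.
have [t [T [/andP[t0 tT] tTe mT mt]]] := quantile_pair m om0 mg gM ep.
have T0 : 0 <= T by exact: le_trans tT.
set e := eta * r / _ in ep tTe.
have eV : e * (4 * (V + 1 + om)) = eta * r by rewrite /e divfK// gt_eqF.
pose i1 := \1_[set x | 0 < g x] \- \1_[set x | t < g x] : borel X -> R.
pose i2 := \1_[set x | t < g x] : borel X -> R.
have bi2 : bmf i2 by exact: bmf_indic.
have bi1 : bmf i1 by apply: bmfB => //; exact: bmf_indic.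
have i1E x : i1 x = if (0 < g x) && (g x <= t) then 1 else 0.
  rewrite /i1 /= !indic_ite; case: (ltP 0 (g x)) => g0.
    by case: (leP (g x) t) => gt /=; rewrite ?subr0 ?subrr.
  by rewrite ltNge (le_trans g0)//= subrr.
have i2E x : i2 x = if t < g x then 1 else 0 by rewrite /i2 indic_ite.
set E1 := \int[m]_x (i1 x * sl g x ^+ 2).
set E2 := \int[m]_x (i2 x * sl g x ^+ 2).
set N2 := \int[m]_x (i2 x * g x ^+ 2).
set XX := \int[m]_x Num.max (g x ^+ 2 - T ^+ 2) 0.
have bX : @bmf _ (borel X) R (fun x => Num.max (g x ^+ 2 - T ^+ 2) 0).
  by apply: bmf_max; [apply: bmfB => //; exact: bmf_cst|exact: bmf_cst].
have EE : E = E1 + E2.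
  rewrite /E1 /E2 -RintD//; [|exact: bmfM|exact: bmfM].
  by apply: eq_Rintegral => x _; rewrite -mulrDl /i1/= subrK.
have b1 : @bmf _ (borel X) R (fun x => i1 x * sl g x ^+ 2) by exact: bmfM.
have b2 : @bmf _ (borel X) R (fun x => i2 x * sl g x ^+ 2) by exact: bmfM.
have b3 : @bmf _ (borel X) R (fun x => i2 x * g x ^+ 2) by exact: bmfM.
have bZ c f' : @bmf _ (borel X) R f' -> @bmf _ (borel X) R (fun x => c * f' x).
  by move=> bf; apply: bmfM => //; exact: bmf_cst.
(* Young's inequality with weights balanced at [sl g = h / 2 * g] up to the
   level [t], and with a smaller weight on [g] above it *)
have Ha : h ^+ 2 * (N + XX) <= 2 * E1 + 4 * E2 + (h ^+ 2 / 2 * N - h ^+ 2 / 4 * N2).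
  have := coarea_sqr mfin (ltW h0) (ltW h0) hP omP lg gM T0 mV mT.
  rewrite -mulrDr -/N -/XX => /(ler_wpM2l (ltW h0)).
  rewrite mulrA -expr2 => /le_trans; apply.
  rewrite -RintZ//; last by apply: lipschitz_bmf_sl; exact: lipschitz_sqr gM'.
  rewrite /E1 /E2 /N /N2 -!RintZ// -RintD//; try exact: bZ.
  rewrite -RintB//; try exact: bZ.
  rewrite -RintD; [|by []| |]; last 2 first.
  - by apply: bmfD; exact: bZ.
  - by apply: bmfB; exact: bZ.
  apply: Rint_le => //.
  - by apply: bZ; apply: lipschitz_bmf_sl; exact: lipschitz_sqr gM'.
  - by apply: bmfD; [apply: bmfD|apply: bmfB]; exact: bZ.
  move=> x; have := sl_sqr_le x lg; have /andP[gx0 _] := gM x; rewrite (ger0_norm gx0).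
  move/(ler_wpM2l (ltW h0)) => /le_trans; apply; rewrite i1E i2E.
  set s := sl g x; set a := g x in gx0 *; have s0 : 0 <= s := sl_ge0 _ _.
  have q1 := sqr_ge0 (2 * s - h * a); have q2 := sqr_ge0 (4 * s - h * a).
  rewrite !expr2 in q1 q2 *; case: (ltP t a) => ta.
    rewrite andbF; move: q1 q2 s0 gx0; clear; lra.
  case: (ltP 0 a) => a0 /=; first by move: q1 q2 s0 gx0; clear; lra.
  have -> : a = 0 by apply/eqP; rewrite eq_le a0.
  by move: q1 q2 s0; clear; lra.
(* the truncation at level [t] has no energy on [g > t] *)
have Hb : h ^+ 2 / 4 * (N - XX - e * V) <= E1.
  pose g1 x := Num.min (g x) t.
  have lg1 : lipschitz_in setT g1.
    have [L gL] := lg; exists L => x y _ _; rewrite (le_trans (minr_dist _ _ _))//.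
    exact: gL.
  have g1M x : 0 <= g1 x <= M.
    have /andP[? ?] := gM x; rewrite /g1 le_min t0 andbT ge_min.
    by apply/andP; split => //; apply/orP; left.
  have g1M' x : `|g1 x| <= M by have /andP[? ?] := g1M x; rewrite ger0_norm.
  have b4 : @bmf _ (borel X) R (fun x => g1 x ^+ 2).
    by apply: bmfX; exact: lipschitz_bmf lg1 g1M'.
  have g1V : (m [set x | 0 < g1 x]%R <= (V / 2)%:E)%E.
    apply: le_trans mV; apply: le_measure => /=; rewrite ?inE//.
      by apply: measurable_superlevel; exact: (lipschitz_bmf lg1 g1M').1.
    by move=> x /=; rewrite /g1 lt_min => /andP[].
  have g1T : (m [set x | T < g1 x]%R <= om%:E)%E.
    rewrite (_ : [set x | _] = set0) ?measure0 ?lee_fin ?ltW//.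
    by apply/seteqP; split => x //=; rewrite /g1 lt_min => /andP[_]; rewrite ltNge tT.
  have := coarea_sqr mfin (ltW h0) (ltW h0) hP omP lg1 g1M T0 g1V g1T; rewrite -mulrDr.
  have X0 : 0 <= \int[m]_x Num.max (g1 x ^+ 2 - T ^+ 2) 0.
    by apply: Rintegral_ge0 => x _; rewrite le_max lexx orbT.
  set N1 := \int[m]_x (g1 x ^+ 2) => h1.
  have sg x : h * sl (fun x => g1 x ^+ 2) x <= 2 * (i1 x * sl g x ^+ 2) + h ^+ 2 / 2 * g1 x ^+ 2.
    have g2 := sl_sqr_le x lg1.
    have q0 : 0 <= h ^+ 2 / 2 * g1 x ^+ 2 by rewrite mulr_ge0 ?sqr_ge0// divr_ge0// ltW.
    have [tg|gt] := ltP t (g x).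
      have [b b0 hb] := open_mdist (mcontinuous_open_gt t (lipschitz_mcontinuous lg)) tg.
      have [] := @sl_le _ _ (fun x => g1 x ^+ 2) x b 0 b0 (lexx 0).
        move=> y /hb /= ty; rewrite /g1 !min_r ?subrr ?normr0 ?mul0r// ltW//.
      move=> _ s0; rewrite (_ : sl _ x = 0); last by apply/eqP; rewrite eq_le s0 sl_ge0.
      by rewrite mulr0 addr_ge0// mulr_ge0// mulr_ge0 ?sqr_ge0// i1E; case: ifP.
    have g1x : g1 x = g x by rewrite /g1 min_l.
    have s1s : sl g1 x <= sl g x.
      have hc y : mdist x y < 1 -> `|g1 y - g1 x| <= 1 * `|g y - g x| + 0 * mdist x y.
        by move=> _; rewrite mul1r mul0r addr0 minr_dist.
      have [_] := sl_comp_le (lip_loc_slE x (lipschitz_lip_loc lg)) ltr01 ler01 (lexx 0) hc.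
      by rewrite mul1r addr0.
    have /andP[gx0 _] := g1M x; rewrite (ger0_norm gx0) g1x in g2.
    rewrite i1E gt andbT g1x; rewrite g1x in gx0.
    set s := sl g x in s1s *; set s' := sl g1 x in s1s g2; set a := g x in gx0 g2 *.
    have s'0 : 0 <= s' := sl_ge0 _ _; have q1 := sqr_ge0 (2 * s - h * a).
    case: (ltP 0 a) => a0.
      have g3 : sl (fun x => g1 x ^+ 2) x <= 2 * a * s.
        by rewrite (le_trans g2)// ler_wpM2l// mulr_ge0.
      have := ler_wpM2l (ltW h0) g3; rewrite !expr2 in q1 *; move: q1; clear; lra.
    have a00 : a = 0 by apply/eqP; rewrite eq_le a0.
    have := ler_wpM2l (ltW h0) g2; rewrite a00; have s00 := sqr_ge0 s; rewrite !expr2 in q1 s00 *; move: s00; clear; lra.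
  have h2 : h ^+ 2 * N1 <= 2 * E1 + h ^+ 2 / 2 * N1.
    have bs1 : @bmf _ (borel X) R (sl (fun x => g1 x ^+ 2)).
      by apply: lipschitz_bmf_sl; exact: lipschitz_sqr g1M'.
    have := ler_wpM2l (ltW h0) (le_trans (ler_wpM2l (ltW h0) (_ : N1 <= N1 + _)) h1).
    rewrite lerDl X0 => /(_ isT); rewrite mulrA -expr2 => /le_trans; apply.
    rewrite /E1 /N1 -!RintZ// -RintD; [|by []|exact: bZ|exact: bZ].
    by apply: Rint_le => //; [exact: bZ|apply: bmfD; exact: bZ].
  have h3 : N - XX - e * V <= N1.
    rewrite /N /XX /N1 -Rint_cst -RintB// -RintB; [|by []|exact: bmfB|exact: bmf_cst].
    apply: Rint_le => //; first by apply: bmfB; [exact: bmfB|exact: bmf_cst].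
    move=> x; rewrite /g1; have /andP[gx0 _] := gM x.
    have e0 : 0 <= e.
      by rewrite (le_trans _ tTe)// subr_ge0 ler_pXn2r ?nnegrE.
    have [gt|tg] := leP (g x) t.
      rewrite -addrA gerDl -opprD oppr_le0 addr_ge0// le_max lexx orbT//.
    have : g x ^+ 2 - T ^+ 2 <= Num.max (g x ^+ 2 - T ^+ 2) 0 by rewrite le_max lexx.
    by move: tTe; clear; lra.
  have := ler_wpM2l (ltW H0) h3; move: h2; clear; lra.
have Hc : t ^+ 2 * om <= N2.
  have N20 : 0 <= N2 by apply: Rintegral_ge0 => x _; rewrite mulr_ge0 ?sqr_ge0// i2E; case: ifP.
  case: mt => [->|mt]; first by rewrite expr0n mul0r.
  apply: (@le_trans _ _ (t ^+ 2 * \int[m]_x (i2 x))).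
    rewrite ler_wpM2l ?sqr_ge0// Rint_indic// -lee_fin fineK//; exact: mu_fin.
  rewrite -RintZ//; apply: Rint_le => //; first exact: bZ.
  move=> x; rewrite i2E; case: ifP => tg; rewrite ?mulr0 ?mul0r// mulr1 mul1r.
  by rewrite ler_pXn2r ?nnegrE// ?(ltW tg)//; exact: le_trans (ltW tg).
have Hd : N <= T ^+ 2 * V + XX.
  rewrite /N /XX -Rint_cst -RintD; [|by []|exact: bmf_cst|by []].
  apply: Rint_le => //; first by apply: bmfD => //; exact: bmf_cst.
  move=> x; have : g x ^+ 2 - T ^+ 2 <= Num.max (g x ^+ 2 - T ^+ 2) 0 by rewrite le_max lexx.
  by clear; lra.
have He : XX / 2 + N2 / 4 <= r * N / 16 + e * V / 2.
  rewrite -(ler_pM2l H0); move: Elt; rewrite EE /theta /cheeger_gain -/r; move: Ha Hb; clear; lra.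
have XX0 : 0 <= XX by apply: Rintegral_ge0 => x _; rewrite le_max lexx orbT.
have N20 : 0 <= N2 by apply: Rintegral_ge0 => x _; rewrite mulr_ge0 ?sqr_ge0// i2E; case: ifP.
rewrite -(ler_pM2l r0).
have q1 : r * N <= T ^+ 2 * om + r * XX.
  have := ler_wpM2l (ltW r0) Hd; have : T ^+ 2 * (r * (V + 1)) <= T ^+ 2 * om.
    by rewrite ler_wpM2l ?sqr_ge0.
  have := mulr_ge0 (sqr_ge0 T) (ltW r0); clear; lra.
have q2 : (T ^+ 2 - t ^+ 2) * om <= e * om by rewrite ler_wpM2r// ltW.
have q3 : r * XX <= XX by rewrite ler_piMl.
have q4 : 0 <= e * V by rewrite mulr_ge0// ltW.
have q5 : 0 <= e * om by rewrite mulr_ge0// ltW.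
have q6 : r * XX <= r * (r * N / 8 + e * V) by rewrite ler_wpM2l ?(ltW r0)//; move: He N20; clear; lra.
have q7 : r * (r * N) <= r * N by rewrite ler_piMl// mulr_ge0// ltW.
have q8 : r * (e * V) <= e * V by rewrite ler_piMl.
by move: q1 q2 q3 q4 q5 q6 q7 q8 ep Hc He eV XX0 N20; clear; lra.
Qed.

Section rayleigh_quotient.
Context (R : realType) (X : completeMetricType R).
Variable m : {measure set (borel X) -> \bar R}.
Hypothesis mfin : (m setT < +oo)%E.
Let V := fine (m setT).
Implicit Types (g f : X -> R).

Let V0 : 0 <= V. Proof. exact: fine_ge0. Qed.

Lemma superlevel_right_cont (f : borel X -> R) c (B : \bar R) : measurable_fun setT f ->
  (forall n, m [set x | c + n.+1%:R^-1 < f x]%R <= B)%E ->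
  (m [set x | c < f x]%R <= B)%E.
Proof.
move=> mf fB; pose F n := [set x | c + n.+1%:R^-1 < f x].
have mF n : measurable (F n) by exact: measurable_superlevel.
have FE : [set x | c < f x] = \bigcup_n F n.
  apply/seteqP; split => x /=.
    rewrite -subr_gt0 => cf; have [N _ HN] := near_infty_natSinv_lt (PosNum cf).
    by exists N => //; have := HN N (leqnn N); rewrite /F/= ltrBrDl.
  by move=> [n _]; rewrite /F/=; apply: lt_trans; rewrite ltrDl invr_gt0.
have ndF : nondecreasing_seq F.
  move=> a b ab; apply/subsetPset => x /=; apply: le_lt_trans.
  by rewrite lerD2l lef_pV2 ?posrE// ler_nat ltnS.
rewrite FE; have cv := nondecreasing_cvg_mu (mu := m) mF (bigcupT_measurable _ mF) ndF.
rewrite -(cvg_lim (@ereal_hausdorff R) cv); apply: lime_le; first by apply/cvg_ex; eexists; exact: cv.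
by apply: nearW => n; exact: fB.
Qed.

Lemma median f M : 0 < V -> measurable_fun setT (f : borel X -> R) ->
  (forall x, `|f x| <= M) ->
  exists c, (m [set x | c < f x]%R <= (V / 2)%:E)%E /\
            (m [set x | f x < c]%R <= (V / 2)%:E)%E.
Proof.
move=> Vp mf fM; pose S := [set t | (m [set x | t < f x]%R <= (V / 2)%:E)%E].
have mS s : measurable ([set x | s < f x] : set (borel X)) by exact: measurable_superlevel mf.
have SM : S M.
  rewrite /S/= (_ : [set x | _] = set0) ?measure0 ?lee_fin ?divr_ge0//.
  by apply/seteqP; split => x //=; rewrite ltNge (le_trans (ler_norm _) (fM x)).
have Smono s t : s <= t -> S s -> S t.
  move=> st; apply: le_trans; apply: le_measure; rewrite ?inE//.
  by move=> x /=; exact: le_lt_trans.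
have SlbM : lbound S (- M - 1).
  move=> s Ss; rewrite leNgt; apply/negP => sM; have := Smono _ _ (ltW sM) Ss.
  rewrite /S/= (_ : [set x | _] = setT).
    by rewrite leNgt => /negP; apply; rewrite -[ltRHS]fineK ?mu_fin// lte_fin -/V; lra.
  by apply/seteqP; split => x //= _; have := fM x; rewrite ler_norml; lra.
have hS : has_inf S by split; [exists M|exists (- M - 1)].
exists (inf S); split.
  apply: superlevel_right_cont => // n; have n0 : 0 < n.+1%:R^-1 :> R by rewrite invr_gt0.
  have [s Ss sn] := inf_adherent n0 hS; exact: Smono (ltW sn) Ss.
rewrite (_ : [set x | f x < inf S] = [set x | - inf S < - f x]); last first.
  by apply/seteqP; split => x /=; rewrite ltrN2.
apply: superlevel_right_cont => [|n]; first exact: measurableT_comp.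
set d := n.+1%:R^-1; have d0 : 0 < d by rewrite invr_gt0.
have nS : ~ S (inf S - d).
  move=> Sd; suff h2 : inf S <= inf S - d by move: h2 d0; lra.
  by apply: ge_inf => //; case: hS.
have /negP := nS; rewrite -ltNge => VS.
have subC : [set x | - inf S + d < - f x] `<=` setT `\` [set x | inf S - d < f x].
  by move=> x /= h1; split => //; apply/negP; rewrite -leNgt; lra.
apply: (@le_trans _ _ (m (setT `\` [set x | inf S - d < f x]))).
  by apply: le_measure; rewrite ?inE//; [apply: measurable_superlevel; exact: measurableT_comp|exact: measurableD].
have mfS := mu_fin mfin (mS (inf S - d)).
rewrite -[leLHS]fineK; last by apply: mu_fin => //; exact: measurableD.
rewrite fine_muD// lee_fin -/V; move: VS; rewrite -(fineK mfS) lte_fin; lra.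
Qed.

Lemma lip_bs_bounded f : Lip_bs f -> (exists x, f x <> 0) -> exists M, forall x, `|f x| <= M.
Proof.
move=> [[L fL] bf] [x0 fx0]; have [D D0 hD] := mbounded_diam bf.
exists (`|f x0| + `|L| * D) => x; have [->|fx] := eqVneq (f x) 0.
  by rewrite normr0 addr_ge0// mulr_ge0// ltW.
have -> : f x = f x0 + (f x - f x0) by rewrite addrC subrK.
rewrite (le_trans (ler_normD _ _))// lerD2l (le_trans (fL _ _ I I))//.
have h1 : mdist x x0 <= D by apply: hD; apply: subset_closure => //=; exact/eqP.
apply: le_trans (ler_wpM2l (normr_ge0 L) h1).
by rewrite ler_wpM2r ?mdist_ge0// ler_norm.
Qed.

(** A test function [f] splits at its median [c] into [(f - c)^+] and
    [(f - c)^-], which live on disjoint sets of measure at most [V / 2]; the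
    mean zero condition makes the [L^2] norm of [f] at most that of [f - c]. *)
Lemma lambda1_ge (k : R) : 0 <= k ->
  (forall g M, lipschitz_in setT g -> (forall x, 0 <= g x <= M) ->
    (m [set x | 0 < g x]%R <= (V / 2)%:E)%E ->
    k * \int[m]_x (g x ^+ 2) <= \int[m]_x (\1_[set x | 0 < g x] x * sl g x ^+ 2)) ->
  msupport m = setT -> 0 < V -> (k%:E <= lambda1 m)%E.
Proof.
move=> k0 gap ms Vp; apply: le_ereal_inf_tmp => _ [f [lbf [x0 fx0] If0] <-].
have [M fM] := lip_bs_bounded lbf (ex_intro _ x0 fx0).
have lf := lbf.1; have bf := lipschitz_bmf lf fM; have mf := bf.1.
have bs := lipschitz_bmf_sl lf.
have slE x : slope f x = (sl f x)%:E by apply: lip_loc_slE; exact: lipschitz_lip_loc.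
have bf2 : @bmf _ (borel X) R (fun x => f x ^+ 2) by exact: bmfX.
have bs2 : @bmf _ (borel X) R (fun x => sl f x ^+ 2) by exact: bmfX.
rewrite (_ : \int[m]_x _ = (\int[m]_x (sl f x ^+ 2))%:E)%E; last first.
  by rewrite RintE//; apply: eq_integral => x _; rewrite slE -EFin_expe.
rewrite -RintE//.
have If : \int[m]_x f x = 0 by apply/eqP; rewrite -eqe RintE// If0.
have N0 : 0 < \int[m]_x (f x ^+ 2).
  have cf := lipschitz_mcontinuous lf.
  have fx1 : 0 < `|f x0| / 2 by rewrite divr_gt0// normr_gt0; exact/eqP.
  pose a := `|f x0| / 2; pose U := [set x | a < `|f x|].
  have oU : open U.
    apply: (@mcontinuous_open_gt _ _ (fun x => `|f x|)) => x e e0.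
    have [r r0 hr] := cf x e e0; exists r => // y /hr.
    by apply: le_lt_trans; exact: ler_dist_dist.
  have mU : measurable (U : set (borel X)) by exact: borel_open.
  have Ux0 : U x0 by rewrite /U/= /a; have := fx1; lra.
  have : msupport m x0 by rewrite ms.
  move=> /(_ U oU Ux0) mU0.
  have : a ^+ 2 * \int[m]_x (\1_U x) <= \int[m]_x (f x ^+ 2).
    rewrite -RintZ//; last exact: bmf_indic.
    apply: Rint_le => //; first by apply: bmfM; [exact: bmf_cst|exact: bmf_indic].
    move=> x; rewrite indic_ite; case: ifP => Ua; rewrite ?mulr0 ?sqr_ge0// mulr1.
    by rewrite -[leRHS]real_normK ?num_real// ler_pXn2r ?nnegrE// ltW.
  apply: lt_le_trans; rewrite mulr_gt0 ?exprn_gt0// Rint_indic// fine_gt0// mU0/=.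
  by rewrite ltey_eq mu_fin.
rewrite inver gt_eqF// lee_pdivlMr// -EFinM lee_fin.
have [c [cf fc]] := median Vp mf fM.
pose gp x := Num.max (f x - c) 0; pose gm x := Num.max (c - f x) 0.
have lp : lipschitz_in setT gp.
  have [L fL] := lf; exists L => x y _ _; rewrite (le_trans (maxr_dist _ _ _))//.
  have -> : f x - c - (f y - c) = f x - f y by ring.
  exact: fL.
have lm : lipschitz_in setT gm.
  have [L fL] := lf; exists L => x y _ _; rewrite (le_trans (maxr_dist _ _ _))//.
  have -> : c - f x - (c - f y) = f y - f x by ring.
  by rewrite distrC fL.
have M0 : 0 <= M by rewrite (le_trans _ (fM x0)).
have gpM x : 0 <= gp x <= M + `|c|.
  rewrite /gp le_max lexx orbT/= ge_max addr_ge0// andbT.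
  by have := fM x; have := ler_norm (f x); have := ler_normr; have := lerNnormlW (lexx `|c|); lra.
have gmM x : 0 <= gm x <= M + `|c|.
  rewrite /gm le_max lexx orbT/= ge_max addr_ge0// andbT.
  by have := fM x; have := lerNnormlW (lexx `|f x|); have := ler_norm c; lra.
have gpx x : (0 < gp x) = (c < f x) by rewrite /gp lt_max ltxx orbF subr_gt0.
have gmx x : (0 < gm x) = (f x < c) by rewrite /gm lt_max ltxx orbF subr_gt0.
have Vgp : (m [set x | 0 < gp x]%R <= (V / 2)%:E)%E by under eq_set do rewrite gpx.
have Vgm : (m [set x | 0 < gm x]%R <= (V / 2)%:E)%E by under eq_set do rewrite gmx.
have := gap _ _ lp gpM Vgp; have := gap _ _ lm gmM Vgm.
have slf g x : (forall y, `|g y - g x| <= `|f y - f x|) -> sl g x <= sl f x.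
  move=> gf; have hc y : mdist x y < 1 -> `|g y - g x| <= 1 * `|f y - f x| + 0 * mdist x y.
    by move=> _; rewrite mul1r mul0r addr0.
  have [_] := sl_comp_le (slE x) ltr01 ler01 (lexx 0) hc.
  by rewrite mul1r addr0.
have gp' x : `|gp x| <= M + `|c| by have /andP[? ?] := gpM x; rewrite ger0_norm.
have gm' x : `|gm x| <= M + `|c| by have /andP[? ?] := gmM x; rewrite ger0_norm.
have bgp := lipschitz_bmf lp gp'; have bgm := lipschitz_bmf lm gm'.
have bgp2 : @bmf _ (borel X) R (fun x => gp x ^+ 2) by exact: bmfX.
have bgm2 : @bmf _ (borel X) R (fun x => gm x ^+ 2) by exact: bmfX.
set Ep := (X in _ <= X -> _); set Em := (X in _ -> _ <= X -> _) => gapm gapp.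
have EE : Em + Ep <= \int[m]_x (sl f x ^+ 2).
  have b1 : @bmf _ (borel X) R (fun x => \1_[set x | 0 < gp x] x * sl gp x ^+ 2).
    by apply: bmfM; [apply: bmf_indic; apply: measurable_superlevel; exact: bgp.1|apply: bmfX; exact: lipschitz_bmf_sl].
  have b2 : @bmf _ (borel X) R (fun x => \1_[set x | 0 < gm x] x * sl gm x ^+ 2).
    by apply: bmfM; [apply: bmf_indic; apply: measurable_superlevel; exact: bgm.1|apply: bmfX; exact: lipschitz_bmf_sl].
  rewrite /Ep /Em -RintD//; apply: Rint_le => //; first exact: bmfD.
  have sle g x : sl g x <= sl f x -> sl g x ^+ 2 <= sl f x ^+ 2.
    by move=> h1; rewrite ler_pXn2r// nnegrE sl_ge0.
  have sp x : sl gp x ^+ 2 <= sl f x ^+ 2.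
    apply: sle; apply: slf => y; rewrite (le_trans (maxr_dist _ _ _))//.
    by have -> : f y - c - (f x - c) = f y - f x by ring.
  have sm x : sl gm x ^+ 2 <= sl f x ^+ 2.
    apply: sle; apply: slf => y; rewrite (le_trans (maxr_dist _ _ _))//.
    have -> : c - f y - (c - f x) = f x - f y by ring.
    by rewrite distrC.
  move=> x; rewrite !indic_ite gpx gmx; have s0 := sqr_ge0 (sl f x).
  case: (ltgtP c (f x)) => _; rewrite ?mul1r ?mul0r ?addr0 ?add0r//.
have NN : \int[m]_x (f x ^+ 2) <= \int[m]_x (gp x ^+ 2) + \int[m]_x (gm x ^+ 2).
  have b3 : @bmf _ (borel X) R (fun x => (2 * c) * f x) by apply: bmfM => //; exact: bmf_cst.
  rewrite -[leRHS]addr0 -[X in _ + X](mulr0 (2 * c)) -If -RintZ// -RintD// -RintD//; last exact: bmfD.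
  apply: Rint_le => //; first by apply: bmfD => //; exact: bmfD.
  move=> x; have q := sqr_ge0 c; rewrite /gp /gm; have [cx|xc] := ltP c (f x).
    rewrite (max_l (_ : 0 <= f x - c)) ?subr_ge0 ?(ltW cx)//.
    rewrite (max_r (_ : c - f x <= 0)) ?subr_le0 ?(ltW cx)//; rewrite !expr2 in q *; move: q; clear; lra.
  rewrite (max_r (_ : f x - c <= 0)) ?subr_le0//.
  rewrite (max_l (_ : 0 <= c - f x)) ?subr_ge0//; rewrite !expr2 in q *; move: q; clear; lra.
have := ler_wpM2l k0 NN; rewrite mulrDr; move: gapm gapp EE; clear; lra.
Qed.

End rayleigh_quotient.

(** * Enlargements of sets and a Minkowski coarea inequality *)

Lemma limn_einf_ge (R : realType) (u : (\bar R)^nat) (c : \bar R) :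
  (\forall n \near \oo, (c <= u n)%E) -> (c <= limn_einf u)%E.
Proof.
move=> [N _ HN]; rewrite -[limn_einf _]/(limf_einf _ \oo) limf_einfE.
apply: (@le_trans _ _ (ereal_inf (u @` [set n | (N <= n)%N]))).
  by apply: le_ereal_inf_tmp => _ [n /= Nn <-]; exact: HN.
by apply: ereal_sup_ubound; exists [set n | (N <= n)%N] => //; exists N.
Qed.

(** Fatou's lemma for [C - q n]; the upper limit is expressed pointwise through
    [s] because only an upper bound for it is available in the applications. *)
Lemma reverse_fatou d (T : measurableType d) (R : realType) (m : {measure set T -> \bar R})
    (q : nat -> T -> R) (s : T -> R) (C a : R) : (m setT < +oo)%E ->
  (forall n, bmf (q n)) -> (forall n x, q n x <= C) -> bmf s -> (forall x, s x <= C) ->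
  (forall x e, 0 < e -> \forall n \near \oo, q n x <= s x + e) ->
  (forall n, a <= \int[m]_x q n x) -> a <= \int[m]_x s x.
Proof.
move=> mfin bq qC bs sC qs aq; pose V := fine (m setT).
have bC f : bmf f -> @bmf _ T R (fun x => C - f x).
  by move=> bf; apply: bmfB => //; exact: bmf_cst.
have IC f : bmf f -> \int[m]_x (C - f x) = C * V - \int[m]_x f x.
  by move=> bf; rewrite RintB//; [rewrite Rint_cst|exact: bmf_cst].
suff : ((C * V - \int[m]_x s x)%:E <= (C * V - a)%:E)%E by rewrite lee_fin; lra.
rewrite -IC// RintE//; last exact: bC.
apply: (@le_trans _ _ (limn_einf (fun n => \int[m]_x (C - q n x)%:E))%E); last first.
  rewrite -[leRHS]limn_einf_cst; apply: le_limn_einf => n.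
  by rewrite -RintE//; [rewrite IC// lee_fin lerD2l lerN2|exact: bC].
apply: (@le_trans _ _ (\int[m]_x limn_einf (fun n => (C - q n x)%:E))%E); last first.
  apply: fatou => //.
  - by move=> n; apply/measurable_EFinP; exact: (bC _ (bq n)).1.
  - by move=> n x _; rewrite lee_fin subr_ge0.
apply: ge0_le_integral => //.
- by move=> x _; rewrite lee_fin subr_ge0.
- by apply/measurable_EFinP; exact: (bC _ bs).1.
- apply: measurableT_comp => //; apply: measurable_fun_limn_esup => n.
  by apply: measurableT_comp => //; apply/measurable_EFinP; exact: (bC _ (bq n)).1.
- move=> x _; apply/lee_addgt0Pr => e e0; rewrite -leeBlDr// -EFinB.
  by apply: limn_einf_ge; apply: filterS (qs x e e0) => n h; rewrite lee_fin; lra.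
Qed.

Section minkowski.
Context (R : realType) (X : completeMetricType R).
Implicit Types (A B : set X) (f : X -> R) (x y : X).

Definition mnbhd (r : R) A : set X := [set x | exists2 y, A y & mdist x y < r].

Lemma open_mnbhd r A : open (mnbhd r A).
Proof.
apply: mopenP => x [y Ay xy]; exists (r - mdist x y); first by rewrite subr_gt0.
move=> z xz; exists y => //; rewrite (le_lt_trans (metric_triangle z x y))//.
by rewrite (metric_sym z x) -ltrBrDr.
Qed.

Lemma measurable_mnbhd r A : measurable (mnbhd r A : set (borel X)).
Proof. by apply: borel_open; exact: open_mnbhd. Qed.

Lemma sub_mnbhd r A : 0 < r -> A `<=` mnbhd r A.
Proof. by move=> r0 x Ax; exists x => //; rewrite mdistxx. Qed.

Definition supball (r : R) f x : R := sup (f @` [set y | mdist x y < r]).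

Variable m : {measure set (borel X) -> \bar R}.
Hypothesis mfin : (m setT < +oo)%E.
Let V := fine (m setT).

Section bounded_function.
Variables (f : X -> R) (L : R).
Hypothesis fL : forall x y, `|f x - f y| <= L * mdist x y.
Hypothesis f01 : forall x, 0 <= f x <= 1.
Let L0 : 0 <= `|L|. Proof. exact: normr_ge0. Qed.

Let lf : lipschitz_in setT f. Proof. by exists L => x y _ _; exact: fL. Qed.

Let fLa x y : `|f x - f y| <= `|L| * mdist x y.
Proof. by rewrite (le_trans (fL x y))// ler_wpM2r ?mdist_ge0// ler_norm. Qed.

Let hs r x : 0 < r -> has_sup (f @` [set y | mdist x y < r]).
Proof.
move=> r0; split; first by exists (f x); exists x => //=; rewrite mdistxx.
by exists 1 => _ [y _ <-]; case/andP: (f01 y).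
Qed.

Lemma supball_ge r x : 0 < r -> f x <= supball r f x.
Proof.
move=> r0; apply: ub_le_sup; first by case: (hs x r0).
by exists x => //=; rewrite mdistxx.
Qed.

Lemma supball_le (r c : R) x : 0 < r -> (forall y, mdist x y < r -> f y <= c) ->
  supball r f x <= c.
Proof.
move=> r0 h; apply: ge_sup; first by case: (hs x r0).
by move=> _ [y /= xy <-]; exact: h.
Qed.

Lemma supball_superlevel r s : 0 < r ->
  [set x | s < supball r f x] = mnbhd r [set x | s < f x].
Proof.
move=> r0; apply/seteqP; split => x /=.
  by move=> /(sup_gt (hs x r0).1)[_ [y /= xy <-] sy]; exists y.
move=> [y /= sy xy]; apply: lt_le_trans sy _; apply: ub_le_sup; first by case: (hs x r0).
by exists y.
Qed.

Lemma bmf_supball r : 0 < r -> @bmf _ (borel X) R (supball r f).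
Proof.
move=> r0; split.
  apply: (measurability _ (RGenOInfty.measurableE R)) => _ /= [_ [s ->] <-].
  rewrite setTI (_ : _ @^-1` _ = [set x | s < supball r f x]).
    by rewrite supball_superlevel//; exact: measurable_mnbhd.
  by apply/seteqP; split => x /=; rewrite in_itv/= andbT.
exists 1 => x; rewrite ger0_norm.
  by apply: supball_le => // y _; case/andP: (f01 y).
by apply: le_trans (supball_ge x r0); case/andP: (f01 x).
Qed.

(** Coarea inequality for the Minkowski content: the lower bound [c] on the
    growth of superlevel sets is only used at the scales [r n]. The difference
    quotients of [supball] are bounded by the Lipschitz constant and have upper
    limit at most the slope, so the reverse Fatou lemma applies. *)
Lemma coarea_minkowski (r : nat -> R) (c : R -> \bar R) :
  (forall n, 0 < r n) -> r @ \oo --> 0 ->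
  measurable_fun setT c -> (forall s, 0 <= c s)%E ->
  (forall n (s : R), (0 < s)%R -> m [set x | s < f x]%R + (r n)%:E * c s <=
    m (mnbhd (r n) [set x | s < f x]%R))%E ->
  (\int[lebesgue_measure]_(s in `]0%R, +oo[) c s <= \int[m]_x (sl f x)%:E)%E.
Proof.
move=> r0 rcv mc c0 hc.
have bf : @bmf _ (borel X) R f.
  by apply: (@lipschitz_bmf _ _ f 1) => // x; case/andP: (f01 x) => ? ?; rewrite ger0_norm.
have bs : @bmf _ (borel X) R (sl f) by exact: lipschitz_bmf_sl.
pose q n x := (supball (r n) f x - f x) / r n.
have bq n : @bmf _ (borel X) R (q n).
  by apply: bmfM; [apply: bmfB => //; exact: bmf_supball|exact: bmf_cst].
have qL n x : 0 <= q n x <= `|L|.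
  rewrite /q; apply/andP; split.
    by apply: divr_ge0; [rewrite subr_ge0 supball_ge|exact: ltW].
  rewrite ler_pdivrMr// lerBlDr.
  apply: supball_le => // y xy; rewrite -lerBlDr (le_trans (ler_norm _))//.
  by rewrite (le_trans (fLa _ _))// ler_wpM2l// metric_sym ltW.
have Ic n : (\int[lebesgue_measure]_(s in `]0%R, +oo[) c s <= (\int[m]_x q n x)%:E)%E.
  have e1 := layer_cake mfin 0 bf.1.
  have e2 := layer_cake mfin 0 (bmf_supball (r0 n)).1.
  have Emax (g : X -> R) : (forall x, 0 <= g x) -> (fun x : borel X => (Num.max (g x - 0) 0)%:E) = EFin \o g.
    by move=> g0; apply/funext => x; rewrite /= subr0 max_l.
  rewrite Emax in e1; last by move=> x; case/andP: (f01 x).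
  rewrite Emax in e2; last by move=> x; apply: le_trans (supball_ge x (r0 n)); case/andP: (f01 x).
  have mI : measurable (`]0, +oo[ : set R) by exact: measurable_itv.
  have mcc : measurable_fun (`]0, +oo[ : set R) c by exact: measurable_funTS.
  have mcd : measurable_fun (`]0, +oo[ : set R) (fun s : R => m [set x | s < f x]%R).
    by apply: measurable_funTS; exact: (measurable_ccdf mfin bf.1).
  have : (\int[m]_x (f x)%:E + (r n)%:E * \int[lebesgue_measure]_(s in `]0%R, +oo[) c s <=
      \int[m]_x (supball (r n) f x)%:E)%E.
    rewrite -[X in (X + _ <= _)%E]e1 -[leRHS]e2 -ge0_integralZl//; last by rewrite lee_fin ltW.
    rewrite -ge0_integralD//; last 2 first.
    - by move=> s _; rewrite mule_ge0// lee_fin ltW.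
    - exact: measurable_funeM.
    apply: ge0_le_integral => //.
    - by move=> s _; rewrite adde_ge0// mule_ge0// lee_fin ltW.
    - by apply: emeasurable_funD => //; exact: measurable_funeM.
    - by apply: measurable_funTS; exact: (measurable_ccdf mfin (bmf_supball (r0 n)).1).
    - by move=> s /=; rewrite in_itv/= andbT => s0; rewrite supball_superlevel//; exact: hc.
  rewrite -!RintE//; last exact: bmf_supball.
  rewrite /q RintegralZr//; last first.
    by apply: (bmf_integrable mfin); apply: bmfB => //; exact: bmf_supball.
  rewrite RintB//; last exact: bmf_supball.
  by rewrite EFinM EFinB lee_pdivlMr// addeC leeBrDr// muleC.
have I0 : (0 <= \int[lebesgue_measure]_(s in `]0%R, +oo[) c s)%E by apply: integral_ge0.
have If : (\int[lebesgue_measure]_(s in `]0%R, +oo[) c s)%E \is a fin_num.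
  by rewrite ge0_fin_numE// (le_lt_trans (Ic 0%N))// ltry.
rewrite -(fineK If) -RintE// lee_fin.
apply: (reverse_fatou mfin bq (C := `|L|)) => //.
- by move=> n x; case/andP: (qL n x).
- by move=> x; exact: lipschitz_sl_le.
- move=> x e e0; have se : sl f x < sl f x + e by rewrite ltrDl.
  have [d d0 hd] := sl_lt (lip_loc_slE x (lipschitz_lip_loc lf)) se.
  have /cvgrPdist_lt /(_ _ d0) := rcv; apply: filterS => n.
  rewrite sub0r normrN gtr0_norm// => rd.
  rewrite /q ler_pdivrMr// lerBlDl; apply: supball_le => // y xy.
  rewrite -lerBlDl (le_trans (ler_norm _))// (le_trans (hd y (lt_trans xy rd)))//.
  by rewrite ler_wpM2l ?ltW// (le_lt_trans (sl_ge0 f x)).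
- by move=> n; rewrite -lee_fin fineK.
Qed.

End bounded_function.
End minkowski.

(** * Separability and approximate gluing of transport plans *)

Section separable_space.
Context (R : realType) (X : completeMetricType R).
Hypothesis sepX : separable X.

Lemma dense_sequence : X -> exists q : nat -> X,
  forall x e, 0 < e -> exists n, mdist x (q n) < e.
Proof.
move=> x0; have [D /countable_injP[f finj] dD] := sepX.
pose q n := if pselect (exists2 x, D x & f x = n) is left h then sval (cid2 h) else x0.
exists q => x e e0; have oB : open [set y | mdist x y < e].
  apply: mopenP => y /= xy; exists (e - mdist x y); first by rewrite subr_gt0.
  by move=> z yz; rewrite (le_lt_trans (metric_triangle x y z))// -ltrBrDl.
have [|y [/= xy Dy]] := dD _ _ oB; first by exists x; rewrite /= mdistxx.
exists (f y); rewrite /q; case: pselect => [h|[]]; last by exists y.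
case: (cid2 h) => z Dz fz /=; suff -> : z = y by [].
by apply: finj => //; exact: mem_set.
Qed.

Lemma measurable_mdistl (y : X) :
  measurable_fun setT (fun x : borel X => mdist (x : X) y).
Proof.
apply: mcontinuous_measurable => x e e0; exists e => // z xz.
by rewrite (le_lt_trans _ xz)// !(metric_sym _ y); exact: mdist_distl.
Qed.

Lemma measurable_mdist : measurable_fun setT
  (fun p : borel X * borel X => mdist (p.1 : X) (p.2 : X)).
Proof.
have [h|/set0P[x0 _]] := eqVneq [set: X] set0.
  rewrite (_ : (fun p => _) = cst 0); first exact: measurable_cst.
  by apply/funext => -[p1 p2]; have : [set: X] p1 by []; rewrite h.
have [q qd] := dense_sequence x0.
apply: (measurability _ (RGenInftyO.measurableE R)) => _ /= [_ [r ->] <-].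
rewrite setTI (_ : _ @^-1` _ =
  \bigcup_n [set p : borel X * borel X | mdist (p.1 : X) (q n) + mdist (p.2 : X) (q n) < r]).
  apply: bigcupT_measurable => n.
  rewrite (_ : [set p | _] = (fun p : borel X * borel X =>
     mdist (p.1 : X) (q n) + mdist (p.2 : X) (q n)) @^-1` `]-oo, r[); last first.
    by apply/seteqP; split => p /=; rewrite in_itv.
  rewrite -[X in measurable X]setTI; have : measurable_fun setT (fun p : borel X * borel X =>
     mdist (p.1 : X) (q n) + mdist (p.2 : X) (q n)); last by apply.
  by apply: measurable_funD; apply: (measurableT_comp (measurable_mdistl (q n))).
apply/seteqP; split => -[x y] /=; rewrite in_itv/=.
  move=> xr; have r0 : 0 < (r - mdist x y) / 2 by rewrite divr_gt0// subr_gt0.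
  have [n xn] := qd x _ r0; exists n => //=.
  by have := metric_triangle y x (q n); rewrite (metric_sym y x); lra.
move=> [n _ /=]; apply: le_lt_trans; rewrite (metric_sym y).
exact: metric_triangle.
Qed.

Lemma open_mball (a : X) r : open [set x | mdist a x < r].
Proof.
apply: mopenP => y /= xy; exists (r - mdist a y); first by rewrite subr_gt0.
by move=> z yz; rewrite (le_lt_trans (metric_triangle a y z))// -ltrBrDl.
Qed.

Lemma small_partition (d : R) : 0 < d -> exists C : nat -> set (borel X),
  [/\ forall n, measurable (C n), trivIset setT C, \bigcup_n C n = setT &
      forall n x y, C n x -> C n y -> mdist (x : X) (y : X) <= d].
Proof.
move=> d0; have [h|/set0P[x0 _]] := eqVneq [set: X] set0.
  exists (fun=> set0); split => //; first exact: trivIset_set0.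
  by apply/esym; rewrite bigcup0.
have [q qd] := dense_sequence x0.
pose B n : set (borel X) := [set x : X | mdist (q n) x < d / 2].
have mB n : measurable (B n).
  by apply: borel_open; exact: open_mball.
exists (seqDU B); split.
- by move=> n; apply: measurableD => //; exact: bigsetU_measurable.
- exact: trivIset_seqDU.
- rewrite -seqDU_bigcup_eq; apply/seteqP; split => // x _.
  have d2 : 0 < d / 2 by rewrite divr_gt0.
  by have [n xn] := qd x _ d2; exists n => //; rewrite /B/= metric_sym.
- move=> n x y [+ _] [+ _]; rewrite /B/= => xn yn.
  have := metric_triangle x (q n) y; rewrite (metric_sym x (q n)); lra.
Qed.

End separable_space.

(** Gluing along a countable partition: on each cell [C n] the two plans are
    made conditionally independent given that their middle points lie in [C n].
    The glued plan thus has two middle points, different but in the same cell. *)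
Section approximate_gluing.
Context d1 d2 d3 (T1 : measurableType d1) (T2 : measurableType d2)
  (T3 : measurableType d3) (R : realType).
Variables (pi1 : probability (T1 * T2)%type R) (pi2 : probability (T2 * T3)%type R).
Hypothesis marg : forall A, measurable A -> pi1 (setT `*` A) = pi2 (A `*` setT).
Variable C : nat -> set T2.
Hypothesis mC : forall n, measurable (C n).
Hypothesis tC : trivIset setT C.
Hypothesis UC : \bigcup_n C n = setT.
Local Open Scope ereal_scope.

Lemma approximate_gluing :
  exists s : {measure set ((T1 * T2) * (T2 * T3))%type -> \bar R},
  [/\ forall S, measurable S -> s (S `*` setT) = pi1 S,
      forall S, measurable S -> s (setT `*` S) = pi2 S &
      s (~` \bigcup_n ((setT `*` C n) `*` (C n `*` setT))) = 0].
Proof.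
have mL n : measurable ((setT `*` C n) : set (T1 * T2)%type) by exact: measurableX.
have mR n : measurable ((C n `*` setT) : set (T2 * T3)%type) by exact: measurableX.
have f1 n : pi1 (setT `*` C n) < +oo by rewrite (le_lt_trans (probability_le1 _ _))// ltry.
have f2 n : pi2 (C n `*` setT) < +oo by rewrite (le_lt_trans (probability_le1 _ _))// ltry.
pose e n := fine (pi1 (setT `*` C n)).
have e0 n : (0 <= (e n)^-1)%R by rewrite invr_ge0 fine_ge0.
pose m1 n : {finite_measure set (T1 * T2)%type -> \bar R} := mfrestr (mL n) (f1 n).
pose m2 n : {finite_measure set (T2 * T3)%type -> \bar R} := mfrestr (mR n) (f2 n).
pose s n : {measure set ((T1 * T2) * (T2 * T3))%type -> \bar R} :=
  mscale (NngNum (e0 n)) (m1 n \x m2 n).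
have sE n (S1 : set (T1 * T2)%type) (S2 : set (T2 * T3)%type) : measurable S1 -> measurable S2 ->
    s n (S1 `*` S2) = (e n)^-1%:E * (pi1 (S1 `&` (setT `*` C n)) * pi2 (S2 `&` (C n `*` setT))).
  by move=> mS1 mS2; rewrite /s/= /mscale/= product_measure1E.
have eE n : pi1 (setT `*` C n) = (e n)%:E by rewrite fineK// ge0_fin_numE.
have eE2 n : pi2 (C n `*` setT) = (e n)%:E by rewrite -marg// eE.
have canc n x : (0 <= x) -> (x <= (e n)%:E) -> (e n)^-1%:E * (x * (e n)%:E) = x.
  move=> x0 xe; have [en0|en0] := eqVneq (e n) 0%R.
    by move: xe; rewrite en0 !mule0 => xe; apply/eqP; rewrite eq_le x0 xe.
  by rewrite muleC -muleA -EFinM mulfV// mule1.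
pose L n : set (T1 * T2)%type := setT `*` C n.
pose Rr n : set (T2 * T3)%type := C n `*` setT.
have tL S : trivIset setT (fun n => S `&` L n).
  apply: trivIset_setIl => i j _ _ [[x y] [[_ /= yi] [_ /= yj]]].
  by apply: tC => //; exists y.
have tR S : trivIset setT (fun n => S `&` Rr n).
  apply: trivIset_setIl => i j _ _ [[x y] [[/= yi _] [/= yj _]]].
  by apply: tC => //; exists x.
have UL S : \bigcup_n (S `&` L n) = S.
  rewrite -setI_bigcupr; apply/setIidPl => -[x y] _.
  have [n _ Cn] : (\bigcup_n C n) y by rewrite UC.
  by exists n.
have UR S : \bigcup_n (S `&` Rr n) = S.
  rewrite -setI_bigcupr; apply/setIidPl => -[x y] _.
  have [n _ Cn] : (\bigcup_n C n) x by rewrite UC.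
  by exists n.
exists (mseries s 0); split.
- move=> S mS; rewrite /= /mseries; transitivity (\sum_(0 <= n <oo) pi1 (S `&` L n)).
    apply: eq_eseriesr => n _; rewrite sE// setTI eE2 canc// -eE.
    by apply: le_measure; rewrite ?inE//; exact: measurableI.
  have -> // : pi1 S = \sum_(0 <= n <oo) pi1 (S `&` L n).
  rewrite -[in LHS](UL S); apply: measure_semi_bigcup; last by rewrite UL.
    by move=> n; apply: measurableI => //; exact: mL.
  exact: tL.
- move=> S mS; rewrite /= /mseries; transitivity (\sum_(0 <= n <oo) pi2 (S `&` Rr n)).
    apply: eq_eseriesr => n _; rewrite sE// setTI eE [X in _ * X]muleC canc// -eE2.
    by apply: le_measure; rewrite ?inE//; exact: measurableI.
  have -> // : pi2 S = \sum_(0 <= n <oo) pi2 (S `&` Rr n).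
  rewrite -[in LHS](UR S); apply: measure_semi_bigcup; last by rewrite UR.
    by move=> n; apply: measurableI => //; exact: mR.
  exact: tR.
rewrite /= /mseries eseries0// => n _ _.
have mB k : measurable (L k `*` Rr k) by apply: measurableX; [exact: mL|exact: mR].
apply/eqP; rewrite eq_le measure_ge0 andbT.
apply: (@le_trans _ _ (s n ((~` L n `*` setT) `|` (setT `*` ~` Rr n)))).
  apply: le_measure; rewrite ?inE.
  - by apply: measurableC; exact: bigcupT_measurable.
  - by apply: measurableU; apply: measurableX => //; apply: measurableC; [exact: mL|exact: mR].
  move=> [p q] /= h; have [Lp|] := pselect (L n p); last by left.
  by right; split => // Rq; apply: h; exists n.
have mL' : measurable (~` L n) by apply: measurableC; exact: mL.
have mR' : measurable (~` Rr n) by apply: measurableC; exact: mR.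
have z1 : s n (~` L n `*` [set: T2 * T3]) = 0 by rewrite sE// setICl measure0 mul0e mule0.
have z2 : s n ([set: T1 * T2] `*` ~` Rr n) = 0 by rewrite sE// setICl measure0 !mule0.
have mA : measurable (~` L n `*` [set: T2 * T3]) by exact: measurableX.
have mB' : measurable ([set: T1 * T2] `*` ~` Rr n) by exact: measurableX.
have l1 : s n (~` L n `*` [set: T2 * T3]) <= 0 by rewrite z1.
have l2 : s n ([set: T1 * T2] `*` ~` Rr n) <= 0 by rewrite z2.
apply: le_trans (measureU2 _ mA mB') _; rewrite -[leRHS]adde0; exact: leeD l1 l2.
Qed.
End approximate_gluing.

(** * Transport costs along Wasserstein geodesics *)

Lemma probability_of_measure d (T : measurableType d) (R : realType)
    (mu : {measure set T -> \bar R}) : mu setT = 1%E ->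
  exists P : probability T R, forall A, P A = mu A.
Proof.
move=> mu1; exists [the probability T R of mnormalize mu (dirac point)] => A.
rewrite /= /mnormalize mu1/= ifF; last by apply/negbTE; rewrite negb_or oner_neq0.
by rewrite invr1 mule1.
Qed.

Section chebyshev.
Context d (T : measurableType d) (R : realType).
Variable mu : {measure set T -> \bar R}.

Lemma chebyshev_measure (Z : T -> R) (k : R) : measurable_fun setT Z ->
  (forall x, 0 <= Z x) -> 0 < k ->
  (k%:E * mu [set x | (k <= Z x)%R] <= \int[mu]_x (Z x)%:E)%E.
Proof.
move=> mZ Z0 k0; have mS : measurable [set x | k <= Z x].
  rewrite -[X in measurable X]setTI (_ : [set x | k <= Z x] = Z @^-1` `[k, +oo[).
    exact: mZ.
  by apply/seteqP; split => x /=; rewrite in_itv/= andbT.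
rewrite -integral_cst// integral_mkcond; apply: ge0_le_integral => //.
- by move=> x _; rewrite patchE; case: ifP => // _; rewrite lee_fin ltW.
- by apply/(measurable_restrictT _ _).1 => //; exact: measurable_cst.
- exact/measurable_EFinP.
- by move=> x _; rewrite patchE; case: ifPn => [/set_mem|_]; rewrite lee_fin.
Qed.

End chebyshev.

Lemma integral_image_measure d1 d2 (T1 : measurableType d1) (T2 : measurableType d2)
    (R : realType) (mu : {measure set T1 -> \bar R}) (nu : {measure set T2 -> \bar R})
    (phi : T1 -> T2) (f : T2 -> R) : measurable_fun setT phi -> measurable_fun setT f ->
  (forall x, 0 <= f x) -> (forall S, measurable S -> nu S = mu (phi @^-1` S)) ->
  (\int[nu]_x (f x)%:E = \int[mu]_x (f (phi x))%:E)%E.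
Proof.
move=> mphi mf f0 h; transitivity (\int[pushforward mu phi]_x (f x)%:E)%E.
  by apply: eq_measure_integral => S mS _; rewrite h.
rewrite ge0_integral_pushforward//; first exact/measurable_EFinP.
by move=> x _; rewrite lee_fin.
Qed.

Section midpoints.
Context (R : realType) (X : completeMetricType R).
Hypothesis sepX : separable X.
Implicit Types mu nu : probability (borel X) R.
Local Open Scope ereal_scope.

Definition cost mu nu : \bar R := ereal_inf
  [set \int[pi]_p (mdist (p.1 : X) (p.2 : X) ^+ 2)%:E | pi in coupling mu nu].

Lemma cost_ge0 mu nu : 0 <= cost mu nu.
Proof.
apply: le_ereal_inf_tmp => _ [pi _ <-]; apply: integral_ge0 => p _.
by rewrite lee_fin sqr_ge0.
Qed.

Lemma W2_sqr mu nu : W2 mu nu ^+ 2 = cost mu nu.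
Proof. by rewrite /W2 sqr_sqrte// cost_ge0. Qed.

Lemma eq_coupling mu mu' nu nu' :
  (forall A, measurable A -> mu A = mu' A) ->
  (forall A, measurable A -> nu A = nu' A) -> cost mu nu = cost mu' nu'.
Proof.
move=> hmu hnu; rewrite /cost; congr (ereal_inf (_ @` _)).
by apply/seteqP; split => pi h A mA; have [h1 h2] := h A mA; rewrite h1 h2 hmu// hnu.
Qed.

Lemma near_optimal mu nu (c : R) : cost mu nu < c%:E ->
  exists2 pi, coupling mu nu pi &
    \int[pi]_p (mdist (p.1 : X) (p.2 : X) ^+ 2)%:E < c%:E.
Proof. by move=> /ereal_inf_lt[_ [pi cpi <-] h]; exists pi. Qed.

Lemma geodesic_cost mu0 mu1 (mu_ : R -> probability (borel X) R) (s t : R) : W2_geodesic mu0 mu1 mu_ ->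
  (0 <= s <= 1)%R -> (0 <= t <= 1)%R ->
  cost (mu_ s) (mu_ t) = ((t - s) ^+ 2)%:E * cost mu0 mu1.
Proof.
move=> [_ _ h] s01 t01; rewrite -!W2_sqr h// !expe2 muleACA -EFinM.
by rewrite -!expr2 real_normK ?num_real.
Qed.

(** Glue nearly optimal plans [x -> z] and [z' -> y], with [z] close to [z'], and
    write [a], [b], [c] for the distances from [x] to [z], from [z'] to [y] and from
    [x] to [y]. In the identity
    [a ^+ 2 / t + b ^+ 2 / (1 - t) = (a + b) ^+ 2 + ((1 - t) * a - t * b) ^+ 2 / (t * (1 - t))]
    the left side integrates to the cost along a geodesic, which is also at most
    the integral of [c ^+ 2]. Hence the triangle inequality is nearly an equality
    and [z] lies at a fraction [t] of the way outside a set of small measure. *)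
Lemma midpoint_plan mu0 mu1 (mu_ : R -> probability (borel X) R) (c0 t e : R) : W2_geodesic mu0 mu1 mu_ ->
  cost mu0 mu1 = c0%:E -> (0 < t < 1)%R -> (0 < e)%R ->
  exists (s : {measure set ((borel X * borel X) * (borel X * borel X))%type -> \bar R})
    (B : set ((borel X * borel X) * (borel X * borel X))%type),
  [/\ measurable B, s B <= e%:E,
      (forall w, ~ B w -> mdist (w.1.1 : X) w.1.2 <= t * mdist (w.1.1 : X) w.2.2 + e)%R &
  [/\ forall A, measurable A -> s [set w | A w.1.1] = mu0 A,
      forall A, measurable A -> s [set w | A w.1.2] = mu_ t A &
      forall A, measurable A -> s [set w | A w.2.2] = mu1 A]].
Proof.
move=> geo c0E /andP[t0 t1] e0.
have [_ ends _] := geo.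
have ct : cost mu0 (mu_ t) = (t ^+ 2 * c0)%:E.
  rewrite (@eq_coupling _ (mu_ 0%R) _ (mu_ t))//.
    by rewrite (geodesic_cost geo) ?lexx ?ler01 ?(ltW t0) ?(ltW t1)// subr0 c0E.
  by move=> A mA; have [-> _] := ends A mA.
have ct' : cost (mu_ t) mu1 = ((1 - t) ^+ 2 * c0)%:E.
  rewrite (@eq_coupling _ (mu_ t) _ (mu_ 1%R))//.
    by rewrite (geodesic_cost geo) ?lexx ?ler01 ?(ltW t0) ?(ltW t1)// c0E.
  by move=> A mA; have [_ ->] := ends A mA.
have c00 : (0 <= c0)%R by rewrite -lee_fin -c0E cost_ge0.
pose k : R := (e / 2)%R; have k0 : (0 < k)%R by rewrite divr_gt0.
pose eta : R := Num.min (e * k ^+ 2)%R e.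
have eta0 : (0 < eta)%R by rewrite lt_min e0 mulr_gt0// exprn_gt0.
have tt0 : (0 < t * (1 - t))%R by rewrite mulr_gt0// subr_gt0.
pose e' : R := Num.min 1%R (eta * (t * (1 - t)) / 2)%R.
have e'0 : (0 < e')%R by rewrite lt_min ltr01 divr_gt0// mulr_gt0.
have C0 : (0 < 2 * (5 + 2 * c0))%R by rewrite mulr_gt0// ltr_pwDl// mulr_ge0.
pose dl : R := Num.min (Num.min e 1%R) (eta / (2 * (5 + 2 * c0)))%R.
have dl0 : (0 < dl)%R by rewrite !lt_min e0 ltr01 divr_gt0.
have [pi1 cp1 Ip1] := @near_optimal mu0 (mu_ t) (t ^+ 2 * c0 + e')%R ltac:(by rewrite ct lte_fin ltrDl).
have [pi2 cp2 Ip2] := @near_optimal (mu_ t) mu1 ((1 - t) ^+ 2 * c0 + e')%R ltac:(by rewrite ct' lte_fin ltrDl).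
have [C [mC tC UC dC]] := small_partition sepX dl0.
have marg A : measurable A -> pi1 (setT `*` A) = pi2 (A `*` setT).
  by move=> mA; have [_ ->] := cp1 A mA; have [-> _] := cp2 A mA.
have [s [s1 s2 s3]] := approximate_gluing marg mC tC UC.
have sT : s setT = 1 by rewrite -setXTT s1// probability_setT.
pose W := ((borel X * borel X) * (borel X * borel X))%type.
pose a (w : W) : R := mdist (w.1.1 : X) w.1.2.
pose b (w : W) : R := mdist (w.2.1 : X) w.2.2.
pose c (w : W) : R := mdist (w.1.1 : X) w.2.2.
have md := measurable_mdist sepX.
have ma : measurable_fun setT a by exact: (measurableT_comp md).
have mb : measurable_fun setT b by exact: (measurableT_comp md).
have mp : measurable_fun setT (fun w : W => (w.1.1, w.2.2)).
  by apply: measurable_fun_pair; apply: measurableT_comp.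
have mc : measurable_fun setT c by exact: (measurableT_comp md mp).
pose Z (w : W) : R := (((1 - t) * a w - t * b w) ^+ 2 / (t * (1 - t)) +
  Num.max ((a w + b w + dl) ^+ 2 - c w ^+ 2) 0)%R.
have Z0 w : (0 <= Z w)%R.
  by rewrite addr_ge0 ?divr_ge0 ?sqr_ge0 ?(ltW tt0)// le_max lexx orbT.
have mZ : measurable_fun setT Z.
  apply: measurable_funD.
    apply: measurable_funM => //; apply: measurable_funX; apply: measurable_funB;
    exact: measurable_funM.
  apply: measurable_maxr => //; apply: measurable_funB; apply: measurable_funX => //.
  by apply: measurable_funD => //; exact: measurable_funD.
pose G := \bigcup_n (([set: borel X] `*` C n) `*` (C n `*` [set: borel X])) : set W.
have mG : measurable G.
  by apply: bigcupT_measurable => n; apply: measurableX; exact: measurableX.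
have Gd w : G w -> (mdist (w.1.2 : X) w.2.1 <= dl)%R.
  by move=> [n _ [[_ /= Cz] [/= Cz' _]]]; exact: dC Cz Cz'.
have dle : (dl <= e)%R by rewrite !ge_min lexx.
have dl1 : (dl <= 1)%R by rewrite !ge_min lexx orbT.
pose ca := (t^-1 + dl)%R; pose cb := ((1 - t)^-1 + dl)%R.
have t10 : (0 < 1 - t)%R by rewrite subr_gt0.
have ca0 : (0 <= ca)%R by apply: addr_ge0; rewrite ?invr_ge0; exact: ltW.
have cb0 : (0 <= cb)%R by apply: addr_ge0; rewrite ?invr_ge0; exact: ltW.
(* the excess Z of the glued plan is controlled by the costs of the two plans *)
have key w : G w -> (Z w + c w ^+ 2 <= ca * a w ^+ 2 + cb * b w ^+ 2 + 3 * dl)%R.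
  move=> Gw; have zz := Gd w Gw.
  have abc : (c w <= a w + b w + dl)%R.
    have h1 : (c w <= a w + mdist (w.1.2 : X) w.2.2)%R by exact: metric_triangle.
    have h2 : (mdist (w.1.2 : X) w.2.2 <= mdist (w.1.2 : X) w.2.1 + b w)%R.
      exact: metric_triangle.
    by move: h1 h2 zz; clear; lra.
  have cw0 : (0 <= c w)%R by exact: mdist_ge0.
  have abd : (0 <= a w + b w + dl)%R by exact: le_trans abc.
  rewrite /Z max_l; last by rewrite subr_ge0 ler_pXn2r.
  have -> : (((1 - t) * a w - t * b w) ^+ 2 / (t * (1 - t)) =
      a w ^+ 2 / t + b w ^+ 2 / (1 - t) - (a w + b w) ^+ 2)%R.
    by field; rewrite !gt_eqF.
  have q1 := sqr_ge0 (a w - 1); have q2 := sqr_ge0 (b w - 1).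
  have q3 := mulr_ge0 (ltW dl0) q1; have q4 := mulr_ge0 (ltW dl0) q2.
  have q5 : (dl * dl <= dl)%R by rewrite ler_piMl// ltW.
  by rewrite /ca /cb !expr2 in q3 q4 *; move: q3 q4 q5; clear; lra.
pose sq (p : borel X * borel X) : R := (mdist (p.1 : X) (p.2 : X) ^+ 2)%R.
have msq : measurable_fun setT sq by exact: measurable_funX.
have sq0 p : (0 <= sq p)%R by exact: sqr_ge0.
have Ia : \int[s]_w (a w ^+ 2)%:E <= (t ^+ 2 * c0 + e')%:E.
  have h S : measurable S -> pi1 S = s (fst @^-1` S).
    move=> mS; apply: etrans (esym (s1 S mS)) _.
    by congr (s _); apply/seteqP; split => // -[p q] /= [].
  have <- := integral_image_measure measurable_fst msq sq0 h; exact: ltW Ip1.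
have Ib : \int[s]_w (b w ^+ 2)%:E <= ((1 - t) ^+ 2 * c0 + e')%:E.
  have h S : measurable S -> pi2 S = s (snd @^-1` S).
    move=> mS; apply: etrans (esym (s2 S mS)) _.
    by congr (s _); apply/seteqP; split => // -[p q] /= [].
  have <- := integral_image_measure measurable_snd msq sq0 h; exact: ltW Ip2.
have m11 A : measurable A -> s [set w | A w.1.1] = mu0 A.
  move=> mA; have [<- _] := cp1 A mA; rewrite -s1; last exact: measurableX.
  by congr (s _); apply/seteqP; split => [[[x z] [z' y]]|[[x z] [z' y]]] //= [[]].
have m12 A : measurable A -> s [set w | A w.1.2] = mu_ t A.
  move=> mA; have [_ <-] := cp1 A mA; rewrite -s1; last exact: measurableX.
  by congr (s _); apply/seteqP; split => [[[x z] [z' y]]|[[x z] [z' y]]] //= [[]].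
have m22 A : measurable A -> s [set w | A w.2.2] = mu1 A.
  move=> mA; have [_ <-] := cp2 A mA; rewrite -s2; last exact: measurableX.
  by congr (s _); apply/seteqP; split => [[[x z] [z' y]]|[[x z] [z' y]]] //= [_ []].
have Ic : c0%:E <= \int[s]_w (c w ^+ 2)%:E.
  have [P PE] := @probability_of_measure _ _ R
    [the {measure set _ -> \bar R} of pushforward s (fun w : W => (w.1.1, w.2.2))] sT.
  rewrite -c0E; apply: ereal_inf_lbound; exists P.
    move=> A mA; rewrite !PE /= /pushforward -(m11 A mA) -(m22 A mA).
    by split; congr (s _); apply/seteqP; split => [[[x z] [z' y]]|[[x z] [z' y]]] //= [].
  have h S : measurable S -> P S = s ((fun w : W => (w.1.1, w.2.2)) @^-1` S).
    by move=> mS; rewrite PE.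
  exact: (integral_image_measure mp msq sq0 h).
have ma2 : measurable_fun setT (fun w => (a w ^+ 2)%:E).
  by apply/measurable_EFinP; exact: measurable_funX.
have mb2 : measurable_fun setT (fun w => (b w ^+ 2)%:E).
  by apply/measurable_EFinP; exact: measurable_funX.
have mc2 : measurable_fun setT (fun w => (c w ^+ 2)%:E).
  by apply/measurable_EFinP; exact: measurable_funX.
have Itot : \int[s]_w (Z w)%:E + \int[s]_w (c w ^+ 2)%:E <= (c0 + eta)%:E.
  rewrite -ge0_integralD//; [|by move=> w _; rewrite lee_fin|exact/measurable_EFinP|by move=> w _; rewrite lee_fin sqr_ge0].
  apply: (@le_trans _ _ (\int[s]_w (ca%:E * (a w ^+ 2)%:E + cb%:E * (b w ^+ 2)%:E + (3 * dl)%:E))).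
    apply: ae_ge0_le_integral => //.
    - by move=> w _; rewrite lee_fin addr_ge0// sqr_ge0.
    - by apply: emeasurable_funD => //; exact/measurable_EFinP.
    - move=> w _; rewrite lee_fin addr_ge0 ?mulr_ge0// ?(ltW dl0)//.
      by rewrite addr_ge0// mulr_ge0// sqr_ge0.
    - by apply: emeasurable_funD => //; apply: emeasurable_funD; exact: measurable_funeM.
    - exists (~` G); split; [exact: measurableC|exact: s3|].
      move=> w /= h Gw; apply: h => _; rewrite -!EFinM -!EFinD lee_fin; exact: key.
  rewrite ge0_integralD//; last 3 first.
  - by move=> w _; rewrite -!EFinM -EFinD lee_fin addr_ge0// mulr_ge0// sqr_ge0.
  - by apply: emeasurable_funD; exact: measurable_funeM.
  - by move=> w _; rewrite lee_fin mulr_ge0// ltW.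
  rewrite ge0_integralD//; last 4 first.
  - by move=> w _; rewrite -!EFinM lee_fin mulr_ge0// sqr_ge0.
  - exact: measurable_funeM.
  - by move=> w _; rewrite -!EFinM lee_fin mulr_ge0// sqr_ge0.
  - exact: measurable_funeM.
  rewrite !ge0_integralZl//; try by move=> w _; rewrite lee_fin sqr_ge0.
  rewrite integral_cst// sT mule1.
  apply: (@le_trans _ _ (ca%:E * (t ^+ 2 * c0 + e')%:E + cb%:E * ((1 - t) ^+ 2 * c0 + e')%:E + (3 * dl)%:E)).
    by apply: leeD => //; apply: leeD; rewrite lee_wpmul2l// lee_fin.
  rewrite -!EFinM -!EFinD lee_fin.
  have h1 : (dl * (2 * (5 + 2 * c0)) <= eta)%R by rewrite -ler_pdivlMr// !ge_min lexx orbT.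
  have h2 : (e' <= 1)%R by rewrite ge_min lexx.
  have h3 : (e' / (t * (1 - t)) <= eta / 2)%R.
    by rewrite ler_pdivrMr// mulrAC ge_min lexx orbT.
  have h4 : (e' / (t * (1 - t)) = e' / t + e' / (1 - t))%R by field; rewrite !gt_eqF.
  have h5 : (t ^+ 2 / t = t)%R by rewrite expr2 mulfK// gt_eqF.
  have h6 : ((1 - t) ^+ 2 / (1 - t) = 1 - t)%R by rewrite expr2 mulfK// gt_eqF.
  have -> : (ca * (t ^+ 2 * c0 + e') + cb * ((1 - t) ^+ 2 * c0 + e') + 3 * dl =
    (t ^+ 2 / t) * c0 + ((1 - t) ^+ 2 / (1 - t)) * c0 + (e' / t + e' / (1 - t)) +
    dl * (t ^+ 2 * c0 + (1 - t) ^+ 2 * c0 + 2 * e' + 3))%R by rewrite /ca /cb; ring.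
  rewrite h5 h6 -h4.
  have h7 : (dl * (t ^+ 2 * c0 + (1 - t) ^+ 2 * c0 + 2 * e' + 3) <= dl * (5 + 2 * c0))%R.
    rewrite ler_wpM2l ?(ltW dl0)//.
    have q1 : (t ^+ 2 * c0 <= 1 * c0)%R by rewrite ler_wpM2r// expr_le1 ?ltW.
    have q2 : ((1 - t) ^+ 2 * c0 <= 1 * c0)%R.
      by rewrite ler_wpM2r// expr_le1// ?(ltW t10)// lerBlDr lerDl ltW.
    by move: q1 q2 h2; clear; lra.
  by move: h1 h3 h7; clear; lra.
have IZ : \int[s]_w (Z w)%:E <= eta%:E.
  have -> : eta%:E = (c0 + eta)%:E - c0%:E :> \bar R by rewrite -EFinB addrC addKr.
  rewrite leeBrDr//; exact: le_trans (leeD2l _ Ic) Itot.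
have k20 : (0 < k ^+ 2)%R by rewrite exprn_gt0.
have mS : measurable [set w | (k ^+ 2 <= Z w)%R].
  rewrite -[X in measurable X]setTI (_ : [set w | _] = Z @^-1` `[(k ^+ 2)%R, +oo[%classic).
    exact: mZ.
  by apply/seteqP; split => x /=; rewrite in_itv/= andbT.
exists s, ([set w | (k ^+ 2 <= Z w)%R] `|` ~` G); split => //.
- by apply: measurableU => //; exact: measurableC.
- apply: le_trans (measureU2 _ mS (measurableC mG)) _.
  have l1 : s [set w | (k ^+ 2 <= Z w)%R] <= e%:E.
    rewrite -(@lee_pmul2l _ (k ^+ 2)%:E)// -EFinM.
    apply: le_trans (chebyshev_measure s mZ Z0 k20) _; apply: le_trans IZ _.
    by rewrite lee_fin mulrC ge_min lexx.
  have l2 : s (~` G) <= 0 by rewrite s3.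
  by rewrite -[leRHS]adde0; exact: leeD l1 l2.
- move=> w /not_orP[/= /negP]; rewrite -ltNge => Zk /contrapT /Gd zz.
  have h1 : (((1 - t) * a w - t * b w) ^+ 2 / (t * (1 - t)) < k ^+ 2)%R.
    by apply: le_lt_trans Zk; rewrite lerDl le_max lexx orbT.
  have h2 : ((a w + b w + dl) ^+ 2 - c w ^+ 2 < k ^+ 2)%R.
    apply: le_lt_trans Zk; rewrite /Z.
    have h : ((a w + b w + dl) ^+ 2 - c w ^+ 2 <= Num.max ((a w + b w + dl) ^+ 2 - c w ^+ 2) 0)%R.
      by rewrite le_max lexx.
    by rewrite (le_trans h)// lerDr divr_ge0 ?sqr_ge0// ltW.
  have a0 : (0 <= a w)%R by exact: mdist_ge0.
  have b0 : (0 <= b w)%R by exact: mdist_ge0.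
  have cw0 : (0 <= c w)%R by exact: mdist_ge0.
  have h3 : (a w + b w <= c w + k)%R.
    rewrite -(@ler_pXn2r _ 2)// ?nnegrE ?addr_ge0// ?(ltW k0)//.
    apply: (@le_trans _ _ ((a w + b w + dl) ^+ 2)%R).
      by rewrite ler_pXn2r// ?nnegrE ?addr_ge0 ?lerDl// ltW.
    have := mulr_ge0 cw0 (ltW k0); rewrite !expr2 in h2 *; move: h2; clear; lra.
  have h4 : (`|(1 - t) * a w - t * b w| <= k)%R.
    rewrite -(@ler_pXn2r _ 2)// ?nnegrE ?(ltW k0)// real_normK ?num_real//.
    move: h1; rewrite ltr_pdivrMr// => /ltW /le_trans; apply.
    by rewrite ler_piMr ?(ltW k20)// mulr_ile1 ?(ltW t0) ?(ltW t1) ?(ltW t10)// gerBl ltW.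
  move: h4; rewrite ler_norml => /andP[h4 h5].
  rewrite -!/(a w) -!/(c w).
  have : (t * (a w + b w) <= t * (c w + k))%R by rewrite ler_wpM2l// ltW.
  have : (t * k <= k)%R by rewrite ler_piMl// ltW.
  rewrite /k in h3 h4 h5 *; move: h3 h4 h5; clear; lra.
Qed.

End midpoints.

(** * Bounds for the entropy *)

Lemma xlnx_tangent (R : realType) (r c : R) : 0 <= r -> 0 < c ->
  r * ln c + r - c <= r * ln r.
Proof.
move=> r0 c0; have [->|rn0] := eqVneq r 0; first by rewrite !mul0r add0r sub0r oppr_le0 ltW.
have rp : 0 < r by rewrite lt_neqAle eq_sym rn0.
have e1 : 1 + (c / r - 1) = c / r by ring.
have := @le_ln1Dx R (c / r - 1); rewrite e1 ltrBrDl addrN divr_gt0// => /(_ isT).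
rewrite ln_div ?posrE// => /(ler_wpM2l r0); rewrite mulrBr mulrBr mulr1 mulrCA mulfV// mulr1.
lra.
Qed.

Section integral_monotone.
Context d (T : measurableType d) (R : realType).
Variable mu : {measure set T -> \bar R}.
Local Open Scope ereal_scope.

(** Monotonicity of the integral when only the smaller function is known to be
    integrable: the integral of the larger one may be [+oo]. *)
Lemma le_integral_lower (g f : T -> R) : mu.-integrable setT (EFin \o g) ->
  measurable_fun setT f -> (forall x, g x <= f x)%R ->
  \int[mu]_x (g x)%:E <= \int[mu]_x (f x)%:E.
Proof.
move=> ig mf gf; have mg : measurable_fun setT (EFin \o g) by case/integrableP: ig.
have mf' : measurable_fun setT (EFin \o f) by exact/measurable_EFinP.
rewrite [leLHS]integralE [leRHS]integralE; apply: leeB.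
  apply: ge0_le_integral => //; first exact: measurable_funepos.
    exact: measurable_funepos.
  move=> x _; rewrite !funeposE /= ge_max !le_max lee_fin gf lexx orbT/= ?andbT//.
apply: ge0_le_integral => //; first exact: measurable_funeneg.
  exact: measurable_funeneg.
by move=> x _; rewrite !funenegE /= ge_max !le_max lee_fin lerN2 gf lexx orbT.
Qed.

End integral_monotone.

Section density_integral.
Context d (T : measurableType d) (R : realType).
Variables (mu nu : {measure set T -> \bar R}) (rho : T -> R).
Hypothesis mufin : (mu setT < +oo)%E.
Hypothesis nufin : (nu setT < +oo)%E.
Hypothesis mrho : measurable_fun setT rho.
Hypothesis rho0 : forall x, 0 <= rho x.
Hypothesis nuE : forall A, measurable A -> nu A = (\int[mu]_(x in A) (rho x)%:E)%E.

Lemma ge0_integral_density (f : T -> R) : measurable_fun setT f -> (forall x, 0 <= f x) ->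
  (\int[nu]_x (f x)%:E = \int[mu]_x (rho x * f x)%:E)%E.
Proof.
move=> mf f0; pose F (z : R * T) : R := (if (0 < z.1) && (z.1 < f z.2) then 1 else 0) * rho z.2.
have mfs : measurable_fun setT (fun z : R * T => f z.2) by exact: measurableT_comp.
have mF : measurable_fun setT F.
  apply: measurable_funM; last exact: measurableT_comp.
  apply: measurable_ite; apply: measurable_and; exact: measurable_fun_ltr.
have F0 z : 0 <= F z by rewrite /F mulr_ge0//; case: ifP.
rewrite (_ : \int[nu]_x _ = \int[nu]_x (Num.max (f x - 0) 0)%:E)%E; last first.
  by apply: eq_integral => x _; rewrite subr0 max_l.
rewrite -layer_cake// [LHS]integral_mkcond.
transitivity (\int[lebesgue_measure]_s \int[mu]_x (F (s, x))%:E)%E.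
  apply: eq_integral => s _; rewrite patchE mem_setE in_itv/= andbT /F/=.
  case: ifP => s0 /=; last by rewrite integral0_eq// => x _; rewrite mul0r.
  rewrite nuE; last exact: measurable_superlevel.
  rewrite integral_mkcond; apply: eq_integral => x _; rewrite patchE.
  case: ifPn => [/set_mem/= ->|]; first by rewrite mul1r.
  by rewrite notin_setE/= => /negP; case: (_ < _); rewrite ?mul0r.
rewrite tonelli_lebesgue//; apply: eq_integral => x _; rewrite /F/=.
have <- : (rho x * (f x - 0))%:E = (rho x * f x)%:E by rewrite subr0.
rewrite -(integral_itv_ite (rho x) false true (f0 x)); apply: eq_integral => s _.
by rewrite in_itv/=; case: ifP; rewrite ?mul1r ?mul0r.
Qed.

Lemma integrable_densityM (f : T -> R) : bmf f -> mu.-integrable setT (EFin \o (fun x => rho x * f x)).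
Proof.
have ir : mu.-integrable setT (EFin \o rho).
  apply/integrableP; split; first exact/measurable_EFinP.
  under eq_integral do rewrite /= ger0_norm//.
  by rewrite -nuE.
move=> [mb [C bC]]; apply: (@le_integrable _ _ _ mu setT measurableT _ (fun x => (C * rho x)%:E)).
- by apply/measurable_EFinP; exact: measurable_funM.
- move=> x _; rewrite /= lee_fin mulrC normrM (ger0_norm (rho0 x)).
  by rewrite normrM (ger0_norm (rho0 x)) ler_wpM2r// (le_trans (bC x))// ler_norm.
- by under eq_fun do rewrite EFinM; exact: integrableZl.
Qed.

Lemma Rintegral_density (f : T -> R) : bmf f -> \int[nu]_x f x = \int[mu]_x (rho x * f x).
Proof.
move=> /[dup] bf [mf [C fC]]; have bC := @bmf_cst _ T R C.
have fC0 x : 0 <= f x + C by have := fC x; rewrite ler_norml; lra.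
have bfC : bmf (fun x => f x + C) by exact: bmfD.
have : \int[nu]_x (f x + C) = \int[mu]_x (rho x * f x + C * (rho x * cst 1 x)).
  rewrite /Rintegral; congr fine.
  rewrite (ge0_integral_density bfC.1)//; apply: eq_integral => x _; congr EFin => /=; ring.
have i1 : mu.-integrable setT (EFin \o (fun x => rho x * cst 1 x)).
  by apply: integrable_densityM; exact: bmf_cst.
rewrite (RintD nufin)// RintegralD//; last 2 first.
- exact: integrable_densityM.
- by rewrite (_ : EFin \o _ = fun x => C%:E * (rho x * cst 1 x)%:E)%E//; exact: integrableZl.
rewrite RintegralZl// Rint_cst.
suff -> : \int[mu]_x (rho x * cst 1 x) = fine (nu setT) by move/addIr.
by rewrite nuE// /Rintegral; congr fine; apply: eq_integral => x _; rewrite mulr1.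
Qed.

End density_integral.

Section entropy.
Context (R : realType) (X : completeMetricType R).
Variable m : {measure set (borel X) -> \bar R}.
Hypothesis mfin : (m setT < +oo)%E.
Let V := fine (m setT).
Implicit Types mu nu : probability (borel X) R.

Lemma measurable_xlnx (rho : borel X -> R) : measurable_fun setT rho ->
  measurable_fun setT (rho_log_rho rho).
Proof.
move=> mr; apply: measurable_funM => //; exact: measurableT_comp.
Qed.

Lemma bmf_xlnx (rho : borel X -> R) (M : R) : measurable_fun setT rho ->
  (forall x, 0 <= rho x <= M) -> bmf (rho_log_rho rho).
Proof.
move=> mr r0M; have mx := measurable_xlnx mr.
split => //; exists (1 + M * `|ln M|) => x; have /andP[r0 rM] := r0M x.
have := xlnx_tangent r0 ltr01; rewrite ln1 mulr0 add0r => h1.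
have h0 : 0 <= M * `|ln M| by rewrite mulr_ge0// (le_trans r0).
have [r00|rn0] := eqVneq (rho x) 0.
  by rewrite /rho_log_rho r00 mul0r normr0 addr_ge0.
have rp : 0 < rho x by rewrite lt_neqAle eq_sym rn0 r0.
have h : rho x * ln (rho x) <= M * `|ln M|.
  rewrite (@le_trans _ _ (rho x * ln M))//.
    by rewrite ler_wpM2l// ler_ln ?posrE// (lt_le_trans rp).
  by rewrite (le_trans (ler_norm _))// normrM ler_wpM2r// ger0_norm.
by rewrite /rho_log_rho ler_norml; apply/andP; split; lra.
Qed.

Lemma ent_le_integral mu rho (M : R) : density m mu rho -> (forall x, rho x <= M) ->
  (Ent m mu <= (\int[m]_x rho_log_rho rho x)%:E)%E.
Proof.
move=> [mr r0 hr] rM.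
have bx : bmf (rho_log_rho rho) by apply: (@bmf_xlnx _ M mr) => x; rewrite r0 rM.
rewrite RintE//; apply: ereal_inf_lbound; exists rho => //; split => //.
by apply: integrable_funrneg => //; exact: bmf_integrable.
Qed.

Lemma ent_le mu rho (M : R) : 0 < M -> density m mu rho -> (forall x, rho x <= M) ->
  (Ent m mu <= (ln M)%:E)%E.
Proof.
move=> M0 dr rM; apply: le_trans (ent_le_integral dr rM) _; have [mr r0 hr] := dr.
have br : bmf rho by split => //; exists M => x; rewrite ger0_norm.
have bx : bmf (rho_log_rho rho) by apply: (@bmf_xlnx _ M mr) => x; rewrite r0 rM.
apply: (@le_trans _ _ (\int[m]_x (ln M * rho x))%:E).
  rewrite lee_fin; apply: Rint_le => //; first by apply: bmfM => //; exact: bmf_cst.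
  move=> x; have [r00|rn0] := eqVneq (rho x) 0; first by rewrite /rho_log_rho r00 mul0r mulr0.
  have rp : 0 < rho x by rewrite lt_neqAle eq_sym rn0 r0.
  by rewrite /rho_log_rho mulrC ler_wpM2r// ler_ln ?posrE.
by rewrite RintZ// EFinM RintE// -hr// probability_setT mule1.
Qed.

(** Gibbs variational principle, from the tangents of [r log r] at [expR (phi x)]. *)
Lemma ent_gibbs mu (phi : borel X -> R) : bmf phi ->
  ((\int[mu]_x phi x + 1 - \int[m]_x expR (phi x))%:E <= Ent m mu)%E.
Proof.
move=> bphi; apply: le_ereal_inf_tmp => _ [rho [[mr r0 hr] irho] <-].
have nufin : (mu setT < +oo)%E by rewrite probability_setT ltry.
have bc : bmf (fun x => expR (phi x)).
  split; first by apply: measurableT_comp => //; exact: bphi.1.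
  have [_ [C hC]] := bphi; exists (expR C) => x; rewrite ger0_norm ?expR_ge0// ler_expR.
  by rewrite (le_trans (ler_norm _)).
have irb := integrable_densityM nufin mr r0 hr.
have ir : m.-integrable setT (EFin \o rho).
  have := irb _ (@bmf_cst _ (borel X) R 1); rewrite (_ : (fun x => _) = rho)//.
  by apply/funext => x; rewrite /= mulr1.
pose g x := rho x * phi x + rho x - expR (phi x).
have ig : m.-integrable setT (EFin \o g).
  rewrite (_ : EFin \o g = ((EFin \o (fun x => rho x * phi x)%R) \+ (EFin \o rho)) \- (EFin \o (fun x => expR (phi x))))%E//.
  apply: integrableB => //; last exact: bmf_integrable.
  by apply: integrableD => //; exact: irb.
have gle x : g x <= rho_log_rho rho x.
  by have := xlnx_tangent (r0 x) (expR_gt0 (phi x)); rewrite expRK.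
apply: le_trans (le_integral_lower ig (measurable_xlnx mr) gle).
suff -> : (\int[m]_x (g x)%:E = (\int[m]_x g x)%:E)%E.
  rewrite lee_fin /g RintegralB//; last 2 first.
  - rewrite (_ : EFin \o _ = (EFin \o (fun x => rho x * phi x)%R) \+ (EFin \o rho))%E//.
    by apply: integrableD => //; exact: irb.
  - exact: bmf_integrable.
  rewrite RintegralD//; last exact: irb.
  rewrite -(Rintegral_density mfin nufin mr r0 hr)//.
  have -> // : \int[m]_x rho x = 1.
  by apply/EFin_inj; rewrite /Rintegral fineK ?integrable_fin_num// -hr// probability_setT.
by rewrite /Rintegral fineK// integrable_fin_num.
Qed.

(** The choice [c1 = 1 / m Z] with [c2] tending to [0] is Jensen's inequality for
    measures concentrated on [Z]. *)
Lemma ent_ge mu (Z : set (borel X)) (c1 c2 : R) : measurable Z -> 0 < c1 -> 0 < c2 ->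
  ((fine (mu Z) * ln c1 + (1 - fine (mu Z)) * ln c2 + 1
    - c1 * fine (m Z) - c2 * (V - fine (m Z)))%:E <= Ent m mu)%E.
Proof.
move=> mZ c10 c20; have nufin : (mu setT < +oo)%E by rewrite probability_setT ltry.
have bZ : bmf (\1_Z : borel X -> R) by exact: bmf_indic.
pose phi x := ln c2 + (ln c1 - ln c2) * \1_Z x.
have bphi : bmf phi by apply: bmfD; [|apply: bmfM => //]; exact: bmf_cst.
apply: le_trans (ent_gibbs mu bphi); rewrite lee_fin.
rewrite (RintD nufin); [|exact: bmf_cst|by apply: bmfM => //; exact: bmf_cst].
have mu1 : fine (mu setT) = 1 by rewrite probability_setT.
rewrite Rint_cst (RintZ nufin)// Rint_indic// mu1.
have -> : \int[m]_x expR (phi x) = c2 * V + (c1 - c2) * fine (m Z).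
  rewrite (_ : (fun x => _) = fun x => c2 + (c1 - c2) * \1_Z x).
    rewrite RintD//; [|exact: bmf_cst|by apply: bmfM => //; exact: bmf_cst].
    by rewrite Rint_cst RintZ// Rint_indic.
  apply/funext => x; rewrite /phi indicE; case: (x \in Z) => /=.
    by rewrite !mulr1 [ln c2 + _]addrC [c2 + _]addrC !subrK lnK ?posrE.
  by rewrite !mulr0 !addr0 lnK ?posrE.
lra.
Qed.

End entropy.

(** * Convexity of the entropy between bounded densities *)

Section density_measure.
Context d (T : measurableType d) (R : realType).
Variables (mu : {measure set T -> \bar R}) (rho : T -> R).
Hypothesis mrho : measurable_fun setT rho.
Hypothesis rho0 : forall x, 0 <= rho x.

Definition dens_measure of measurable_fun setT rho & (forall x, 0 <= rho x) :=
  fun U : set T => (\int[mu]_(x in U) (rho x)%:E)%E.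

Let f := dens_measure mrho rho0.

Let f0 : f set0 = 0%E. Proof. by rewrite /f /dens_measure integral_set0. Qed.

Let fge0 U : (0 <= f U)%E.
Proof. by apply: integral_ge0 => x _; rewrite lee_fin. Qed.

Let fsig : semi_sigma_additive f.
Proof.
move=> F mF tF mUF; rewrite /f /dens_measure; apply: cvg_toP.
  apply: ereal_nondecreasing_is_cvgn => a b ab.
  by apply: lee_sum_nneg_natr => // k _ _; exact: fge0.
rewrite ge0_integral_bigcup//.
- by apply/measurable_EFinP; exact: measurable_funTS.
- by move=> x _; rewrite lee_fin.
Qed.

HB.instance Definition _ := isMeasure.Build _ _ _ (dens_measure mrho rho0) f0 fge0 fsig.

End density_measure.

Section measure_misc.
Context d (T : measurableType d) (R : realType).
Variable mu : {measure set T -> \bar R}.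
Local Open Scope ereal_scope.

Lemma measure_bigcup_le (F : nat -> set T) (B : \bar R) :
  (forall n, measurable (F n)) -> nondecreasing_seq F -> (forall n, mu (F n) <= B) ->
  mu (\bigcup_n F n) <= B.
Proof.
move=> mF ndF FB; have cv := nondecreasing_cvg_mu (mu := mu) mF (bigcupT_measurable _ mF) ndF.
rewrite -(cvg_lim (@ereal_hausdorff R) cv); apply: lime_le; first by apply/cvg_ex; eexists; exact: cv.
by apply: nearW => n; exact: FB.
Qed.

Lemma integral_le_full (S : set T) (f : T -> R) (C : R) : mu setT = 1 ->
  measurable S -> mu (~` S) = 0 -> measurable_fun setT f -> (forall x, 0 <= f x)%R ->
  (0 <= C)%R -> (forall x, S x -> (f x <= C)%R) -> \int[mu]_x (f x)%:E <= C%:E.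
Proof.
move=> mu1 mS S0 mf f0 C0 fC; apply: (@le_trans _ _ (\int[mu]_x C%:E)).
  apply: ae_ge0_le_integral => //; [by move=> x _; rewrite lee_fin|exact/measurable_EFinP|].
  exists (~` S); split => //; first exact: measurableC.
  by move=> x /= h Sx; apply: h => _; rewrite lee_fin fC.
by rewrite integral_cst// mu1 mule1.
Qed.

Lemma integral_ge_full (S : set T) (f : T -> R) (C : R) : mu setT = 1 ->
  measurable S -> mu (~` S) = 0 -> measurable_fun setT f -> (forall x, 0 <= f x)%R ->
  (0 <= C)%R -> (forall x, S x -> (C <= f x)%R) -> C%:E <= \int[mu]_x (f x)%:E.
Proof.
move=> mu1 mS S0 mf f0 C0 fC; apply: (@le_trans _ _ (\int[mu]_x C%:E)).
  by rewrite integral_cst// mu1 mule1.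
apply: ae_ge0_le_integral => //; [by move=> x _; rewrite lee_fin|exact/measurable_EFinP|].
exists (~` S); split => //; first exact: measurableC.
by move=> x /= h Sx; apply: h => _; rewrite lee_fin fC.
Qed.

Lemma full_setX d' (T' : measurableType d') (pi : {measure set (T * T')%type -> \bar R})
    (A : set T) (B : set T') : measurable A -> measurable B ->
  pi (~` A `*` setT) = 0 -> pi (setT `*` ~` B) = 0 -> pi (~` (A `*` B)) = 0.
Proof.
move=> mA mB A0 B0; apply/eqP; rewrite eq_le measure_ge0 andbT.
have mA' : measurable (~` A `*` [set: T']) by apply: measurableX => //; exact: measurableC.
have mB' : measurable ([set: T] `*` ~` B) by apply: measurableX => //; exact: measurableC.
apply: (@le_trans _ _ (pi ((~` A `*` setT) `|` (setT `*` ~` B)))).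
  apply: le_measure; rewrite ?inE//.
  - by apply: measurableC; exact: measurableX.
  - exact: measurableU.
  - move=> [x y] /= h; have [Ax|] := pselect (A x); last by left.
    by right; split => // By; apply: h.
have l1 : pi (~` A `*` setT) <= 0 by rewrite A0.
have l2 : pi (setT `*` ~` B) <= 0 by rewrite B0.
by apply: le_trans (measureU2 _ mA' mB') _; rewrite -[leRHS]adde0; exact: leeD l1 l2.
Qed.

End measure_misc.

Section transport_bounds.
Context (R : realType) (X : completeMetricType R).
Hypothesis sepX : separable X.
Implicit Types mu nu : probability (borel X) R.
Local Open Scope ereal_scope.

Lemma full_setC mu (A : set (borel X)) : measurable A -> mu A = 1 -> mu (~` A) = 0.
Proof. by move=> mA A1; rewrite probability_setC// A1 subee. Qed.

Lemma measurable_mdist2 : measurable_fun setT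
  (fun p : borel X * borel X => mdist (p.1 : X) (p.2 : X) ^+ 2)%R.
Proof. by apply: measurable_funX; exact: measurable_mdist. Qed.

Lemma cost_le mu nu (A B : set (borel X)) (D : R) : measurable A -> measurable B ->
  mu A = 1 -> nu B = 1 -> (0 <= D)%R ->
  (forall x y, A x -> B y -> mdist (x : X) (y : X) <= D)%R ->
  cost mu nu <= (D ^+ 2)%:E.
Proof.
move=> mA mB A1 B1 D0 h.
have p2 S S' : measurable S -> measurable S' -> (mu \x nu) (S `*` S') = mu S * nu S'.
  by move=> mS mS'; exact: product_measure1E.
have p1 : (mu \x nu) setT = 1 by rewrite -setXTT p2// !probability_setT mule1.
have [P PE0] := probability_of_measure p1.
have PE S S' : measurable S -> measurable S' -> P (S `*` S') = mu S * nu S'.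
  by move=> mS mS'; exact: etrans (PE0 _) (p2 _ _ mS mS').
apply: (@le_trans _ _ (\int[P]_p (mdist (p.1 : X) (p.2 : X) ^+ 2)%:E)).
  apply: ereal_inf_lbound; exists P => // S mS.
  by rewrite !PE// !probability_setT mule1 mul1e.
apply: (@integral_le_full _ _ _ P (A `*` B)) => //.
- exact: probability_setT.
- exact: measurableX.
- apply: full_setX => //.
  + by apply: etrans (PE _ _ (measurableC mA) measurableT) _; rewrite full_setC// mul0e.
  + by apply: etrans (PE _ _ measurableT (measurableC mB)) _; rewrite full_setC// mule0.
- exact: measurable_mdist2.
- by move=> p; exact: sqr_ge0.
- exact: sqr_ge0.
- by move=> [x y] [/= Ax By]; rewrite ler_pXn2r ?nnegrE ?mdist_ge0//; exact: h.
Qed.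

Lemma cost_ge mu nu (A B : set (borel X)) (D : R) : measurable A -> measurable B ->
  mu A = 1 -> nu B = 1 -> (0 <= D)%R ->
  (forall x y, A x -> B y -> D <= mdist (x : X) (y : X))%R ->
  (D ^+ 2)%:E <= cost mu nu.
Proof.
move=> mA mB A1 B1 D0 h; apply: le_ereal_inf_tmp => _ [pi cpi <-].
apply: (@integral_ge_full _ _ _ pi (A `*` B)) => //.
- exact: probability_setT.
- exact: measurableX.
- apply: full_setX => //.
  + by have [h1 _] := cpi _ (measurableC mA); apply: etrans h1 _; exact: full_setC.
  + by have [_ h2] := cpi _ (measurableC mB); apply: etrans h2 _; exact: full_setC.
- exact: measurable_mdist2.
- by move=> p; exact: sqr_ge0.
- exact: sqr_ge0.
- by move=> [x y] [/= Ax By]; rewrite ler_pXn2r ?nnegrE ?mdist_ge0//; exact: h.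
Qed.

Lemma measurable_mdistr (x0 : X) : measurable_fun setT (fun x : borel X => mdist x0 (x : X)).
Proof.
rewrite (_ : (fun x => _) = fun x : borel X => mdist (x : X) x0); first exact: measurable_mdistl.
by apply/funext => x; exact: metric_sym.
Qed.

Lemma P2_bounded mu (A : set (borel X)) (x0 : X) (D : R) : measurable A -> mu A = 1 ->
  (0 <= D)%R -> (forall x, A x -> mdist x0 x <= D)%R -> P2 mu.
Proof.
move=> mA A1 D0 h; exists x0; apply: (@le_lt_trans _ _ (D ^+ 2)%:E); last exact: ltry.
apply: (@integral_le_full _ _ _ mu A) => //.
- exact: probability_setT.
- exact: full_setC.
- by apply: measurable_funX; exact: measurable_mdistr.
- by move=> p; exact: sqr_ge0.
- exact: sqr_ge0.
- by move=> x Ax; rewrite ler_pXn2r ?nnegrE ?mdist_ge0//; exact: h.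
Qed.

End transport_bounds.

Section entropy_interpolation.
Context (R : realType) (X : completeMetricType R).
Variable m : {measure set (borel X) -> \bar R}.
Hypothesis sepX : separable X.
Hypothesis mfin : (m setT < +oo)%E.
Let V := fine (m setT).
Implicit Types mu nu : probability (borel X) R.

Lemma probability_of_density (rho : borel X -> R) : bmf rho -> (forall x, 0 <= rho x) ->
  \int[m]_x rho x = 1 -> exists P : probability (borel X) R, density m P rho.
Proof.
move=> [mr br] r0 r1; have [|P PE] :=
  @probability_of_measure _ _ R [the {measure set _ -> \bar R} of dens_measure m mr r0].
  by rewrite /= /dens_measure -RintE ?r1.
by exists P; split => // A mA; rewrite PE.
Qed.

Lemma uniform_on (A : set (borel X)) : measurable A -> (0 < m A)%E ->
  exists2 P : probability (borel X) R,
    density m P (fun x => (fine (m A))^-1 * \1_A x) & P A = 1%E.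
Proof.
move=> mA A0; have Af := mu_fin mfin mA.
have a0 : 0 < fine (m A) by rewrite fine_gt0// A0 ltey_eq Af.
have bA : bmf (\1_A : borel X -> R) by exact: bmf_indic.
pose u := fun x : borel X => (fine (m A))^-1 * \1_A x.
have bu : bmf u by apply: bmfM => //; exact: bmf_cst.
have u0 x : 0 <= u x by rewrite mulr_ge0 ?invr_ge0 ?(ltW a0)// indicE.
have u1 : \int[m]_x u x = 1 by rewrite RintZ// Rint_indic// mulVf// gt_eqF.
have [P dP] := probability_of_density bu u0 u1.
exists P => //; have [_ _ ->//] := dP.
rewrite integral_mkcond -[RHS]/(1%:E) -u1 RintE//; apply: eq_integral => x _.
by rewrite patchE /u indicE; case: (x \in A) => //=; rewrite mulr0.
Qed.

Lemma uniform_le (A : set (borel X)) x : (fine (m A))^-1 * \1_A x <= (fine (m A))^-1 :> R.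
Proof. by rewrite ler_piMr ?invr_ge0 ?fine_ge0// indicE; case: (_ \in _). Qed.

Lemma cd_interpolation (K : R) mu0 mu1 (U0 U1 c0 D : R) (A : set (borel X)) (x0 : X) :
  CD_infty m K -> (Ent m mu0 <= U0%:E)%E -> (Ent m mu1 <= U1%:E)%E ->
  measurable A -> mu0 A = 1%E -> mu1 A = 1%E -> 0 <= D -> (forall x, A x -> mdist x0 x <= D) ->
  cost mu0 mu1 = c0%:E ->
  exists2 mu_ : R -> probability (borel X) R, W2_geodesic mu0 mu1 mu_ &
  forall t : R, 0 <= t <= 1 ->
    (Ent m (mu_ t) <= ((1 - t) * U0 + t * U1 - K / 2 * t * (1 - t) * c0)%:E)%E.
Proof.
move=> cd E0 E1 mA A0 A1 D0 AD c0E.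
have dom mu U : (Ent m mu <= U%:E)%E -> mu A = 1%E -> dom_Ent m mu.
  move=> ub muA; split; first exact: (P2_bounded mA muA D0 AD).
  have lb := ent_ge mfin mu measurableT ltr01 ltr01.
  by rewrite fin_numE -ltNye -ltey (lt_le_trans (ltNyr _) lb) (le_lt_trans ub (ltry _)).
have [mu_ geo H] := cd mu0 mu1 (dom _ _ E0 A0) (dom _ _ E1 A1).
exists mu_ => // t /[dup] t01 /andP[t0 t1]; apply: le_trans (H t t01) _.
rewrite W2_sqr c0E -EFinM [leRHS]EFinB; apply: leeB => //; rewrite [leRHS]EFinD.
by apply: leeD; rewrite [leRHS]EFinM; apply: lee_wpmul2l; rewrite ?lee_fin ?subr_ge0.
Qed.

End entropy_interpolation.

(** * Brunn-Minkowski growth and Gaussian concentration *)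

Section set_growth.
Context (R : realType) (X : completeMetricType R).
Variable m : {measure set (borel X) -> \bar R}.
Hypothesis sepX : separable X.
Hypothesis mfin : (m setT < +oo)%E.
Let V := fine (m setT).
Variable K : R.
Hypothesis cd : CD_infty m K.
Let kap := Num.max (- K) 0.
Implicit Types mu nu : probability (borel X) R.

Let V0 : 0 <= V. Proof. exact: fine_ge0. Qed.

Lemma ent_concentrated mu (Z : set (borel X)) (U : R) : measurable Z -> mu Z = 1%E ->
  0 < fine (m Z) -> (Ent m mu <= U%:E)%E -> - ln (fine (m Z)) <= U.
Proof.
move=> mZ Z1 z0 EU; apply/ler_addgt0Pr => e e0.
have V1 : 0 < V + 1 by rewrite ltr_wpDl.
have c20 : 0 < e / (V + 1) by rewrite divr_gt0.
have c10 : 0 < (fine (m Z))^-1 by rewrite invr_gt0.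
have := le_trans (ent_ge mfin mu mZ c10 c20) EU; rewrite Z1 /= lee_fin -/V.
rewrite lnV ?posrE// mulVf ?gt_eqF//.
have zV : fine (m Z) <= V by apply: fine_mu_le.
have : e / (V + 1) * (V - fine (m Z)) <= e.
  rewrite mulrAC ler_pdivrMr// ler_wpM2l ?(ltW e0)//; lra.
lra.
Qed.

(** Brunn-Minkowski: along a geodesic between the uniform measures on [A] and [B]
    the mass at time [t] has moved by at most [t * D], so it is carried by the
    enlargement of [A], and Jensen's inequality bounds its entropy from below. *)
Lemma set_interpolation (A B : set (borel X)) (x0 : X) (D0 D t r : R) :
  measurable A -> measurable B -> (0 < m A)%E -> (0 < m B)%E ->
  0 <= D0 -> (forall x, (A `|` B) x -> mdist x0 x <= D0) ->
  0 < D -> (forall x y, A x -> B y -> mdist (x : X) (y : X) <= D) ->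
  0 < t < 1 -> t * D < r ->
  (1 - t) * ln (fine (m A)) + t * ln (fine (m B)) - kap / 2 * t * D ^+ 2 <=
  ln (fine (m (mnbhd r A))).
Proof.
move=> mA mB A0 B0 D00 ABD D0' ABd /[dup] t01 /andP[t0 t1] tr.
have a0 : 0 < fine (m A) by rewrite fine_gt0// A0 ltey_eq mu_fin.
have b0 : 0 < fine (m B) by rewrite fine_gt0// B0 ltey_eq mu_fin.
have [mu0 d0 A1] := uniform_on mfin mA A0.
have [mu1 d1 B1] := uniform_on mfin mB B0.
have mAB : measurable (A `|` B) by exact: measurableU.
have one mu S : measurable S -> mu S = 1%E -> S `<=` A `|` B -> mu (A `|` B) = 1%E.
  move=> mS S1 sub; apply/eqP; rewrite eq_le probability_le1//= -S1.
  by apply: le_measure; rewrite ?inE.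
have AB0 := one mu0 A mA A1 (@subsetUl _ _ _).
have AB1 := one mu1 B mB B1 (@subsetUr _ _ _).
have cD : (cost mu0 mu1 <= (D ^+ 2)%:E)%E by apply: (cost_le sepX mA mB A1 B1 (ltW D0')).
have cf : cost mu0 mu1 \is a fin_num by rewrite ge0_fin_numE ?cost_ge0// (le_lt_trans cD)// ltry.
pose c0 := fine (cost mu0 mu1).
have c0E : cost mu0 mu1 = c0%:E by rewrite fineK.
have c00 : 0 <= c0 by rewrite fine_ge0// cost_ge0.
have c0D : c0 <= D ^+ 2 by rewrite -lee_fin -c0E.
have ia0 : 0 < (fine (m A))^-1 by rewrite invr_gt0.
have ib0 : 0 < (fine (m B))^-1 by rewrite invr_gt0.
have [mu_ geo H] := cd_interpolation mfin cd (ent_le mfin ia0 d0 (uniform_le m A))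
  (ent_le mfin ib0 d1 (uniform_le m B)) mAB AB0 AB1 D00 ABD c0E.
have mZ := measurable_mnbhd r A; set Z := mnbhd r A in mZ *.
have r0 : 0 < r by apply: lt_trans tr; rewrite mulr_gt0.
have AZ : A `<=` Z by exact: sub_mnbhd.
have z0 : 0 < fine (m Z) by apply: lt_le_trans a0 _; exact: fine_mu_le.
have Z1 : mu_ t Z = 1%E.
  suff Zc : mu_ t (~` Z) = 0%E.
    by have := probability_setC (mu_ t) (measurableC mZ); rewrite setCK Zc sube0.
  apply/eqP; rewrite eq_le measure_ge0 andbT; apply/lee_addgt0Pr => e e0; rewrite add0e.
  pose e' := Num.min e ((r - t * D) / 2).
  have e'0 : 0 < e' by rewrite lt_min e0 divr_gt0// subr_gt0.
  have [s [W [mW sW hW [m11 m12 m22]]]] := midpoint_plan sepX geo c0E t01 e'0.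
  rewrite -m12; last exact: measurableC.
  have ms1 : measurable [set w : (borel X * borel X) * (borel X * borel X) | (~` A) w.1.1].
    rewrite -[X in measurable X]setTI.
    have : measurable_fun setT (fun w : (borel X * borel X) * (borel X * borel X) => w.1.1).
      exact: measurableT_comp.
    by apply => //; exact: measurableC.
  have ms2 : measurable [set w : (borel X * borel X) * (borel X * borel X) | (~` B) w.2.2].
    rewrite -[X in measurable X]setTI.
    have : measurable_fun setT (fun w : (borel X * borel X) * (borel X * borel X) => w.2.2).
      exact: measurableT_comp.
    by apply => //; exact: measurableC.
  have ms3 : measurable [set w : (borel X * borel X) * (borel X * borel X) | (~` Z) w.1.2].
    rewrite -[X in measurable X]setTI.
    have : measurable_fun setT (fun w : (borel X * borel X) * (borel X * borel X) => w.1.2).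
      exact: measurableT_comp.
    by apply => //; exact: measurableC.
  have l1 : (s [set w | (~` A) w.1.1] <= 0)%E by rewrite m11 ?full_setC//; exact: measurableC.
  have l2 : (s [set w | (~` B) w.2.2] <= 0)%E by rewrite m22 ?full_setC//; exact: measurableC.
  have l3 : (s W <= e%:E)%E by apply: le_trans sW _; rewrite lee_fin ge_min lexx.
  have mW1 : measurable (W `|` [set w | (~` A) w.1.1]) by exact: measurableU.
  apply: (@le_trans _ _ (s ((W `|` [set w | (~` A) w.1.1]) `|` [set w | (~` B) w.2.2]))).
    apply: le_measure; rewrite ?inE//; first exact: measurableU.
    move=> [[x z] [z' y]] /= nZ; have [Ww|nW] := pselect (W (x, z, (z', y))); first by left; left.
    have [Ax|] := pselect (A x); last by left; right.
    have [By|] := pselect (B y); last by right.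
    exfalso; apply: nZ; exists x => //.
    have /= h1 := hW _ nW; rewrite metric_sym (le_lt_trans h1)//.
    have h2 : t * mdist (x : X) y <= t * D by rewrite ler_wpM2l ?(ltW t0)//; exact: ABd.
    have h3 : e' <= (r - t * D) / 2 by rewrite ge_min lexx orbT.
    by move: tr; lra.
  apply: le_trans (measureU2 _ mW1 ms2) _; rewrite -[leRHS]adde0; apply: leeD => //.
  apply: le_trans (measureU2 _ mW ms1) _; rewrite -[leRHS]adde0; exact: leeD.
have t01' : 0 <= t <= 1 by rewrite !ltW.
have := ent_concentrated mZ Z1 z0 (H t t01'); rewrite !lnV ?posrE//.
have kK : - K <= kap by rewrite /kap le_max lexx.
have k0 : 0 <= kap by rewrite /kap le_max lexx orbT.
have h1 : - K * (t * (1 - t) * c0) <= kap * (t * (1 - t) * c0).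
  by rewrite ler_wpM2r// !mulr_ge0// ?(ltW t0)// subr_ge0 ltW.
have h2 : kap * (t * (1 - t) * c0) <= kap * (t * D ^+ 2).
  rewrite ler_wpM2l// -mulrA ler_wpM2l ?(ltW t0)// (le_trans _ c0D)// ler_piMl//.
  by rewrite lerBlDr lerDl ltW.
lra.
Qed.

(** Linearisation of [set_interpolation] in [t]. Taking [t * D = r / 2] gives the
    same growth rate at every scale [r]; for small [m A] the logarithm of its
    inverse dominates the curvature term. *)
Lemma set_growth_rate (A B : set (borel X)) (x0 : X) (D0 D r : R) :
  measurable A -> measurable B -> (0 < m A)%E -> (0 < m B)%E ->
  0 <= D0 -> (forall x, (A `|` B) x -> mdist x0 x <= D0) ->
  0 < D -> (forall x y, A x -> B y -> mdist (x : X) (y : X) <= D) ->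
  0 < r < 2 * D ->
  fine (m A) + r * (fine (m A) * (ln (fine (m B)) - ln (fine (m A)) - kap * D ^+ 2 / 2) / (2 * D))
  <= fine (m (mnbhd r A)).
Proof.
move=> mA mB A0 B0 D00 ABD D0' ABd /andP[r0 rD].
have a0 : 0 < fine (m A) by rewrite fine_gt0// A0 ltey_eq mu_fin.
have D2 : 0 < 2 * D by rewrite mulr_gt0.
pose t := r / (2 * D).
have t01 : 0 < t < 1 by rewrite divr_gt0//= ltr_pdivrMr// mul1r.
have tr : t * D < r.
  have -> : t * D = r / 2 by rewrite /t; field; rewrite gt_eqF.
  by rewrite ltr_pdivrMr// ltr_pMr// ltr1n.
have := set_interpolation mA mB A0 B0 D00 ABD D0' ABd t01 tr.
have z0 : 0 < fine (m (mnbhd r A)).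
  by apply: lt_le_trans a0 _; apply: fine_mu_le => //; [exact: measurable_mnbhd|exact: sub_mnbhd].
set a := fine (m A) in a0 *; set b := fine (m B); set z := fine (m _) in z0 *.
pose l := ln b - ln a - kap * D ^+ 2 / 2.
move=> h; have : ln a + t * l <= ln z by rewrite /l; lra.
rewrite -ler_expR [leRHS]lnK ?posrE// expRD lnK ?posrE// => /(le_trans _); apply.
rewrite -/l (_ : _ + _ = a * (1 + t * l)); last by rewrite /t; ring.
by rewrite ler_wpM2l ?(ltW a0)//; exact: expR_ge1Dx.
Qed.

(** For [K > 0] the midpoint of a geodesic between the uniform measures on [A] and
    [B] has small entropy when [A] and [B] are far apart, but the entropy is bounded
    below by [- ln V]. *)
Lemma distant_set_le (A B : set (borel X)) (x0 : X) (D0 s : R) : 0 < K ->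
  measurable A -> measurable B -> (0 < m A)%E -> (0 < m B)%E ->
  0 <= D0 -> (forall x, (A `|` B) x -> mdist x0 x <= D0) ->
  0 <= s -> (forall x y, A x -> B y -> s <= mdist (x : X) (y : X)) ->
  ln (fine (m A)) <= 2 * ln V - ln (fine (m B)) - K / 4 * s ^+ 2.
Proof.
move=> K0 mA mB A0 B0 D00 ABD s0 ABs.
have a0 : 0 < fine (m A) by rewrite fine_gt0// A0 ltey_eq mu_fin.
have b0 : 0 < fine (m B) by rewrite fine_gt0// B0 ltey_eq mu_fin.
have Vp : 0 < V by apply: lt_le_trans a0 _; exact: fine_mu_le.
have [mu0 d0 A1] := uniform_on mfin mA A0.
have [mu1 d1 B1] := uniform_on mfin mB B0.
have mAB : measurable (A `|` B) by exact: measurableU.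
have one mu S : measurable S -> mu S = 1%E -> S `<=` A `|` B -> mu (A `|` B) = 1%E.
  move=> mS S1 sub; apply/eqP; rewrite eq_le probability_le1//= -S1.
  by apply: le_measure; rewrite ?inE.
have AB0 := one mu0 A mA A1 (@subsetUl _ _ _).
have AB1 := one mu1 B mB B1 (@subsetUr _ _ _).
have cD : (cost mu0 mu1 <= ((D0 + D0) ^+ 2)%:E)%E.
  apply: (cost_le sepX mA mB A1 B1); first by rewrite addr_ge0.
  move=> x y Ax By; rewrite (le_trans (metric_triangle _ x0 _))// metric_sym lerD//.
    by apply: ABD; left.
  by apply: ABD; right.
have cs : ((s ^+ 2)%:E <= cost mu0 mu1)%E by apply: (cost_ge sepX mA mB A1 B1).
have cf : cost mu0 mu1 \is a fin_num by rewrite ge0_fin_numE ?cost_ge0// (le_lt_trans cD)// ltry.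
pose c0 := fine (cost mu0 mu1).
have c0E : cost mu0 mu1 = c0%:E by rewrite fineK.
have c0s : s ^+ 2 <= c0 by rewrite -lee_fin -c0E.
have ia0 : 0 < (fine (m A))^-1 by rewrite invr_gt0.
have ib0 : 0 < (fine (m B))^-1 by rewrite invr_gt0.
have [mu_ geo H] := cd_interpolation mfin cd (ent_le mfin ia0 d0 (uniform_le m A))
  (ent_le mfin ib0 d1 (uniform_le m B)) mAB AB0 AB1 D00 ABD c0E.
have h01 : 0 <= (2^-1 : R) <= 1 by apply/andP; split; lra.
have T1 : mu_ 2^-1 setT = 1%E by exact: probability_setT.
have := ent_concentrated measurableT T1 Vp (H _ h01); rewrite !lnV ?posrE// -/V.
have := ler_wpM2l (ltW K0) c0s; lra.
Qed.

(** The complement of the ball is exhausted by bounded sets, for which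
    [distant_set_le] is uniform. *)
Lemma gaussian_concentration (x0 : X) (r0 r : R) : 0 < K -> 0 <= r0 -> r0 <= r ->
  (0 < m [set x | (mdist x0 x < r0)%R])%E ->
  (m [set x | (r <= mdist x0 x)%R] <=
   (expR (2 * ln V - ln (fine (m [set x | (mdist x0 x < r0)%R])) - K / 4 * (r - r0) ^+ 2))%:E)%E.
Proof.
move=> K0 r00 rr B0; set B := [set x | _] in B0 *.
have mB : measurable (B : set (borel X)) by apply: borel_open; exact: open_mball.
pose F n : set (borel X) := [set x : X | r <= mdist x0 x < n%:R].
have md := @measurable_mdistr R X x0.
have mF n : measurable (F n).
  rewrite -[X in measurable X]setTI (_ : F n = (fun x : borel X => mdist x0 (x : X)) @^-1` `[r, n%:R[%classic).
    exact: md.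
  by apply/seteqP; split => x /=; rewrite in_itv.
have -> : [set x | r <= mdist x0 x] = \bigcup_n F n.
  apply/seteqP; split => x /=; last by move=> [n _ /andP[]].
  move=> rx; exists (Num.truncn (mdist x0 x)).+1 => //; apply/andP; split => //.
  exact: truncnS_gt.
apply: measure_bigcup_le => //.
  move=> i j ij; apply/subsetPset => x /andP[h1 h2]; rewrite /F/= h1/=.
  by rewrite (lt_le_trans h2)// ler_nat.
move=> n; have [->|Fn0] := eqVneq (m (F n)) 0%E; first by rewrite lee_fin expR_ge0.
have Fp : (0 < m (F n))%E by rewrite lt_neqAle eq_sym Fn0 measure_ge0.
have mf := mu_fin mfin (mF n).
have f0 : 0 < fine (m (F n)) by rewrite fine_gt0// Fp ltey_eq mf.
rewrite -(fineK mf) lee_fin -[leLHS]lnK ?posrE// ler_expR.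
apply: (@distant_set_le _ _ x0 (n%:R + r0)) => //.
- by rewrite addr_ge0.
- move=> x [/= /andP[_ /ltW h]|/ltW h]; first by rewrite (le_trans h)// lerDl.
  by rewrite (le_trans h)// lerDr.
- by rewrite subr_ge0.
- move=> x y /= /andP[rx _] yr; have := metric_triangle x0 y x; rewrite (metric_sym y x).
  by move: yr; rewrite /B/=; lra.
Qed.

End set_growth.

(** * Cutoffs and the perimeter of small sets *)

Section truncation.
Context (R : realType) (X : completeMetricType R).
Variable m : {measure set (borel X) -> \bar R}.
Hypothesis mfin : (m setT < +oo)%E.
Variables (x0 : X) (r : R).
Implicit Types (f : X -> R) (E : set (borel X)).

(** Sequences converging to [\1_E] in [L^1] are eventually close to it. *)
Lemma per_ge E (theta : R) (P : \bar R) : 0 < theta ->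
  (forall f, Lip_loc f -> (\int[m]_x (`|f x - \1_E x|)%:E <= theta%:E)%E ->
    (P <= \int[m]_x slope f x)%E) -> (P <= Per m E)%E.
Proof.
move=> t0 h; apply: le_ereal_inf_tmp => _ [f_ [lf cf] <-]; apply: limn_einf_ge.
have tn : (0 < theta%:E)%E by rewrite lte_fin.
have := cf _ (open_ereal_lt' tn) => H.
apply: (@filterS _ \oo _ _ _ _ H) => n /= /ltW.
by rewrite Lnorm1 => hn; apply: h => //; under eq_integral do rewrite -EFin_abs.
Qed.

Definition clamp (a : R) : R := Num.min 1 (Num.max 0 a).
Definition cutfun (x : X) : R := clamp (r + 1 - mdist x0 x).
Definition cutoff f (x : X) : R := clamp (f x) * cutfun x.

Lemma clamp01 a : 0 <= clamp a <= 1.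
Proof. by rewrite /clamp le_min ler01 le_max lexx/= ge_min lexx. Qed.

Lemma clamp_ge1 a : 1 <= a -> clamp a = 1.
Proof. by move=> a1; rewrite /clamp min_l// le_max a1 orbT. Qed.

Lemma clamp_le0 a : a <= 0 -> clamp a = 0.
Proof. by move=> a0; rewrite /clamp max_l// min_r. Qed.

Lemma cut01 f x : 0 <= cutoff f x <= 1.
Proof.
have /andP[a0 a1] := clamp01 (f x); have /andP[b0 b1] := clamp01 (r + 1 - mdist x0 x).
by rewrite /cutoff mulr_ge0//= mulr_ile1.
Qed.

Lemma cut_out f x : r + 1 <= mdist x0 x -> cutoff f x = 0.
Proof. by move=> rx; rewrite /cutoff /cutfun (@clamp_le0 (_ - _)) ?mulr0// subr_le0. Qed.

Lemma cut_in f x : mdist x0 x <= r -> cutoff f x = clamp (f x).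
Proof. by move=> xr; rewrite /cutoff /cutfun (@clamp_ge1 (_ - _)) ?mulr1// lerBrDr addrC lerD2r. Qed.

Lemma cut_dist f x y : `|cutoff f y - cutoff f x| <= 1 * `|f y - f x| + 1 * mdist x y.
Proof.
have /andP[a0 a1] := clamp01 (f x); have /andP[b0 b1] := clamp01 (r + 1 - mdist x0 y).
have -> : cutoff f y - cutoff f x = cutfun y * (clamp (f y) - clamp (f x)) +
   clamp (f x) * (cutfun y - cutfun x) by rewrite /cutoff; ring.
rewrite (le_trans (ler_normD _ _))// !normrM (ger0_norm a0) (ger0_norm b0).
apply: lerD; apply: ler_pM => //; first exact: clamp_dist.
rewrite (le_trans (clamp_dist _ _))//.
have -> : r + 1 - mdist x0 y - (r + 1 - mdist x0 x) = mdist x0 x - mdist x0 y by ring.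
exact: mdist_distl.
Qed.

Lemma cut_lipschitz f : Lip_loc f -> exists L, forall x y, `|cutoff f x - cutoff f y| <= L * mdist x y.
Proof.
move=> lf; have [L hL] := lf _ (mbounded_ball x0 (r + 3)).
exists (`|L| + 1).
have H x y : mdist x0 x < r + 1 -> `|cutoff f x - cutoff f y| <= (`|L| + 1) * mdist x y.
  move=> xr; have [yr|yr] := ltP (mdist x0 y) (r + 3).
    rewrite (le_trans (cut_dist _ _ _))// mulrDl !mul1r (metric_sym y) lerD2r.
    rewrite (le_trans (hL _ _ _ _))//=; first by rewrite (lt_trans xr)// ltrD2l ltr1n.
    by rewrite ler_wpM2r ?mdist_ge0// ler_norm.
  have xy : 1 <= mdist x y by have := metric_triangle x0 x y; lra.
  rewrite (@cut_out f y) ?subr0; last by lra.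
  have /andP[c0 c1] := cut01 f x; rewrite ger0_norm// (le_trans c1)//.
  by rewrite (le_trans xy)// ler_peMl ?mdist_ge0// lerDr.
move=> x y; have [xr|xr] := ltP (mdist x0 x) (r + 1); first exact: H.
have [yr|yr] := ltP (mdist x0 y) (r + 1); first by rewrite distrC metric_sym; exact: H.
by rewrite !cut_out// subrr normr0 mulr_ge0 ?mdist_ge0.
Qed.

Lemma sl_cut f x : Lip_loc f -> sl (cutoff f) x <= sl f x + (if r <= mdist x0 x then 1 else 0).
Proof.
move=> lf; have fE := lip_loc_slE x lf; case: ifPn => [_|].
  have [_] := sl_comp_le fE ltr01 ler01 ler01 (fun y _ => cut_dist f x y).
  by rewrite mul1r.
rewrite -ltNge => xr; have r0 : 0 < r - mdist x0 x by rewrite subr_gt0.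
have h y : mdist x y < r - mdist x0 x ->
    `|cutoff f y - cutoff f x| <= 1 * `|f y - f x| + 0 * mdist x y.
  move=> xy; have := metric_triangle x0 x y => h1.
  rewrite !cut_in ?(ltW xr)//; last by lra.
  by rewrite mul1r mul0r addr0; exact: clamp_dist.
have [_] := sl_comp_le fE r0 ler01 (lexx 0) h.
by rewrite mul1r.
Qed.

Lemma measurable_far : measurable ([set x | r <= mdist x0 x] : set (borel X)).
Proof.
rewrite -[X in measurable X]setTI (_ : [set x | _] = (fun x : borel X => mdist x0 (x : X)) @^-1` `[r, +oo[%classic).
  exact: measurable_mdistr.
by apply/seteqP; split => x /=; rewrite in_itv/= andbT.
Qed.

Lemma integral_sl_cut f : Lip_loc f ->
  (\int[m]_x (sl (cutoff f) x)%:E <= \int[m]_x slope f x + m [set x | (r <= mdist x0 x)%R])%E.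
Proof.
move=> lf; have [L cL] := cut_lipschitz lf.
have lc : lipschitz_in setT (cutoff f) by exists L => x y _ _; exact: cL.
have mfar := measurable_far.
rewrite -[X in (_ <= _ + m X)%E]setIT -integral_indic// -ge0_integralD//; last 3 first.
- by move=> x _; exact: slope_ge0.
- by apply: measurable_slope; exact: lip_loc_mcontinuous.
- by apply/measurable_EFinP; exact: measurable_indic.
apply: ge0_le_integral => //.
- by move=> x _; rewrite lee_fin sl_ge0.
- by apply/measurable_EFinP; apply: measurable_sl; exact: lipschitz_mcontinuous.
- apply: emeasurable_funD; last by apply/measurable_EFinP; exact: measurable_indic.
  by apply: measurable_slope; exact: lip_loc_mcontinuous.
- by move=> x _; rewrite (lip_loc_slE x lf) -EFinD lee_fin indic_ite; exact: sl_cut.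
Qed.

End truncation.

Section profile.
Context (R : realType) (X : completeMetricType R).
Variable m : {measure set (borel X) -> \bar R}.
Hypothesis sepX : separable X.
Hypothesis mfin : (m setT < +oo)%E.
Let V := fine (m setT).
Variable K : R.
Hypothesis cd : CD_infty m K.
Let kap := Num.max (- K) 0.

(** Near [E] in [L^1] a locally Lipschitz function, cut off outside a large
    ball, has superlevel sets of measure at most [2 m(E)]; their growth rate
    integrates to a lower bound for the integral of the slope. *)
Lemma small_set_perimeter (E : set (borel X)) (x0 : X) (r q : R) :
  measurable E -> (0 < m E)%E -> (0 < m [set x | (mdist x0 x < 1)%R])%E ->
  0 <= r -> (m [set x | (r <= mdist x0 x)%R] <= (fine (m E) / 8)%:E)%E -> 0 <= q ->
  q * (2 * (r + 2)) <= ln (fine (m [set x | (mdist x0 x < 1)%R])) - ln (2 * fine (m E))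
    - kap * (r + 2) ^+ 2 / 2 ->
  ((fine (m E) * (q / 2 - 8^-1))%:E <= Per m E)%E.
Proof.
move=> mE E0 B0 r0 far q0 hq; set v := fine (m E) in far hq *.
have mEf := mu_fin mfin mE.
have v0 : 0 < v by rewrite fine_gt0// E0 ltey_eq mEf.
have v16 : 0 < v / 16 by rewrite divr_gt0.
apply: (per_ge v16) => f lf hf; pose g := cutoff x0 r f.
have [L gL] := cut_lipschitz x0 r lf.
have g01 x : 0 <= g x <= 1 := cut01 x0 r f x.
have mfc : measurable_fun setT (f : borel X -> R).
  by apply: mcontinuous_measurable; exact: lip_loc_mcontinuous.
pose Z (x : borel X) := `|f x - \1_E x|.
have mZ : measurable_fun setT Z.
  by apply: measurableT_comp => //; apply: measurable_funB => //; exact: measurable_indic.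
have Z0 x : 0 <= Z x by exact: normr_ge0.
have bg : @bmf _ (borel X) R g.
  apply: (@lipschitz_bmf _ _ g 1); first by exists L => x y _ _; exact: gL.
  by move=> x; have /andP[? ?] := g01 x; rewrite ger0_norm.
pose D := r + 2; have D0 : 0 < D by rewrite ltr_wpDl.
pose c s : \bar R := if 4^-1 < s then (q%:E * m [set x | (s < g x)%R])%E else 0%E.
have mB : measurable ([set x | mdist x0 x < 1] : set (borel X)).
  by apply: borel_open; exact: open_mball.
have growth n s : 0 < s -> (m [set x | s < g x]%R + (D / n.+1%:R)%:E * c s <=
    m (mnbhd (D / n.+1%:R) [set x | s < g x]%R))%E.
  move=> s0; set rn := D / n.+1%:R.
  have rn0 : 0 < rn by rewrite divr_gt0.
  set A := [set x | s < g x].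
  have mA : measurable (A : set (borel X)) by apply: measurable_superlevel; exact: bg.1.
  have mN := measurable_mnbhd rn A.
  have AN : (m A <= m (mnbhd rn A))%E.
    by apply: le_measure; rewrite ?inE//; exact: sub_mnbhd.
  rewrite /c; case: ifPn => s4; last by rewrite mule0 adde0.
  have mAf := mu_fin mfin mA; have mNf := mu_fin mfin mN.
  have [A00|A0] := eqVneq (m A) 0%E; first by rewrite A00 !mule0 adde0 -A00.
  have Ap : (0 < m A)%E by rewrite lt_neqAle eq_sym A0 measure_ge0.
  have a0 : 0 < fine (m A) by rewrite fine_gt0// Ap ltey_eq mAf.
  have a2v : fine (m A) <= 2 * v.
    have mS : measurable [set x | 4^-1 <= Z x].
      rewrite -[X in measurable X]setTI (_ : [set x | _] = Z @^-1` `[4^-1, +oo[%classic).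
        exact: mZ.
      by apply/seteqP; split => x /=; rewrite in_itv/= andbT.
    have i4 : 0 < 4^-1 :> R by rewrite invr_gt0.
    have := le_trans (chebyshev_measure m mZ Z0 i4) hf.
    rewrite -[X in (_ * X)%E](fineK (mu_fin mfin mS)) -EFinM lee_fin => h1.
    have : (m A <= m E + m [set x | (4^-1 <= Z x)%R])%E.
      apply: le_trans (measureU2 _ mE mS); apply: le_measure; rewrite ?inE//.
        exact: measurableU.
      move=> x; rewrite /A/= => sg; have [Ex|nE] := pselect (E x); [by left|right].
      rewrite /Z/= indicE memNset//= subr0.
      have gc : g x <= clamp (f x).
        have /andP[a1 _] := clamp01 (f x); have /andP[_ b1] := clamp01 (r + 1 - mdist x0 x).
        by rewrite /g /cutoff ler_piMr.
      have : 4^-1 < clamp (f x) by rewrite (lt_le_trans s4)// (le_trans (ltW sg)).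
      rewrite /clamp lt_min lt_max => /andP[_ /orP[|fx]]; first by rewrite ltNge invr_ge0 ler0n.
      by rewrite (le_trans (ltW fx))// ler_norm.
    rewrite -(fineK mEf) -(fineK (mu_fin mfin mS)) -(fineK mAf) -EFinD lee_fin -/v; lra.
  have Ar x : A x -> mdist x0 x < r + 1.
    move=> /= sg; rewrite ltNge; apply/negP => xD.
    by move: sg; rewrite /A/= /g cut_out// ltNge (ltW s0).
  have AB x : (A `|` [set x | mdist x0 x < 1]) x -> mdist x0 x <= D.
    by move=> [/Ar|/=]; rewrite /D; lra.
  have ABd x y : A x -> [set x | mdist x0 x < 1] y -> mdist x y <= D.
    move=> /Ar xr /= y1; have := metric_triangle x x0 y; rewrite (metric_sym x x0) /D; lra.
  have rn2 : 0 < rn < 2 * D.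
    rewrite rn0/= /rn ltr_pdivrMr// mulrC mulrA ltr_pMl//.
    by rewrite (@lt_le_trans _ _ 2) ?ltr1n// ler_peMl// ler1n.
  have := set_growth_rate sepX mfin cd mA mB Ap B0 (ltW D0) AB D0 ABd rn2.
  rewrite -(fineK mAf) -(fineK mNf) -!EFinM -EFinD lee_fin.
  apply: le_trans; rewrite lerD2l ler_wpM2l ?(ltW rn0)//.
  rewrite /= -mulrA mulrC ler_wpM2l ?(ltW a0)// ler_pdivlMr ?mulr_gt0//.
  apply: le_trans hq _; rewrite -/D -/kap lerD2r lerD2l lerN2 ler_ln ?posrE//; exact: mulr_gt0.
have rcv : (fun n => D / n.+1%:R) @ \oo --> (0 : R).
  rewrite -[X in _ --> X](mulr0 D); apply: cvgM; first exact: cvg_cst.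
  exact: cvg_harmonic.
have c0 s : (0 <= c s)%E by rewrite /c; case: ifP => // _; rewrite mule_ge0// lee_fin.
have mc : measurable_fun setT c.
  apply: measurable_fun_ifT => //; first exact: measurable_fun_ltr.
  by apply: measurable_funeM; exact: (measurable_ccdf mfin bg.1).
have rn0 n : 0 < D / n.+1%:R by rewrite divr_gt0.
have := coarea_minkowski mfin gL g01 rn0 rcv mc c0 growth.
have -> : (\int[lebesgue_measure]_(s in `]0%R, +oo[) c s =
    (q * \int[m]_x Num.max (g x - 4^-1) 0)%:E)%E.
  have bmx : @bmf _ (borel X) R (fun x => Num.max (g x - 4^-1) 0).
    by apply: bmf_max; [apply: bmfB => //; exact: bmf_cst|exact: bmf_cst].
  rewrite EFinM RintE// -(layer_cake mfin 4^-1 bg.1) -ge0_integralZl//; last first.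
    by apply: measurable_funTS; exact: (measurable_ccdf mfin bg.1).
  rewrite [LHS]integral_mkcond [RHS]integral_mkcond; apply: eq_integral => s _.
  rewrite !patchE !mem_setE !in_itv/= !andbT /c.
  have [s0|s0] := ltP 0 s => //.
  by rewrite ltNge (le_trans s0) ?invr_ge0.
move=> h1; have h2 := le_trans h1 (integral_sl_cut m x0 r lf).
pose Z1 x := Num.min (Z x) 1.
have bZ1 : bmf Z1.
  split; first exact: measurable_minr.
  exists 1 => x; have z0 : 0 <= Z1 x by rewrite /Z1 le_min Z0 ler01.
  by rewrite ger0_norm// /Z1 ge_min lexx orbT.
have IZ1 : \int[m]_x Z1 x <= v / 16.
  rewrite -lee_fin RintE//; apply: le_trans hf; apply: ge0_le_integral => //.
  - by move=> x _; rewrite lee_fin /Z1 le_min Z0 ler01.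
  - by apply/measurable_EFinP; exact: bZ1.1.
  - exact/measurable_EFinP.
  - by move=> x _; rewrite lee_fin ge_min lexx.
have mfar := measurable_far x0 r.
have bE : bmf (\1_E : borel X -> R) by exact: bmf_indic.
have bF : bmf (\1_[set x | r <= mdist x0 x] : borel X -> R) by exact: bmf_indic.
have vI : v / 2 <= \int[m]_x Num.max (g x - 4^-1) 0.
  have bb : @bmf _ (borel X) R (fun x => 3 / 4 * (\1_E x - \1_[set x | r <= mdist x0 x] x)).
    by apply: bmfM; [exact: bmf_cst|exact: bmfB].
  apply: (@le_trans _ _ (\int[m]_x (3 / 4 * (\1_E x - \1_[set x | r <= mdist x0 x] x) - Z1 x))).
    rewrite RintB// RintZ//; last exact: bmfB.
    rewrite RintB// !Rint_indic// -/v.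
    have : fine (m [set x | (r <= mdist x0 x)%R]) <= v / 8.
      by rewrite -lee_fin fineK// mu_fin.
    by move: IZ1; lra.
  apply: Rint_le => //; first exact: bmfB.
    by apply: bmf_max; [apply: bmfB => //; exact: bmf_cst|exact: bmf_cst].
  move=> x; have z0 : 0 <= Z1 x by rewrite /Z1 le_min Z0 ler01.
  have mx : g x - 4^-1 <= Num.max (g x - 4^-1) 0 by rewrite le_max lexx.
  have mx0 : 0 <= Num.max (g x - 4^-1) 0 by rewrite le_max lexx orbT.
  have e1 : \1_E x <= 1 :> R by rewrite indicE; case: (x \in E).
  rewrite indic_ite; case: ifPn => rx; first by move: z0 mx0 e1; lra.
  have xr : mdist x0 x <= r by rewrite -ltNge in rx; exact: ltW.
  have gx : g x = clamp (f x) by rewrite /g cut_in.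
  have g0 : 0 <= g x by case/andP: (g01 x).
  rewrite /Z1 /Z in z0 *; move: z0; rewrite indicE; case: (boolP (x \in E)) => xE /=; last by lra.
  have [f1|f1] := ltP (f x) 1; last first.
    by move: mx; rewrite gx clamp_ge1// minEle; case: ifP => _; have := normr_ge0 (f x - 1); lra.
  have fc : f x <= clamp (f x) by rewrite /clamp le_min (ltW f1) le_max lexx orbT.
  rewrite ltr0_norm ?subr_lt0//; rewrite -gx in fc; rewrite minEle; case: ifP => _; lra.
have farf : fine (m [set x | (r <= mdist x0 x)%R]) <= v / 8.
  by rewrite -lee_fin fineK// mu_fin.
have [|] := leP (v * (q / 2 - 8^-1))%:E (\int[m]_x slope f x)%E => // hlt.
have sf : (\int[m]_x slope f x)%E \is a fin_num.
  rewrite ge0_fin_numE ?(lt_trans hlt) ?ltry//.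
  by apply: integral_ge0 => x _; exact: slope_ge0.
exfalso; move: h2 hlt; rewrite -(fineK sf) -(fineK (mu_fin mfin mfar)) -EFinD lee_fin lte_fin.
have := ler_wpM2l q0 vI; lra.
Qed.

End profile.

(** * The superlinear isoperimetric profile *)

Lemma per_ge0 (R : realType) (X : completeMetricType R)
  (m : {measure set (borel X) -> \bar R}) (A : set (borel X)) : (0 <= Per m A)%E.
Proof.
apply: le_ereal_inf_tmp => _ [f_ _ <-]; rewrite -[leLHS]limn_einf_cst.
by apply: le_limn_einf => n; apply: integral_ge0 => x _; exact: slope_ge0.
Qed.

Section small_sets.
Context (R : realType) (X : completeMetricType R).
Variable m : {measure set (borel X) -> \bar R}.
Hypothesis sepX : separable X.
Hypothesis mfin : (m setT < +oo)%E.
Let V := fine (m setT).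
Variable K : R.
Hypothesis cd : CD_infty m K.
Let kap := Num.max (- K) 0.

(** The radius [r] of the region outside of which competitors are cut off may
    depend on the measure [v] of the set; [q] is chosen such that
    [q / 2 - 1 / 8 = 1 / e]. *)
Lemma small_sets_of_tails (x0 : X) (e : R) : 0 < e ->
  (0 < m [set x | (mdist x0 x < 1)%R])%E ->
  (forall q : R, 0 <= q -> exists2 om : R, 0 < om & forall v, 0 < v <= om ->
    exists r, [/\ 0 <= r, (m [set x | (r <= mdist x0 x)%R] <= (v / 8)%:E)%E &
      q * (2 * (r + 2)) <= ln (fine (m [set x | (mdist x0 x < 1)%R])) - ln (2 * v)
       - kap * (r + 2) ^+ 2 / 2]) ->
  exists2 om : R, 0 < om & forall E : set (borel X), measurable E ->
    (m E <= om%:E)%E -> (m E <= e%:E * Per m E)%E.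
Proof.
move=> e0 B0 tails; have [|om om0 H] := tails (2 / e + 4^-1).
  by rewrite addr_ge0 ?divr_ge0 ?invr_ge0// ltW.
exists om => // E mE Eom; have mEf := mu_fin mfin mE.
have [->|E0] := eqVneq (m E) 0%E; first by rewrite mule_ge0 ?per_ge0// lee_fin ltW.
have Ep : (0 < m E)%E by rewrite lt_neqAle eq_sym E0 measure_ge0.
have v0 : 0 < fine (m E) by rewrite fine_gt0// Ep ltey_eq mEf.
have [|r [r0 far hq]] := H (fine (m E)); first by rewrite v0 -lee_fin fineK.
have q0 : 0 <= 2 / e + 4^-1 by rewrite addr_ge0 ?divr_ge0 ?invr_ge0// ltW.
have := small_set_perimeter sepX mfin cd mE Ep B0 r0 far q0 hq.
move=> h; have e0' : (0 <= e%:E)%E by rewrite lee_fin ltW.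
apply: le_trans (lee_wpmul2l e0' h); rewrite -EFinM -{1}(fineK mEf) lee_fin.
rewrite (_ : e * _ = fine (m E))//; field; by rewrite gt_eqF.
Qed.

Lemma bounded_tails (x0 : X) (q : R) : (diam [set: X] < +oo)%E ->
  (0 < m [set x | (mdist x0 x < 1)%R])%E ->
  exists2 om : R, 0 < om & forall v, 0 < v <= om ->
    exists r, [/\ 0 <= r, (m [set x | (r <= mdist x0 x)%R] <= (v / 8)%:E)%E &
      q * (2 * (r + 2)) <= ln (fine (m [set x | (mdist x0 x < 1)%R])) - ln (2 * v)
       - kap * (r + 2) ^+ 2 / 2].
Proof.
move=> dX B0; have [D D0 hD] := mbounded_diam dX.
set b := ln _; pose r := D + 1.
exists (expR (b - ln 2 - kap * (r + 2) ^+ 2 / 2 - q * (2 * (r + 2)))); first exact: expR_gt0.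
move=> v /andP[v0 vom]; exists r; split; first by rewrite addr_ge0 ?ltW.
  rewrite (_ : [set x | _] = set0) ?measure0 ?lee_fin ?divr_ge0 ?(ltW v0)//.
  apply/seteqP; split => x //=; have := hD x0 x I I; rewrite /r; lra.
have : ln v <= b - ln 2 - kap * (r + 2) ^+ 2 / 2 - q * (2 * (r + 2)).
  by rewrite -ler_expR lnK ?posrE.
rewrite lnM ?posrE//; lra.
Qed.

(** A radius [d * ln (1 / v)] is enough: for every [d] the Gaussian tail is
    eventually smaller than [v], and for small [d] the radius costs only a fraction
    of the gain [ln (1 / v)]. *)
Lemma positive_curvature_tails (x0 : X) (q : R) : 0 < K -> 0 <= q ->
  (0 < m [set x | (mdist x0 x < 1)%R])%E ->
  exists2 om : R, 0 < om & forall v, 0 < v <= om ->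
    exists r, [/\ 0 <= r, (m [set x | (r <= mdist x0 x)%R] <= (v / 8)%:E)%E &
      q * (2 * (r + 2)) <= ln (fine (m [set x | (mdist x0 x < 1)%R])) - ln (2 * v)
       - kap * (r + 2) ^+ 2 / 2].
Proof.
move=> K0 q0 B0; have kap0 : kap = 0 by rewrite /kap max_r// oppr_le0 ltW.
have conc r := gaussian_concentration sepX mfin cd (x0 := x0) (r := r) K0 ler01 ^~ B0.
set b := ln (fine (m [set x | (mdist x0 x < 1)%R])) in conc *; pose C := 2 * ln V - b + ln 8.
pose d := (4 * (q + 1))^-1; have d0 : 0 < d by rewrite invr_gt0 mulr_gt0// ltr_wpDl.
have Kd : 0 < K * d ^+ 2 by rewrite mulr_gt0// exprn_gt0.
pose Y := `|C| + 8 / (K * d ^+ 2) + 2 * `|6 * q - b + ln 2|.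
exists (expR (- Y)); first exact: expR_gt0.
move=> v /andP[v0 vY]; pose y := - ln v.
have yY : Y <= y by rewrite /y lerNr -ler_expR lnK ?posrE.
have y8 : 8 / (K * d ^+ 2) <= y.
  have h1 := normr_ge0 C; have h2 := normr_ge0 (6 * q - b + ln 2); apply: le_trans yY.
  by rewrite /Y; move: h1 h2; set c1 := `|C|; set c2 := `|_|; set c3 := 8 / _; lra.
have yC : C <= y.
  have h1 := ler_norm C; have h2 := normr_ge0 (6 * q - b + ln 2).
  have h3 : 0 <= 8 / (K * d ^+ 2) by rewrite divr_ge0// ltW.
  by apply: le_trans yY; rewrite /Y; move: h1 h2 h3; set c1 := `|C|; set c2 := `|_|; set c3 := 8 / _; lra.
have yq : 6 * q - b + ln 2 <= y / 2.
  have h1 := normr_ge0 C; have h2 := ler_norm (6 * q - b + ln 2).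
  have h3 : 0 <= 8 / (K * d ^+ 2) by rewrite divr_ge0// ltW.
  by move: yY h1 h2 h3; rewrite /Y; set c1 := `|C|; set c2 := `|_|; set c3 := 8 / _; lra.
have y0 : 0 <= y by rewrite (le_trans _ y8)// divr_ge0// ltW.
have dq : 2 * q * d <= 2^-1.
  by rewrite /d ler_pdivrMr ?mulr_gt0// ?ltr_wpDl//; lra.
have h0 : 1 <= 1 + d * y by rewrite lerDl mulr_ge0// ltW.
exists (1 + d * y); split; first exact: le_trans ler01 h0.
  apply: le_trans (conc _ h0) _; rewrite lee_fin -[leRHS]lnK ?posrE ?divr_gt0// ler_expR.
  rewrite lnM ?posrE ?invr_gt0// lnV ?posrE//.
  have -> : 1 + d * y - 1 = d * y by ring.
  have : 8 * y <= (K * d ^+ 2) * y * y.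
    by rewrite ler_wpM2r// mulrC -ler_pdivrMr.
  have -> : ln v = - y by rewrite opprK.
  move: yC; rewrite -/V -/b /C exprMn (expr2 y); lra.
rewrite kap0 mul0r mul0r subr0 lnM ?posrE//.
have : 2 * q * d * y <= 2^-1 * y by rewrite ler_wpM2r.
by move: yq; rewrite /y; lra.
Qed.

Lemma small_sets (x0 : X) (e : R) : 0 < e ->
  (0 < m [set x | (mdist x0 x < 1)%R])%E -> (diam [set: X] < +oo)%E \/ 0 < K ->
  exists2 om : R, 0 < om & forall E : set (borel X), measurable E ->
    (m E <= om%:E)%E -> (m E <= e%:E * Per m E)%E.
Proof.
move=> e0 B0 h; apply: (small_sets_of_tails e0 B0) => q q0; case: h => h.
  exact: bounded_tails.
exact: positive_curvature_tails.
Qed.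

End small_sets.

Section scaling.
Context (R : realType) (X : completeMetricType R).
Variable m : {measure set (borel X) -> \bar R}.

Lemma limn_einfZ (u : (\bar R)^nat) (k : R) : 0 < k ->
  limn_einf (fun n => (k%:E * u n)%E) = (k%:E * limn_einf u)%E.
Proof.
move=> k0; have E v : limn_einf v = ereal_sup (range (einfs v)) :> \bar R.
  by rewrite limn_einf_lim; apply: cvg_lim => //; exact: cvg_einfs_sup.
rewrite !E -ereal_sup_pZl//; congr ereal_sup; apply/seteqP; split => [_ [n _ <-]|_ [_ [n _ <-] <-]].
  exists (einfs u n); first by exists n.
  rewrite /einfs/= -ereal_inf_pZl//; congr ereal_inf.
  by rewrite /sdrop image_comp.
exists n => //; rewrite /einfs/= -ereal_inf_pZl//; congr ereal_inf.
by rewrite /sdrop image_comp.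
Qed.

Lemma per_mscale (k : {nonneg R}) (A : set (borel X)) : 0 < k%:num -> measurable A ->
  Per (mscale k m) A = (k%:num%:E * Per m A)%E.
Proof.
move=> k0 mA.
have mf f : Lip_loc f -> measurable_fun setT (f : borel X -> R).
  by move=> lf; apply: mcontinuous_measurable; exact: lip_loc_mcontinuous.
have sE f : Lip_loc f -> (\int[mscale k m]_x slope f x = k%:num%:E * \int[m]_x slope f x)%E.
  move=> lf; rewrite ge0_integral_mscale//.
    by apply: measurable_slope; exact: lip_loc_mcontinuous.
  by move=> x _; exact: slope_ge0.
have nE f : Lip_loc f -> ('N[mscale k m]_1 [(fun x => (f x - \1_A x)%:E)] =
    k%:num%:E * 'N[m]_1 [(fun x => (f x - \1_A x)%:E)])%E.
  move=> lf; rewrite !Lnorm1 ge0_integral_mscale//.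
  apply: measurableT_comp => //; apply/measurable_EFinP; apply: measurable_funB => //.
  exact: mf.
have cE f_ : (forall n, Lip_loc (f_ n)) -> cvg_Lp (mscale k m) 1 f_ \1_A <-> cvg_Lp m 1 f_ \1_A.
  move=> lf; rewrite /cvg_Lp; under eq_fun do rewrite nE//; split => h.
    have kk : (k%:num^-1%:E * k%:num%:E = 1 :> \bar R)%E by rewrite -EFinM mulVf// gt_eqF.
    have := cvgeZl (_ : (k%:num^-1%:E \is a fin_num)) h; rewrite mule0.
    move=> /(_ isT); under eq_fun do rewrite muleA kk mul1e; exact.
  by have := cvgeZl (_ : (k%:num%:E \is a fin_num)) h; rewrite mule0; exact.
rewrite /Per -ereal_inf_pZl//; congr ereal_inf; apply/seteqP; split.
  move=> _ [f_ [lf cf] <-]; exists (limn_einf (fun n => \int[m]_x slope (f_ n) x))%E.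
    by exists f_ => //; split => //; apply/cE.
  by rewrite -limn_einfZ//; congr limn_einf; apply/funext => n; rewrite sE.
move=> _ [_ [f_ [lf cf] <-] <-]; exists f_; first by split => //; apply/cE.
by rewrite -limn_einfZ//; congr limn_einf; apply/funext => n; rewrite sE.
Qed.

Hypothesis mfin : (m setT < +oo)%E.
Hypothesis mpos : (0 < m setT)%E.
Let V := fine (m setT).

Let V0 : 0 < V. Proof. by rewrite fine_gt0// mpos. Qed.

Let k0 : 0 < (total_mass_inv m)%:num. Proof. by rewrite /= invr_gt0. Qed.

Let scale_profile (E : set (borel X)) (e : R) : measurable E ->
  (mscale (total_mass_inv m) m E <= e%:E * Per (mscale (total_mass_inv m) m) E)%E =
  (m E <= e%:E * Per m E)%E.
Proof.
move=> mE; rewrite per_mscale// muleCA /mscale/=.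
by rewrite lee_pmul2l// lte_fin; exact: k0.
Qed.

Let scale_le (E : set (borel X)) (c : R) : measurable E ->
  (mscale (total_mass_inv m) m E <= c%:E)%E = (m E <= (c * V)%:E)%E.
Proof.
move=> mE; rewrite /mscale/= muleC lee_pdivrMr// -EFinM//.
Qed.

(** Both sides of the isoperimetric bound scale in the same way, so normalising
    [m] only changes the threshold. *)
Lemma superlinear_profileP : superlinear_profile m <->
  forall e : R, 0 < e -> exists2 om : R, 0 < om & forall E : set (borel X), measurable E ->
    (m E <= om%:E)%E -> (m E <= e%:E * Per m E)%E.
Proof.
split => [[w [w0 h]] e e0|h].
  have /andP[we _] := w0 e e0; exists (w e * V); first by rewrite mulr_gt0.
  by move=> E mE Ew; rewrite -scale_profile//; apply: h => //; rewrite scale_le.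
have H e : exists w : R, 0 < e -> 0 < w <= 2^-1 /\ forall E : set (borel X), measurable E ->
    (m E <= (w * V)%:E)%E -> (m E <= e%:E * Per m E)%E.
  have [e0|] := ltP 0 e; last by exists 0.
  have [om om0 hom] := h e e0; exists (Num.min 2^-1 (om / V)) => _; split.
    by rewrite lt_min invr_gt0 ltr0n/= divr_gt0//= ge_min lexx.
  move=> E mE Ew; apply: hom => //; apply: le_trans Ew _; rewrite lee_fin.
  by rewrite -ler_pdivlMr// ge_min lexx orbT.
have [w hw] := choice H; exists w; split=> [e e0|e E e0 mE]; first by have [] := hw e e0.
by rewrite scale_le// scale_profile//; have [_] := hw e e0; exact.
Qed.

End scaling.

(** * Hopf-Lax evolution *)

Section hopf_lax.
Context (R : realType) (X : completeMetricType R).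
Variables (g : X -> R) (L : R).
Hypothesis L0 : 0 <= L.
Hypothesis gL : forall x y, `|g x - g y| <= L * mdist x y.
Hypothesis g01 : forall x, 0 <= g x <= 1.

(** The logarithm of [hopf k] is the Hopf-Lax evolution of [ln (g ^+ 2)] for the
    cost [mdist ^+ 2 / k]. *)
Definition hopf (k : R) (z : X) : R :=
  sup [set g x ^+ 2 * expR (- (mdist x z ^+ 2 / k)) | x in [set: X]].

Let term01 k x z : 0 < k -> 0 <= g x ^+ 2 * expR (- (mdist x z ^+ 2 / k)) <= 1.
Proof.
move=> k0; have /andP[a0 a1] := g01 x; rewrite mulr_ge0 ?sqr_ge0 ?expR_ge0//=.
rewrite mulr_ile1 ?sqr_ge0 ?expR_ge0//; first by rewrite expr_le1.
by rewrite -expR0 ler_expR oppr_le0 divr_ge0 ?sqr_ge0// ltW.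
Qed.

Let hs k z : 0 < k -> has_sup [set g x ^+ 2 * expR (- (mdist x z ^+ 2 / k)) | x in [set: X]].
Proof.
move=> k0; split; first by exists (g z ^+ 2 * expR (- (mdist z z ^+ 2 / k))); exists z.
by exists 1 => _ [x _ <-]; case/andP: (term01 x z k0).
Qed.

Lemma hopf_ge k x z : 0 < k -> g x ^+ 2 * expR (- (mdist x z ^+ 2 / k)) <= hopf k z.
Proof. by move=> k0; apply: ub_le_sup; [case: (hs z k0)|exists x]. Qed.

Lemma hopf_le k z c : 0 < k ->
  (forall x, g x ^+ 2 * expR (- (mdist x z ^+ 2 / k)) <= c) -> hopf k z <= c.
Proof. by move=> k0 h; apply: ge_sup; [case: (hs z k0)|move=> _ [x _ <-]]. Qed.

Lemma hopf01 k z : 0 < k -> 0 <= hopf k z <= 1.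
Proof.
move=> k0; apply/andP; split; last by apply: hopf_le => // x; case/andP: (term01 x z k0).
by apply: le_trans (hopf_ge z z k0); case/andP: (term01 z z k0).
Qed.

(** Cauchy-Schwarz for [g z * 1 + (l * sqrt k) * (d / sqrt k)], together with
    [1 + s <= expR s]. *)
Let term_le k l x z : 0 < k -> 0 <= l -> `|g x - g z| <= l * mdist x z ->
  g x ^+ 2 * expR (- (mdist x z ^+ 2 / k)) <= g z ^+ 2 + k * l ^+ 2.
Proof.
move=> k0 l0 gxz; set d := mdist x z in gxz *; have d0 : 0 <= d by exact: mdist_ge0.
have /andP[x0 _] := g01 x; have /andP[z0 _] := g01 z.
have gx : g x <= g z + l * d by move: gxz; rewrite ler_norml; lra.
have gx2 : g x ^+ 2 <= (g z + l * d) ^+ 2.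
  by rewrite ler_pXn2r ?nnegrE// addr_ge0// mulr_ge0.
have cs : (g z + l * d) ^+ 2 <= (g z ^+ 2 + k * l ^+ 2) * (1 + d ^+ 2 / k).
  rewrite -(ler_pM2r k0) -subr_ge0.
  have -> : (g z ^+ 2 + k * l ^+ 2) * (1 + d ^+ 2 / k) * k - (g z + l * d) ^+ 2 * k =
    (g z * d - k * l) ^+ 2 by field; rewrite gt_eqF.
  exact: sqr_ge0.
have c0 : 0 <= g z ^+ 2 + k * l ^+ 2 by rewrite addr_ge0 ?sqr_ge0// mulr_ge0 ?sqr_ge0// ltW.
rewrite expRN ler_pdivrMr ?expR_gt0// (le_trans gx2)// (le_trans cs)//.
by rewrite ler_wpM2l// expR_ge1Dx.
Qed.

Lemma hopf_lip k z : 0 < k -> hopf k z <= g z ^+ 2 + k * L ^+ 2.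
Proof. by move=> k0; apply: hopf_le => // x; exact: term_le. Qed.

(** The exponential makes the contribution of the points at a fixed positive
    distance [o(k)], so only the slope at [z] matters in the limit. *)
Lemma hopf_slope (k : nat -> R) z e : (forall n, 0 < k n) -> k @ \oo --> 0 -> 0 < e ->
  \forall n \near \oo, (hopf (k n) z - g z ^+ 2) / k n <= sl g z ^+ 2 + e.
Proof.
move=> k0 kcv e0; have s0 := sl_ge0 g z.
have s1 : 0 < 2 * sl g z + 1 by rewrite ltr_wpDl// mulr_ge0.
pose e' := Num.min 1 (e / (2 * sl g z + 1)).
have e'0 : 0 < e' by rewrite lt_min ltr01 divr_gt0.
have e'1 : e' <= 1 by rewrite ge_min lexx.
have e'e : e' * (2 * sl g z + 1) <= e by rewrite -ler_pdivlMr// ge_min lexx orbT.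
pose l := sl g z + e'; have l0 : 0 <= l by rewrite addr_ge0// ltW.
have le2 : l ^+ 2 <= sl g z ^+ 2 + e.
  have : e' * e' <= e' * 1 by rewrite ler_wpM2l// ltW.
  by rewrite /l sqrrD expr2; lra.
have lg : lipschitz_in setT g by exists L => x y _ _; exact: gL.
have se : sl g z < l by rewrite ltrDl.
have [d d0 hd] := sl_lt (lip_loc_slE z (lipschitz_lip_loc lg)) se.
have d4 : 0 < d ^+ 4 by rewrite exprn_gt0.
have ke0 : 0 < e * d ^+ 4 / 4 by rewrite divr_gt0// mulr_gt0.
have /cvgrPdist_lt /(_ _ ke0) := kcv; apply: filterS => n.
rewrite sub0r normrN gtr0_norm// => kn; set kk := k n in kn *; have kk0 : 0 < kk := k0 n.
rewrite ler_pdivrMr// lerBlDl mulrC; apply: hopf_le => // x.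
have [xz|zx] := ltP (mdist x z) d.
  apply: (@le_trans _ _ (g z ^+ 2 + kk * l ^+ 2)).
    by apply: term_le => //; rewrite metric_sym; apply: hd; rewrite metric_sym.
  by rewrite lerD2l ler_wpM2l// ltW.
set s := mdist x z ^+ 2 / kk.
have sd : d ^+ 2 / kk <= s.
  by rewrite ler_pM2r ?invr_gt0// ler_pXn2r ?nnegrE ?mdist_ge0// ltW.
have dk0 : 0 < d ^+ 2 / kk by rewrite divr_gt0// exprn_gt0.
have s0' : 0 < s by exact: lt_le_trans sd.
have exps : s ^+ 2 / 4 <= expR s.
  have -> : s = s / 2 + s / 2 by lra.
  rewrite expRD; have h := expR_ge1Dx (s / 2).
  have h2 : s / 2 <= expR (s / 2) by move: h; lra.
  have := ler_pM (ltW (divr_gt0 s0' (ltr0Sn _ 1))) (ltW (divr_gt0 s0' (ltr0Sn _ 1))) h2 h2.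
  by apply: le_trans; rewrite expr2; lra.
have /andP[x0 x1] := g01 x; have x2 : g x ^+ 2 <= 1 by rewrite expr_le1.
apply: (@le_trans _ _ (kk * e)); last first.
  rewrite mulrDr addrA -[leLHS]add0r lerD2r addr_ge0 ?sqr_ge0// mulr_ge0 ?sqr_ge0//; exact: ltW.
apply: (@le_trans _ _ (expR (- s))); first by rewrite ler_piMl// expR_ge0.
rewrite expRN -[leLHS]div1r ler_pdivrMr ?expR_gt0//.
apply: (@le_trans _ _ (kk * e * ((d ^+ 2 / kk) ^+ 2 / 4))); last first.
  rewrite ler_wpM2l ?mulr_ge0 ?(ltW kk0) ?(ltW e0)// (le_trans _ exps)// ler_pM2r ?invr_gt0//.
  by rewrite ler_pXn2r ?nnegrE// ltW.
have -> : kk * e * ((d ^+ 2 / kk) ^+ 2 / 4) = (e * d ^+ 4 / 4) / kk.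
  by field; rewrite gt_eqF.
by rewrite ler_pdivlMr// mul1r ltW.
Qed.

Lemma bmf_hopf k : 0 < k -> @bmf _ (borel X) R (hopf k).
Proof.
move=> k0; split; last first.
  by exists 1 => z; have /andP[? ?] := hopf01 z k0; rewrite ger0_norm.
apply: (measurability _ (RGenOInfty.measurableE R)) => _ /= [_ [s ->] <-].
rewrite setTI; apply: borel_open.
rewrite (_ : _ @^-1` _ = \bigcup_x [set z | s < g x ^+ 2 * expR (- (mdist x z ^+ 2 / k))]).
  apply: bigcup_open => x _; have [c0|c0] := eqVneq (g x) 0.
    have -> : [set z | s < g x ^+ 2 * expR (- (mdist x z ^+ 2 / k))] = [set z | s < 0].
      by apply/funext => z /=; rewrite c0 expr0n mul0r.
    have [s0|s0] := ltP s 0.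
      suff -> : [set _ : X | true] = setT by exact: openT.
      by apply/seteqP; split.
    suff -> : [set _ : X | false] = set0 by exact: open0.
    by apply/seteqP; split.
  have c2 : 0 < g x ^+ 2 by rewrite exprn_even_gt0.
  have [s0|s0] := leP s 0.
    rewrite (_ : [set z | _] = setT); first exact: openT.
    by apply/seteqP; split => z //= _; rewrite (le_lt_trans s0)// mulr_gt0// expR_gt0.
  rewrite (_ : [set z | _] = [set z | mdist x z ^+ 2 < k * ln (g x ^+ 2 / s)]).
    have [b0|b0] := leP (k * ln (g x ^+ 2 / s)) 0.
      rewrite (_ : [set z | _] = set0); first exact: open0.
      by apply/seteqP; split => z //=; rewrite ltNge (le_trans b0)// sqr_ge0.
    rewrite (_ : [set z | _] = [set z | mdist x z < Num.sqrt (k * ln (g x ^+ 2 / s))]).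
      exact: open_mball.
    apply/funext => z /=; apply/propext.
    by rewrite -[X in X < Num.sqrt _]ger0_norm ?mdist_ge0// -sqrtr_sqr ltr_sqrt.
  apply/funext => z /=; apply/propext.
  rewrite mulrC -ltr_pdivrMr// -[X in X < expR _]lnK ?posrE ?divr_gt0// ltr_expR.
  by rewrite ltrNr -lnV ?posrE ?divr_gt0// invf_div ltr_pdivrMr// mulrC.
apply/seteqP; split => z /=; rewrite in_itv/= andbT.
  by move=> /(sup_gt (hs z k0).1)[_ [x _ <-] sx]; exists x.
by move=> [x _ /= sx]; exact: lt_le_trans sx (hopf_ge x z k0).
Qed.

End hopf_lax.

(** * Moving a small amount of mass *)

Section image.
Context d1 d2 (T1 : measurableType d1) (T2 : measurableType d2) (R : realType).
Variables (mu : {measure set T1 -> \bar R}) (nu : {measure set T2 -> \bar R}).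
Hypothesis mufin : (mu setT < +oo)%E.

Lemma Rintegral_image (phi : T1 -> T2) (f : T2 -> R) : measurable_fun setT phi -> bmf f ->
  (forall S, measurable S -> nu S = mu (phi @^-1` S)) ->
  \int[nu]_x f x = \int[mu]_x f (phi x).
Proof.
move=> mphi /[dup] bf [mf [C fC]] h.
have nuT : nu setT = mu setT by rewrite h.
have nufin : (nu setT < +oo)%E by rewrite nuT.
have bC1 := @bmf_cst _ T1 R C; have bC2 := @bmf_cst _ T2 R C.
have bfphi : bmf (fun x => f (phi x)).
  by split; [exact: measurableT_comp|exists C => x; exact: fC].
have fC0 x : 0 <= f x + C by have := fC x; rewrite ler_norml; lra.
have := integral_image_measure mphi (bmfD bf bC2).1 fC0 h.
rewrite -!RintE//; [|exact: bmfD|exact: bmfD].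
rewrite !RintD// !Rint_cst nuT => -[].
exact: addIr.
Qed.

End image.

Section perturbed_coupling.
Context (R : realType) (X : completeMetricType R).
Hypothesis sepX : separable X.
Implicit Types mu nu : probability (borel X) R.
Local Open Scope ereal_scope.

(** The common part [nu] stays where it is, and only the mass [th] is coupled,
    through the product of [u] and [v]. *)
Lemma cost_move (mu0 mu1 u v : probability (borel X) R) (nu : {measure set (borel X) -> \bar R}) (th D : R)
    (A B : set (borel X)) : (0 <= th)%R -> (0 <= D)%R ->
  (forall S, measurable S -> mu0 S = nu S + th%:E * u S) ->
  (forall S, measurable S -> mu1 S = nu S + th%:E * v S) ->
  measurable A -> measurable B -> u A = 1 -> v B = 1 ->
  (forall x y, A x -> B y -> mdist (x : X) (y : X) <= D)%R ->
  cost mu0 mu1 <= (th * D ^+ 2)%:E.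
Proof.
move=> th0 D0 h0 h1 mA mB uA vB AB.
pose diag (x : borel X) : (borel X * borel X)%type := (x, x).
have mdiag : measurable_fun setT diag by exact: measurable_fun_pair.
pose P1 : {measure set (borel X * borel X)%type -> \bar R} :=
  measure_function_pushforward__canonical__measure_function_Measure nu mdiag.
have p2 S S' : measurable S -> measurable S' -> (u \x v) (S `*` S') = u S * v S'.
  by move=> mS mS'; exact: product_measure1E.
have p1 : (u \x v) setT = 1 by rewrite -setXTT p2// !probability_setT mule1.
have [uv uvE0] := probability_of_measure p1.
have uvE S S' : measurable S -> measurable S' -> uv (S `*` S') = u S * v S'.
  by move=> mS mS'; exact: etrans (uvE0 _) (p2 _ _ mS mS').
pose P2' : {measure set (borel X * borel X)%type -> \bar R} := [the measure _ _ of mscale (NngNum th0) uv].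
pose P : {measure set (borel X * borel X)%type -> \bar R} := [the measure _ _ of measure_add P1 P2'].
have PE S S' : measurable S -> measurable S' ->
    P (S `*` S') = nu (S `&` S') + th%:E * (u S * v S').
  move=> mS mS'; rewrite -uvE//; exact: measure_addE P1 P2' _.
have l1 S : measurable S -> P (S `*` setT) = mu0 S.
  by move=> mS; rewrite PE// setIT probability_setT mule1 -h0.
have l2 S : measurable S -> P (setT `*` S) = mu1 S.
  by move=> mS; rewrite PE// setTI probability_setT mul1e -h1.
have PT : P setT = 1 by rewrite -setXTT l1// probability_setT.
have [Q QE] := probability_of_measure PT.
have md := measurable_mdist2 sepX.
have md0 p : (0 <= mdist (p.1 : X) (p.2 : X) ^+ 2)%R by exact: sqr_ge0.
apply: (@le_trans _ _ (\int[Q]_p (mdist (p.1 : X) (p.2 : X) ^+ 2)%:E)).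
  by apply: ereal_inf_lbound; exists Q => // S mS; rewrite !QE l1// l2.
have -> : \int[Q]_p (mdist (p.1 : X) (p.2 : X) ^+ 2)%:E =
    \int[P]_p (mdist (p.1 : X) (p.2 : X) ^+ 2)%:E.
  by apply: eq_measure_integral => S mS _; exact: QE.
have mE : measurable_fun setT (fun p : borel X * borel X => (mdist (p.1 : X) (p.2 : X) ^+ 2)%:E).
  exact/measurable_EFinP.
have E0 p : setT p -> 0 <= (mdist (p.1 : X) (p.2 : X) ^+ 2)%:E by rewrite lee_fin.
rewrite (ge0_integral_measure_add P1 P2' measurableT E0 mE).
rewrite (@integral_image_measure _ _ _ _ _ nu P1 diag)//.
under eq_integral do rewrite /diag/= mdistxx expr0n.
rewrite integral0 add0e /P2' ge0_integral_mscale//=.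
rewrite EFinM; apply: lee_wpmul2l; first by rewrite lee_fin.
have uvT : uv setT = 1 by rewrite -setXTT uvE// !probability_setT mule1.
apply: (@integral_le_full _ _ _ uv (A `*` B)) => //.
- exact: measurableX.
- apply: full_setX => //.
  + by apply: etrans (uvE _ _ (measurableC mA) measurableT) _; rewrite full_setC// mul0e.
  + by apply: etrans (uvE _ _ measurableT (measurableC mB)) _; rewrite full_setC// mule0.
- exact: sqr_ge0.
- by move=> [x y] [/= Ax By]; rewrite ler_pXn2r ?nnegrE ?mdist_ge0//; exact: AB.
Qed.

End perturbed_coupling.

(** * An HWI-type inequality and a capacity estimate *)

Section capacity.
Context (R : realType) (X : completeMetricType R).
Variable m : {measure set (borel X) -> \bar R}.
Hypothesis sepX : separable X.
Hypothesis mfin : (m setT < +oo)%E.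
Let V := fine (m setT).
Variable K : R.
Hypothesis cd : CD_infty m K.
Let kap := Num.max (- K) 0.

Section function.
Variables (g : X -> R) (L : R).
Hypothesis L0 : 0 <= L.
Hypothesis gL : forall x y, `|g x - g y| <= L * mdist x y.
Hypothesis g01 : forall x, 0 <= g x <= 1.
Let N := \int[m]_x (g x ^+ 2).
Hypothesis N0 : 0 < N.

Let bg : @bmf _ (borel X) R g.
Proof.
apply: (@lipschitz_bmf _ _ g 1); first by exists L => x y _ _; exact: gL.
by move=> x; have /andP[? ?] := g01 x; rewrite ger0_norm.
Qed.

Let bg2 : @bmf _ (borel X) R (fun x => g x ^+ 2). Proof. exact: bmfX. Qed.

Let rho (x : borel X) := N^-1 * g x ^+ 2.

Let brho : bmf rho. Proof. by apply: bmfM => //; exact: bmf_cst. Qed.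

Let rho0 x : 0 <= rho x. Proof. by rewrite mulr_ge0 ?sqr_ge0// invr_ge0 ltW. Qed.

Let rhoM x : rho x <= N^-1.
Proof.
have /andP[a0 a1] := g01 x.
by rewrite ler_piMr ?invr_ge0 ?(ltW N0)// expr_le1.
Qed.

(** Otto-Villani's estimate of the entropy near [g ^+ 2], at positive times: the
    entropy at [nu] is tested against [ln] of the Hopf-Lax evolution of
    [g ^+ 2]. The term [t ^+ 2] keeps the logarithm bounded and is negligible. *)
Lemma ent_near (mu nu : probability (borel X) R) (C t ta : R) : density m mu rho ->
  0 < t -> 0 < ta -> (cost mu nu < (t ^+ 2 * C)%:E)%E ->
  ((\int[m]_x rho_log_rho rho x - t * (C / (2 * ta)) + 1 -
    N^-1 * \int[m]_x (hopf g (2 * t * ta) x + t ^+ 2))%:E <= Ent m nu)%E.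
Proof.
move=> [mr r0 hr] t0 ta0 costC; set k := 2 * t * ta.
have k0 : 0 < k by rewrite !mulr_gt0.
have t2 : 0 < t ^+ 2 by rewrite exprn_gt0.
have bh : @bmf _ (borel X) R (hopf g k) by exact: bmf_hopf.
have h0 z : 0 <= hopf g k z <= 1 by exact: hopf01.
have bln (f : borel X -> R) : bmf f -> (forall x, 0 <= f x <= 1) ->
    bmf (fun x => ln ((f x + t ^+ 2) / N)).
  move=> [mf _] f01; split.
    apply: measurableT_comp => //; apply: measurable_funM => //.
    by apply: measurable_funD.
  exists (`|ln (t ^+ 2 / N)| + `|ln ((1 + t ^+ 2) / N)|) => x; have /andP[f0 f1] := f01 x.
  have p1 : 0 < t ^+ 2 / N by rewrite divr_gt0.
  have p2 : 0 < (f x + t ^+ 2) / N by rewrite divr_gt0// ltr_wpDl.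
  have p3 : 0 < (1 + t ^+ 2) / N by rewrite divr_gt0// addr_gt0.
  have l1 : ln (t ^+ 2 / N) <= ln ((f x + t ^+ 2) / N).
    by rewrite ler_ln ?posrE// ler_pM2r ?invr_gt0// lerDr.
  have l2 : ln ((f x + t ^+ 2) / N) <= ln ((1 + t ^+ 2) / N).
    by rewrite ler_ln ?posrE// ler_pM2r ?invr_gt0// lerD2r.
  have n1 := normr_ge0 (ln (t ^+ 2 / N)); have n2 := normr_ge0 (ln ((1 + t ^+ 2) / N)).
  have n3 := lerNnormlW (lexx `|ln (t ^+ 2 / N)|); have n4 := ler_norm (ln ((1 + t ^+ 2) / N)).
  by rewrite ler_norml; apply/andP; split; lra.
pose phi (z : borel X) := ln ((hopf g k z + t ^+ 2) / N).
pose psi (x : borel X) := ln ((g x ^+ 2 + t ^+ 2) / N).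
have bphi : bmf phi by exact: bln.
have bpsi : bmf psi.
  by apply: (bln _ bg2) => x; have /andP[? ?] := g01 x; rewrite sqr_ge0 expr_le1.
have Ephi : \int[m]_x expR (phi x) = N^-1 * \int[m]_x (hopf g k x + t ^+ 2).
  rewrite -RintZ//; last by apply: bmfD => //; exact: bmf_cst.
  apply: eq_Rintegral => x _; rewrite /phi lnK; first by rewrite mulrC.
  by rewrite posrE divr_gt0// ltr_wpDl//; have /andP[] := h0 x.
apply: le_trans (ent_gibbs mfin nu bphi); rewrite lee_fin Ephi lerD2r lerD2r.
have mufin : (mu setT < +oo)%E by rewrite probability_setT ltry.
have psiE : \int[m]_x rho_log_rho rho x <= \int[mu]_x psi x.
  rewrite (Rintegral_density mfin mufin mr r0 hr)//; apply: Rint_le => //.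
  - by apply: (@bmf_xlnx _ _ _ N^-1 mr) => x; rewrite rho0 rhoM.
  - exact: bmfM.
  move=> x; have [gx|gx] := eqVneq (g x) 0; first by rewrite /rho_log_rho /rho gx expr0n !mulr0 !mul0r.
  rewrite /rho_log_rho ler_wpM2l//; have gx2 : 0 < g x ^+ 2 by rewrite exprn_even_gt0.
  rewrite ler_ln ?posrE ?divr_gt0 ?addr_gt0//; last by rewrite mulr_gt0// invr_gt0.
  by rewrite /rho mulrC ler_pM2r ?invr_gt0// lerDl ltW.
have [pi cpi Ipi] := near_optimal costC.
have pifin : (pi setT < +oo)%E by rewrite probability_setT ltry.
have muE : \int[mu]_x psi x = \int[pi]_p psi p.1.
  apply: (Rintegral_image pifin (phi := fst)) => // S mS.
  have [h _] := cpi S mS; apply: etrans (esym h) _; congr (pi _).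
  by apply/seteqP; split => p //=; case.
have nuE : \int[nu]_x phi x = \int[pi]_p phi p.2.
  apply: (Rintegral_image pifin (phi := snd)) => // S mS.
  have [_ h] := cpi S mS; apply: etrans (esym h) _; congr (pi _).
  by apply/seteqP; split => p //=; case.
have b1 : bmf (fun p : borel X * borel X => psi p.1).
  by split; [apply: measurableT_comp => //; exact: bpsi.1|have [_ [c hc]] := bpsi; exists c => p; exact: hc].
have b2 : bmf (fun p : borel X * borel X => phi p.2).
  by split; [apply: measurableT_comp => //; exact: bphi.1|have [_ [c hc]] := bphi; exists c => p; exact: hc].
have b3 : bmf (fun p : borel X * borel X => Num.max (psi p.1 - phi p.2) 0).
  by apply: bmf_max; [exact: bmfB|exact: bmf_cst].
suff : \int[pi]_p (psi p.1 - phi p.2) <= t * (C / (2 * ta)).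
  by rewrite (RintB pifin)// -muE -nuE; move: psiE; lra.
apply: (@le_trans _ _ (\int[pi]_p Num.max (psi p.1 - phi p.2) 0)).
  apply: (Rint_le pifin) => //; first exact: bmfB.
  by move=> p; rewrite le_max lexx.
have md := measurable_mdist2 sepX.
have k00 : 0 <= k^-1 by rewrite invr_ge0 ltW.
rewrite -lee_fin (RintE pifin)//.
apply: (@le_trans _ _ (\int[pi]_p (k^-1 * mdist (p.1 : X) (p.2 : X) ^+ 2)%:E)%E).
  apply: ge0_le_integral => //.
  - by move=> p _; rewrite lee_fin le_max lexx orbT.
  - by apply/measurable_EFinP; exact: b3.1.
  - by apply/measurable_EFinP; exact: measurable_funM.
  move=> [x z] _; rewrite lee_fin ge_max /= mulr_ge0 ?sqr_ge0// andbT mulrC.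
  set s := mdist x z ^+ 2 / k; have s0 : 0 <= s by rewrite divr_ge0 ?sqr_ge0// ltW.
  have p1 : 0 < (hopf g k z + t ^+ 2) / N.
    by rewrite divr_gt0// ltr_wpDl//; have /andP[] := h0 z.
  have p2 : 0 < (g x ^+ 2 + t ^+ 2) / N by rewrite divr_gt0// ltr_wpDl// sqr_ge0.
  have p3 := expR_gt0 s.
  rewrite lerBlDr -[X in _ <= X + _](expRK s) /phi /psi -lnM ?posrE//.
  have e1 : 1 <= expR s by rewrite -expR0 ler_expR.
  have hz : g x ^+ 2 <= expR s * hopf g k z.
    by have := hopf_ge g01 x z k0; rewrite -/s expRN ler_pdivrMr ?expR_gt0// mulrC.
  rewrite ler_ln ?posrE//; last exact: mulr_gt0.
  rewrite mulrA ler_pM2r ?invr_gt0// mulrDr lerD// ler_peMl// ltW//.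
under eq_integral do rewrite EFinM.
rewrite ge0_integralZl//; last 2 first.
- exact/measurable_EFinP.
- by move=> p _; rewrite lee_fin sqr_ge0.
have k0E : (0 <= k^-1%:E)%E by rewrite lee_fin.
apply: le_trans (lee_wpmul2l k0E (ltW Ipi)) _; rewrite -EFinM lee_fin.
rewrite (_ : k^-1 * _ = t * (C / (2 * ta)))// /k; field.
by rewrite !gt_eqF.
Qed.

(** Differentiating [ent_near] at time zero along a geodesic and using the
    convexity of the entropy: an HWI-type inequality. *)
Lemma hwi (mu0 mu1 : probability (borel X) R) (U1 c0 C D0 ta : R) (S : set (borel X)) (x0 : X) :
  density m mu0 rho -> (Ent m mu1 <= U1%:E)%E ->
  measurable S -> mu0 S = 1%E -> mu1 S = 1%E -> 0 <= D0 -> (forall x, S x -> mdist x0 x <= D0) ->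
  cost mu0 mu1 = c0%:E -> c0 < C -> 0 < ta ->
  N * (\int[m]_x rho_log_rho rho x - U1 - kap / 2 * C - C / (2 * ta)) <=
  2 * ta * \int[m]_x (sl g x ^+ 2).
Proof.
move=> d0 E1 mS S0 S1 D00 SD c0E c0C ta0; set E0 := \int[m]_x rho_log_rho rho x.
have Ent0 : (Ent m mu0 <= E0%:E)%E by exact: ent_le_integral d0 rhoM.
have [mu_ geo H] := cd_interpolation mfin cd Ent0 E1 mS S0 S1 D00 SD c0E.
have c00 : 0 <= c0 by rewrite -lee_fin -c0E cost_ge0.
pose t (n : nat) : R := n.+1%:R^-1.
have t0 n : 0 < t n by rewrite invr_gt0.
have t1 n : t n <= 1 by rewrite invf_le1// ler1n.
have tcv : t @ \oo --> 0 by exact: cvg_harmonic.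
pose k n := 2 * t n * ta; have k0 n : 0 < k n by rewrite !mulr_gt0.
have kcv : k @ \oo --> (0 : R).
  rewrite (_ : k = fun n => (2 * ta) * t n); last by apply/funext => n; rewrite /k mulrAC.
  rewrite -[X in _ --> X](mulr0 (2 * ta)); apply: cvgM; first exact: cvg_cst.
  exact: tcv.
have bh n : @bmf _ (borel X) R (hopf g (k n)) by exact: bmf_hopf.
pose q n (x : borel X) := 2 * ta * ((hopf g (k n) x - g x ^+ 2) / k n) + t n.
have bq n : bmf (q n).
  apply: bmfD; last exact: bmf_cst.
  apply: bmfM; first exact: bmf_cst.
  by apply: bmfM; [exact: bmfB|exact: bmf_cst].
have lg : lipschitz_in setT g by exists L => x y _ _; exact: gL.
have bs : @bmf _ (borel X) R (fun x => 2 * ta * sl g x ^+ 2).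
  by apply: bmfM; [exact: bmf_cst|apply: bmfX; exact: lipschitz_bmf_sl].
have ta2 : 0 < 2 * ta by rewrite mulr_gt0.
rewrite -RintZ//; last by apply: bmfX; exact: lipschitz_bmf_sl.
apply: (reverse_fatou mfin bq (C := 2 * ta * L ^+ 2 + 1)) => //.
- move=> n x; rewrite /q lerD// ler_pM2l// ler_pdivrMr// lerBlDl mulrC.
  exact: hopf_lip.
- move=> x; rewrite -[leLHS]addr0 lerD// ler_pM2l//.
  by rewrite ler_pXn2r ?nnegrE ?sl_ge0//; exact: lipschitz_sl_le.
- move=> x e e0; have e2 : 0 < e / (4 * ta) by rewrite divr_gt0// mulr_gt0.
  have e3 : 0 < e / 2 by rewrite divr_gt0.
  have /cvgrPdist_lt /(_ _ e3) := tcv.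
  have := hopf_slope gL g01 x k0 kcv e2.
  apply: filterS2 => n h1; rewrite sub0r normrN gtr0_norm// => h2.
  have := ler_wpM2l (ltW ta2) h1; rewrite /q mulrDr.
  have -> : 2 * ta * (e / (4 * ta)) = e / 2 by field; rewrite gt_eqF.
  by move: h2; lra.
move=> n; have t01 : 0 <= t n <= 1 by rewrite ltW//= t1.
have t01' : 0 <= (0 : R) <= 1 by rewrite lexx ler01.
have cost_t : cost mu0 (mu_ (t n)) = (t n ^+ 2 * c0)%:E.
  have [_ ends _] := geo; rewrite (@eq_coupling _ _ _ (mu_ 0) _ (mu_ (t n)))//.
    by rewrite (geodesic_cost geo)// subr0 c0E.
  by move=> A mA; have [-> _] := ends A mA.
have costC : (cost mu0 (mu_ (t n)) < (t n ^+ 2 * C)%:E)%E.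
  by rewrite cost_t lte_fin ltr_pM2l// exprn_gt0.
have := le_trans (ent_near d0 (t0 n) ta0 costC) (H _ t01).
rewrite lee_fin -/E0 -/(k n) RintD//; last exact: bmf_cst.
rewrite Rint_cst -/V; set Ih := \int[m]_x hopf g (k n) x => h.
have -> : \int[m]_x q n x = (Ih - N) / t n + t n * V.
  rewrite /q RintD//; last 2 first.
  - apply: bmfM; first exact: bmf_cst.
    by apply: bmfM; [exact: bmfB|exact: bmf_cst].
  - exact: bmf_cst.
  rewrite Rint_cst; congr (_ + _).
  rewrite (_ : (fun x => _) = fun x => (2 * ta / k n) * (hopf g (k n) x - g x ^+ 2)); last first.
    by apply/funext => x; ring.
  rewrite RintZ; [|by []|exact: bmfB]; rewrite RintB// -/Ih -/N mulrC /k.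
  by field; rewrite !gt_eqF.
have kk : - K * ((1 - t n) * c0) <= kap * C.
  have h1 : (1 - t n) * c0 <= C.
    have := t0 n; have := mulr_ge0 (ltW (t0 n)) c00; move: c0C; lra.
  have h2 : 0 <= (1 - t n) * c0 by rewrite mulr_ge0// subr_ge0.
  have kK : - K <= kap by rewrite /kap le_max lexx.
  have kp : 0 <= kap by rewrite /kap le_max lexx orbT.
  exact: le_trans (ler_wpM2r h2 kK) (ler_wpM2l kp h1).
have := ler_wpM2l (ltW (t0 n)) kk; set a := t n in h *; move=> kk'.
have h' : a * (E0 - U1 - kap / 2 * C - C / (2 * ta)) <= N^-1 * (Ih + a ^+ 2 * V) - 1 by lra.
rewrite -(ler_pM2l (t0 n)) -/a.
have -> : a * ((Ih - N) / a + a * V) = N * (N^-1 * (Ih + a ^+ 2 * V) - 1).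
  by field; rewrite !gt_eqF//; exact: t0.
by rewrite mulrCA ler_pM2l.
Qed.

End function.

Lemma density_full (mu : probability (borel X) R) rho (S : set (borel X)) : density m mu rho ->
  measurable S -> (forall x, ~ S x -> rho x = 0) -> mu S = 1%E.
Proof.
move=> [mr r0 hr] mS rS; rewrite hr// -(probability_setT mu) hr// integral_mkcond.
by apply: eq_integral => x _; rewrite patchE; case: ifPn => // /negP; rewrite inE => /rS ->.
Qed.

(** A capacity bound whose constant depends only on the sets to be separated,
    not on the support of [g]: in [hwi], [mu0] has density proportional to
    [g ^+ 2] and [mu1] is obtained by moving a small fraction [sg] of its mass on
    [A] to [B]. The entropy gained is of order [sg * ln sg], the squared distance
    only of order [sg]. *)
Lemma capacity (g : X -> R) (L sg D D0 : R) (A B : set (borel X)) (x0 : X) : 0 <= L ->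
  (forall x y, `|g x - g y| <= L * mdist x y) -> (forall x, 0 <= g x <= 1) ->
  measurable A -> measurable B -> (0 < m A)%E -> (0 < m B)%E ->
  (forall x, A x -> g x = 1) -> (forall x, B x -> g x = 0) ->
  0 < D -> (forall x y, A x -> B y -> mdist (x : X) (y : X) <= D) ->
  0 <= D0 -> (forall x, g x != 0 -> mdist x0 x <= D0) -> (forall x, B x -> mdist x0 x <= D0) ->
  0 < sg <= 1 -> sg * fine (m A) <= fine (m B) * expR (- (2 + kap * D ^+ 2)) ->
  sg * fine (m A) <= 2 * D ^+ 2 * \int[m]_x (sl g x ^+ 2).
Proof.
move=> L0 gL g01 mA mB A0 B0 gA gB D0' ABD D00 gD BD /andP[sg0 sg1] sgAB.
have lg : lipschitz_in setT g by exists L => x y _ _; exact: gL.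
have bg2 : @bmf _ (borel X) R (fun x => g x ^+ 2).
  apply: bmfX; apply: (@lipschitz_bmf _ _ g 1) => // x.
  by have /andP[? ?] := g01 x; rewrite ger0_norm.
have mAf := mu_fin mfin mA; have mBf := mu_fin mfin mB.
set a := fine (m A) in sgAB *; set b := fine (m B) in sgAB.
have a0 : 0 < a by rewrite fine_gt0// A0 ltey_eq mAf.
have b0 : 0 < b by rewrite fine_gt0// B0 ltey_eq mBf.
have biA : bmf (\1_A : borel X -> R) by exact: bmf_indic.
have biB : bmf (\1_B : borel X -> R) by exact: bmf_indic.
set N := \int[m]_x (g x ^+ 2).
have aN : a <= N.
  rewrite /a -Rint_indic//; apply: Rint_le => // x; rewrite indicE.
  by case: (boolP (x \in A)) => [/set_mem/gA ->|_]; rewrite ?expr1n// sqr_ge0.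
have N0 : 0 < N by exact: lt_le_trans aN.
pose th := sg * a / N; have th0 : 0 < th by rewrite divr_gt0// mulr_gt0.
pose rho (x : borel X) := N^-1 * g x ^+ 2.
pose rn (x : borel X) := rho x - sg / N * \1_A x.
pose rho1 (x : borel X) := rn x + th * (b^-1 * \1_B x).
have brho : bmf rho by apply: bmfM => //; exact: bmf_cst.
have rho0 x : 0 <= rho x by rewrite mulr_ge0 ?sqr_ge0// invr_ge0 ltW.
have rho_int : \int[m]_x rho x = 1 by rewrite RintZ// mulVf// gt_eqF.
have brn : bmf rn by apply: bmfB => //; apply: bmfM => //; exact: bmf_cst.
have rnA x : A x -> rn x = (1 - sg) / N.
  by move=> Ax; rewrite /rn /rho gA// indicE mem_set// expr1n !mulr1; ring.
have rnC x : ~ A x -> rn x = rho x.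
  by move=> nA; rewrite /rn indicE memNset// mulr0 subr0.
have rn0 x : 0 <= rn x.
  have [Ax|nA] := pselect (A x); last by rewrite rnC.
  by rewrite rnA// divr_ge0 ?(ltW N0)// subr_ge0.
have biB' : bmf (fun x : borel X => b^-1 * \1_B x) by apply: bmfM => //; exact: bmf_cst.
have brho1 : bmf rho1 by apply: bmfD => //; apply: bmfM => //; exact: bmf_cst.
have iB0 x : 0 <= b^-1 * \1_B x :> R by rewrite mulr_ge0 ?invr_ge0 ?(ltW b0)// indicE.
have iA0 x : 0 <= a^-1 * \1_A x :> R by rewrite mulr_ge0 ?invr_ge0 ?(ltW a0)// indicE.
have rho10 x : 0 <= rho1 x by rewrite addr_ge0// mulr_ge0// ltW.
have rho1_int : \int[m]_x rho1 x = 1.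
  rewrite /rho1 RintD//; last by apply: bmfM => //; exact: bmf_cst.
  rewrite RintZ// RintZ// Rint_indic// -/b mulVf ?gt_eqF// mulr1.
  rewrite /rn RintB//; last by apply: bmfM => //; exact: bmf_cst.
  by rewrite rho_int RintZ// Rint_indic// -/a /th; ring.
have [mu0 d0] := probability_of_density mfin brho rho0 rho_int.
have [mu1 d1] := probability_of_density mfin brho1 rho10 rho1_int.
have [u du uA] := uniform_on mfin mA A0.
have [v dv vB] := uniform_on mfin mB B0.
have split (f h : borel X -> R) (c : R) (S : set (borel X)) : bmf f -> bmf h ->
    (forall x, 0 <= f x) -> (forall x, 0 <= h x) -> 0 <= c -> measurable S ->
    (\int[m]_(x in S) (f x + c * h x)%:E =
     \int[m]_(x in S) (f x)%:E + c%:E * \int[m]_(x in S) (h x)%:E)%E.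
  move=> bf bh f0 h0 c0 mS; rewrite -ge0_integralZl//; last first.
  - by move=> x _; rewrite lee_fin.
  - by apply/measurable_EFinP; apply: measurable_funTS; exact: bh.1.
  rewrite -ge0_integralD//.
  - by move=> x _; rewrite lee_fin.
  - by apply/measurable_EFinP; apply: measurable_funTS; exact: bf.1.
  - by move=> x _; rewrite -EFinM lee_fin mulr_ge0.
  - apply: measurable_funeM; apply/measurable_EFinP; apply: measurable_funTS; exact: bh.1.
have biA' : bmf (fun x : borel X => a^-1 * \1_A x) by apply: bmfM => //; exact: bmf_cst.
have costD : (cost mu0 mu1 <= (th * D ^+ 2)%:E)%E.
  apply: (@cost_move _ _ sepX mu0 mu1 u v
    [the {measure set _ -> \bar R} of dens_measure m brn.1 rn0] th D A B) => //.
  - exact: ltW.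
  - exact: ltW.
  - move=> S mS; have [_ _ ->//] := d0; have [_ _ ->//] := du.
    rewrite /= /dens_measure -split ?(ltW th0)//; apply: eq_integral => x _; congr EFin.
    by rewrite /rn -/a /th; field; rewrite !gt_eqF.
  - move=> S mS; have [_ _ ->//] := d1; have [_ _ ->//] := dv.
    by rewrite /= /dens_measure -split ?(ltW th0).
have cf : cost mu0 mu1 \is a fin_num.
  by rewrite ge0_fin_numE ?cost_ge0// (le_lt_trans costD)// ltry.
pose c0 := fine (cost mu0 mu1); have c0E : cost mu0 mu1 = c0%:E by rewrite fineK.
have thD0 : 0 < th * D ^+ 2 by rewrite mulr_gt0// exprn_gt0.
have c0C : c0 < 2 * (th * D ^+ 2).
  have : c0 <= th * D ^+ 2 by rewrite -lee_fin -c0E.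
  by move: thD0; lra.
pose S : set (borel X) := [set x : X | mdist x0 x <= D0].
have mS : measurable S.
  rewrite -[X in measurable X]setTI (_ : S = (fun x : borel X => mdist x0 (x : X)) @^-1` `]-oo, D0]%classic).
    exact: measurable_mdistr.
  by apply/seteqP; split => x /=; rewrite in_itv.
have rhoS x : ~ S x -> rho x = 0.
  move=> nS; rewrite /rho; have [->|/gD//] := eqVneq (g x) 0.
  by rewrite expr0n mulr0.
have S0 := density_full d0 mS rhoS.
have S1 : mu1 S = 1%E.
  apply: (density_full d1 mS) => x nS; rewrite /rho1 rnC; last first.
    by move=> Ax; apply: nS; apply: gD; rewrite gA// oner_neq0.
  by rewrite rhoS// indicE memNset ?mulr0 ?addr0// => /BD.
have [M rho1M] := brho1.2.
have rho1M' x : rho1 x <= M by rewrite (le_trans (ler_norm _)).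
have bE0 : bmf (rho_log_rho rho).
  by apply: (@bmf_xlnx _ _ _ N^-1 brho.1) => x; rewrite rho0/= ler_piMr ?invr_ge0 ?(ltW N0)// expr_le1; case/andP: (g01 x).
have bE1 : bmf (rho_log_rho rho1).
  by apply: (@bmf_xlnx _ _ _ M brho1.1) => x; rewrite rho10/=.
have := hwi L0 gL g01 N0 d0 (ent_le_integral mfin d1 rho1M') mS S0 S1 D00 (fun x => id) c0E c0C
  (exprn_gt0 2 D0').
rewrite -/N -/rho.
have gain : th * (2 + kap * D ^+ 2) <=
    \int[m]_x rho_log_rho rho x - \int[m]_x rho_log_rho rho1 x.
  rewrite -RintB//.
  pose low (x : borel X) := (- (sg / N) * ln N) * \1_A x + (- (th / b) * ln (th / b)) * \1_B x.
  have blow : bmf low by apply: bmfD; apply: bmfM => //; exact: bmf_cst.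
  apply: (@le_trans _ _ (\int[m]_x low x)).
    rewrite /low RintD//; [|by apply: bmfM => //; exact: bmf_cst..].
    rewrite !RintZ// !Rint_indic// -/a -/b.
    have sa0 : 0 < sg * a by rewrite mulr_gt0.
    have : ln (sg * a) <= ln b - (2 + kap * D ^+ 2).
      by rewrite -ler_expR lnK ?posrE// expRD lnK ?posrE.
    have -> : ln (th / b) = ln (sg * a) - ln N - ln b.
      by rewrite !ln_div ?posrE ?divr_gt0.
    move=> /(ler_wpM2l (ltW th0)) h.
    have -> : - (sg / N) * ln N * a = - th * ln N by rewrite /th; ring.
    have -> : - (th / b) * (ln (sg * a) - ln N - ln b) * b = - th * (ln (sg * a) - ln N - ln b).
      by field; rewrite gt_eqF.
    by move: h; lra.
  apply: Rint_le => //; first exact: bmfB.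
  move=> x; rewrite /low /rho_log_rho; have [Ax|nA] := pselect (A x).
    have nB : ~ B x by move=> /gB; rewrite gA// => /eqP; rewrite oner_eq0.
    rewrite /rho1 rnA// !indicE (mem_set Ax) (memNset nB) !mulr0 !addr0 !mulr1 /rho gA// expr1n mulr1.
    have [->|s1] := eqVneq sg 1.
      by rewrite subrr !mul0r subr0 lnV ?posrE//; rewrite div1r; lra.
    have s10 : 0 < 1 - sg by rewrite subr_gt0 lt_neqAle s1.
    rewrite ln_div ?posrE// lnV ?posrE//.
    have h1 : ln (1 - sg) <= 0 by rewrite ln_le0// gerBl ltW.
    have h2 : (1 - sg) / N * ln (1 - sg) <= 0 by rewrite mulr_ge0_le0// divr_ge0// ltW.
    have -> : N^-1 * - ln N - (1 - sg) / N * (ln (1 - sg) - ln N) =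
      - (sg / N) * ln N - (1 - sg) / N * ln (1 - sg) by ring.
    by move: h2; lra.
  rewrite /rho1 rnC// !indicE (memNset nA) mulr0 add0r.
  have [Bx|nB] := pselect (B x).
    by rewrite (mem_set Bx) /rho gB// expr0n !mulr0 !mul0r !add0r !mulr1; lra.
  by rewrite (memNset nB) !mulr0 addr0 subrr.
have D2 : 0 < D ^+ 2 by rewrite exprn_gt0.
have -> : 2 * (th * D ^+ 2) / (2 * D ^+ 2) = th by field; rewrite gt_eqF.
apply: le_trans; have -> : sg * a = N * th by rewrite /th; field; rewrite gt_eqF.
by rewrite ler_wpM2l ?(ltW N0)//; move: gain; lra.
Qed.

End capacity.

(** * Positivity of the spectral gap *)

Section positive_gap.
Context (R : realType) (X : completeMetricType R).
Variable m : {measure set (borel X) -> \bar R}.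
Hypothesis sepX : separable X.
Hypothesis mfin : (m setT < +oo)%E.
Let V := fine (m setT).
Variable K : R.
Hypothesis cd : CD_infty m K.
Let kap := Num.max (- K) 0.
Implicit Types (g f : X -> R).

Lemma tail_small (x0 : X) (r0 e : R) : 0 < e ->
  exists2 r, r0 <= r & fine (m [set x | (r <= mdist x0 x)%R]) <= e.
Proof.
move=> e0; pose F n : set (borel X) := [set x : X | n%:R <= mdist x0 x].
have mF n : measurable (F n) by exact: measurable_far.
have F0 : \bigcap_n F n = set0.
  apply/seteqP; split => x //= /(_ (Num.truncn (mdist x0 x)).+1 I).
  by rewrite /F/= leNgt => /negP; apply; exact: truncnS_gt.
have ndF : nonincreasing_seq F.
  move=> i j ij; apply/subsetPset => x; rewrite /F/=; apply: le_trans.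
  by rewrite ler_nat.
have F0f : (m (F 0%N) < +oo)%E by rewrite ltey_eq mu_fin.
have := nonincreasing_cvg_mu (mu := m) F0f mF (bigcapT_measurable mF) ndF.
rewrite F0 measure0 => cv.
have tn : (0 < e%:E)%E by rewrite lte_fin.
have H := cv _ (open_ereal_lt' tn).
have [n0 _ Hn] : \forall n \near \oo, (m (F n) < e%:E)%E by exact: H.
pose n := maxn n0 (Num.truncn `|r0|).+1; exists n%:R.
  rewrite (le_trans (ler_norm r0))// (le_trans (ltW (truncnS_gt `|r0|)))// ler_nat leq_maxr//.
have := Hn n (leq_maxl _ _); rewrite -[X in (X < _)%E](fineK (mu_fin mfin (mF n))) lte_fin.
exact: ltW.
Qed.

Section one_sided.
Variables (om : R) (x0 : X).
Hypothesis om0 : 0 < om.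
Hypothesis omP : forall A : set (borel X), measurable A ->
  (m A <= om%:E -> m A <= Per m A)%E.
Hypothesis V0 : 0 < V.

(** [capacity] for [clamp (2 * g / t - 1)], which separates [g > t] from
    [g = 0] and is locally constant near the points where [g] vanishes; the
    cutoff at a large distance contributes little energy. *)
Lemma superlevel_energy : exists2 c : R, 0 < c & forall g M t,
  lipschitz_in setT g -> (forall x, 0 <= g x <= M) -> 0 < t ->
  (m [set x | 0 < g x]%R <= (V / 2)%:E)%E -> (om%:E <= m [set x | t < g x]%R)%E ->
  c * t ^+ 2 <= \int[m]_x (\1_[set x | 0 < g x] x * sl g x ^+ 2).
Proof.
have e0 : 0 < Num.min (om / 2) (V / 4) by rewrite lt_min !divr_gt0.
have [r0 r01 far0] := tail_small x0 1 e0.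
have r00 : 0 < r0 by exact: lt_le_trans ltr01 r01.
pose D := 2 * r0; have D0 : 0 < D by rewrite mulr_gt0.
pose sg := expR (- (2 + kap * D ^+ 2)) / 4.
have sg0 : 0 < sg by rewrite divr_gt0// expR_gt0.
have kap0 : 0 <= kap by rewrite /kap le_max lexx orbT.
have sg1 : sg <= 1.
  rewrite ler_pdivrMr// mul1r (@le_trans _ _ 1) ?ler1n// -expR0 ler_expR oppr_le0.
  by rewrite addr_ge0// mulr_ge0// exprn_ge0// ltW.
pose c2 := sg * (om / 2) / (2 * D ^+ 2).
have D2 : 0 < 2 * D ^+ 2 by rewrite mulr_gt0// exprn_gt0.
have c20 : 0 < c2 by rewrite divr_gt0// mulr_gt0// divr_gt0.
have c24 : 0 < c2 / 4 by rewrite divr_gt0.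
have [r rr0 far] := tail_small x0 r0 c24.
have r0' : 0 <= r by rewrite (le_trans (ltW r00)).
exists (c2 / 16); first by rewrite divr_gt0.
move=> g M t lg gM t0 mV mt.
have gM' x : `|g x| <= M by have /andP[? ?] := gM x; rewrite ger0_norm.
have bg := lipschitz_bmf lg gM'; have mg := bg.1.
pose f x := 2 * g x / t - 1.
have fd x y : `|f x - f y| = 2 / t * `|g x - g y|.
  have -> : f x - f y = 2 / t * (g x - g y) by rewrite /f; ring.
  by rewrite normrM ger0_norm// divr_ge0// ltW.
have t2 : 0 <= 2 / t by rewrite divr_ge0// ltW.
have lf : lipschitz_in setT f.
  have [L gL] := lg; exists (2 / t * L) => x y _ _; rewrite fd -(mulrA (2 / t) L) ler_wpM2l//.
  exact: gL.
have lf' := lipschitz_lip_loc lf.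
pose g2 := cutoff x0 r f; have g201 x : 0 <= g2 x <= 1 by exact: cut01.
have [L0 g2L0] := cut_lipschitz x0 r lf'.
pose L := `|L0|; have L00 : 0 <= L by exact: normr_ge0.
have g2L x y : `|g2 x - g2 y| <= L * mdist x y.
  by rewrite (le_trans (g2L0 x y))// ler_wpM2r ?mdist_ge0// ler_norm.
have lg2 : lipschitz_in setT g2 by exists L => x y _ _; exact: g2L.
pose Bl : set (borel X) := [set x | mdist x0 x < r0].
have mBl : measurable Bl by apply: borel_open; exact: open_mball.
have mfar0 : measurable ([set x | r0 <= mdist x0 x] : set (borel X)) by exact: measurable_far.
pose A : set (borel X) := [set x | t < g x] `&` Bl.
pose B : set (borel X) := (setT `\` [set x | 0 < g x]) `&` Bl.
have mtg : measurable ([set x | t < g x] : set (borel X)) by exact: measurable_superlevel mg.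
have m0g : measurable ([set x | 0 < g x] : set (borel X)) by exact: measurable_superlevel mg.
have mA : measurable A by exact: measurableI.
have mC : measurable (setT `\` [set x | 0 < g x] : set (borel X)) by exact: measurableD.
have mB : measurable B by exact: measurableI.
(* restricting to the ball loses at most the tail *)
have cap S : measurable S -> fine (m S) - Num.min (om / 2) (V / 4) <= fine (m (S `&` Bl)).
  move=> mS; have mSB : measurable (S `&` Bl) by exact: measurableI.
  have : (m S <= m (S `&` Bl) + m [set x | (r0 <= mdist x0 x)%R])%E.
    apply: le_trans (measureU2 _ mSB mfar0); apply: le_measure; rewrite ?inE//.
      exact: measurableU.
    move=> x Sx; have [xr|rx] := ltP (mdist x0 x) r0; [by left|by right].
  rewrite -(fineK (mu_fin mfin mS)) -(fineK (mu_fin mfin mSB)) -(fineK (mu_fin mfin mfar0)).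
  by rewrite -EFinD lee_fin; move: far0; lra.
have omA : om / 2 <= fine (m A).
  have := cap _ mtg; have : om <= fine (m [set x | t < g x]).
    by rewrite -lee_fin fineK// mu_fin.
  have : Num.min (om / 2) (V / 4) <= om / 2 by rewrite ge_min lexx.
  by rewrite -/A; lra.
have VB : V / 4 <= fine (m B).
  have := cap _ mC; rewrite fine_muD// -/V.
  have : fine (m [set x | 0 < g x]) <= V / 2 by rewrite -lee_fin fineK// mu_fin.
  have : Num.min (om / 2) (V / 4) <= V / 4 by rewrite ge_min lexx orbT.
  by rewrite -/B; lra.
have A0 : (0 < m A)%E.
  by rewrite -(fineK (mu_fin mfin mA)) lte_fin (lt_le_trans _ omA)// divr_gt0.
have B0 : (0 < m B)%E.
  by rewrite -(fineK (mu_fin mfin mB)) lte_fin (lt_le_trans _ VB)// divr_gt0.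
have gA x : A x -> g2 x = 1.
  move=> [/= tg xr]; rewrite /g2 cut_in; last by rewrite (le_trans (ltW xr)).
  apply: clamp_ge1; rewrite /f; have : 1 <= g x / t by rewrite ler_pdivlMr// mul1r ltW.
  by lra.
have gB x : B x -> g2 x = 0.
  move=> [[_ /= /negP]]; rewrite -leNgt => g0 _; rewrite /g2 /cutoff clamp_le0 ?mul0r//.
  have : g x / t <= 0 by rewrite ler_pdivrMr// mul0r.
  by rewrite /f; lra.
have ABD x y : A x -> B y -> mdist (x : X) (y : X) <= D.
  move=> [_ /= xr] [_ /= yr]; rewrite (le_trans (metric_triangle x x0 y))// metric_sym.
  by rewrite /D; move: xr yr; rewrite /Bl/=; lra.
have gD x : g2 x != 0 -> mdist x0 x <= r + 1.
  by apply: contraNT; rewrite -ltNge => /ltW rx; apply/eqP; exact: cut_out.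
have BD x : B x -> mdist x0 x <= r + 1.
  by move=> [_ /= xr]; move: xr; rewrite /Bl/=; lra.
have sgAB : sg * fine (m A) <= fine (m B) * expR (- (2 + kap * D ^+ 2)).
  have AV : fine (m A) <= V by exact: fine_mu_le.
  have := ler_wpM2r (expR_ge0 (- (2 + kap * D ^+ 2))) VB.
  have := ler_wpM2l (ltW sg0) AV; rewrite /sg; lra.
have r1 : 0 <= r + 1 by rewrite addr_ge0.
have sg01 : 0 < sg <= 1 by rewrite sg0.
have := capacity sepX mfin cd L00 g2L g201 mA mB A0 B0 gA gB D0 ABD r1 gD BD sg01 sgAB.
move=> /(le_trans (ler_wpM2l (ltW sg0) omA)) capc0.
have capc : c2 <= \int[m]_x (sl g2 x ^+ 2) by rewrite /c2 ler_pdivrMr// [leRHS]mulrC.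
have bs2 : @bmf _ (borel X) R (fun x => sl g2 x ^+ 2) by apply: bmfX; exact: lipschitz_bmf_sl.
have bE : @bmf _ (borel X) R (fun x => \1_[set x | 0 < g x] x * sl g x ^+ 2).
  by apply: bmfM; [exact: bmf_indic|apply: bmfX; exact: lipschitz_bmf_sl].
have mfar : measurable ([set x | r <= mdist x0 x] : set (borel X)) by exact: measurable_far.
have bfar : @bmf _ (borel X) R (\1_[set x | r <= mdist x0 x]) by exact: bmf_indic.
have sl2 x : sl g2 x ^+ 2 <= 8 / t ^+ 2 * (\1_[set x | 0 < g x] x * sl g x ^+ 2) +
    2 * \1_[set x | r <= mdist x0 x] x.
  have i0 : 0 <= \1_[set x | r <= mdist x0 x] x :> R by rewrite indicE.
  have /andP[g0 _] := gM x.
  have [gx|gx] := ltP 0 (g x); last first.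
    have gxt : [set y | g y < t / 2] x by rewrite /= (le_lt_trans gx)// divr_gt0.
    have [b b0 hb] := open_mdist (mcontinuous_open_lt (t / 2) (lipschitz_mcontinuous lg)) gxt.
    have [] := @sl_le _ _ g2 x b 0 b0 (lexx 0).
      move=> y xy; have z0 z : g z < t / 2 -> g2 z = 0.
        move=> gz; rewrite /g2 /cutoff clamp_le0 ?mul0r// /f.
        have : g z / t <= 2^-1 by rewrite ler_pdivrMr// mulrC ltW.
        lra.
      by rewrite (z0 x gxt) (z0 y (hb y xy)) subrr normr0 mul0r.
    move=> _ s0; rewrite (_ : sl g2 x = 0); last by apply/eqP; rewrite eq_le s0 sl_ge0.
    rewrite expr0n/=; apply: addr_ge0; last by rewrite mulr_ge0.
    apply: mulr_ge0; first by rewrite divr_ge0 ?sqr_ge0.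
    by rewrite mulr_ge0 ?sqr_ge0// indicE.
  have sf : sl f x <= 2 / t * sl g x.
    have hc y : mdist x y < 1 -> `|f y - f x| <= 2 / t * `|g y - g x| + 0 * mdist x y.
      by move=> _; rewrite mul0r addr0 fd.
    have [_] := sl_comp_le (lip_loc_slE x (lipschitz_lip_loc lg)) ltr01 t2 (lexx 0) hc.
    by rewrite addr0.
  have := sl_cut x0 r x lf'; rewrite !indic_ite gx mul1r -/g2.
  set i := if _ then _ else _ => h; have i01 : i = 0 \/ i = 1 by rewrite /i; case: ifP; [right|left].
  have h2 : sl g2 x <= 2 / t * sl g x + i by move: h sf; lra.
  have p0 : 0 <= 2 / t * sl g x by rewrite mulr_ge0 ?sl_ge0.
  have ii : i ^+ 2 = i by case: i01 => ->; rewrite ?expr0n ?expr1n.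
  have i0' : 0 <= i by case: i01 => ->.
  have : sl g2 x ^+ 2 <= (2 / t * sl g x + i) ^+ 2.
    by rewrite ler_pXn2r ?nnegrE ?sl_ge0// addr_ge0.
  move/le_trans; apply.
  have -> : 8 / t ^+ 2 * sl g x ^+ 2 = 2 * (2 / t * sl g x) ^+ 2 by field; rewrite gt_eqF.
  have := sqr_ge0 (2 / t * sl g x - i); rewrite sqrrB sqrrD ii; lra.
have : c2 <= 8 / t ^+ 2 * \int[m]_x (\1_[set x | 0 < g x] x * sl g x ^+ 2) + 2 * (c2 / 4).
  apply: le_trans capc _.
  apply: (@le_trans _ _ (8 / t ^+ 2 * \int[m]_x (\1_[set x | 0 < g x] x * sl g x ^+ 2) +
    2 * \int[m]_x \1_[set x | r <= mdist x0 x] x)).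
    rewrite -!RintZ// -RintD//; try by apply: bmfM => //; exact: bmf_cst.
    apply: Rint_le => //; apply: bmfD; apply: bmfM => //; exact: bmf_cst.
  by rewrite lerD2l ler_wpM2l// Rint_indic.
have tt : 0 < t ^+ 2 by rewrite exprn_gt0.
set E := \int[m]_x _ => h3; have h4 : c2 / 2 <= 8 / t ^+ 2 * E by move: h3; lra.
have := ler_wpM2r (ltW tt) h4.
have -> : 8 / t ^+ 2 * E * t ^+ 2 = 8 * E by field; rewrite gt_eqF.
by lra.
Qed.

(** If [g] had small energy compared with the integral [N] of [g ^+ 2], then by
    [coarea_sqr], with the trivial bound [0] on large sets, at most a fraction of [N]
    would lie above the quantile at [om]. Hence [g > t] has measure at least [om]
    for some [t] with [t ^+ 2] of order [N / V], contradicting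
    [superlevel_energy]. *)
Lemma onesided_positive : exists2 k : R, 0 < k & forall g M,
  lipschitz_in setT g -> (forall x, 0 <= g x <= M) ->
  (m [set x | 0 < g x]%R <= (V / 2)%:E)%E ->
  k * \int[m]_x (g x ^+ 2) <= \int[m]_x (\1_[set x | 0 < g x] x * sl g x ^+ 2).
Proof.
have [c c0 cE] := superlevel_energy.
pose k := Num.min 32^-1 (c / (2 * V)).
have k0 : 0 < k by rewrite lt_min invr_gt0 ltr0n/= divr_gt0// mulr_gt0.
exists k => // g M lg gM mV; set N := \int[m]_x (g x ^+ 2); set E := (X in _ <= X).
rewrite leNgt; apply/negP => Elt.
have gM' x : `|g x| <= M by have /andP[? ?] := gM x; rewrite ger0_norm.
have bg := lipschitz_bmf lg gM'; have mg := bg.1.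
have bg2 : @bmf _ (borel X) R (fun x => g x ^+ 2) by exact: bmfX.
have m0g : measurable ([set x | 0 < g x] : set (borel X)) by exact: measurable_superlevel mg.
have bE : @bmf _ (borel X) R (fun x => \1_[set x | 0 < g x] x * sl g x ^+ 2).
  by apply: bmfM; [exact: bmf_indic|apply: bmfX; exact: lipschitz_bmf_sl].
have E0 : 0 <= E by apply: Rintegral_ge0 => x _; rewrite mulr_ge0 ?sqr_ge0// indicE.
have N0 : 0 < N by rewrite -(pmulr_rgt0 _ k0) (le_lt_trans E0).
have eta0 : 0 < N / (8 * V) by rewrite divr_gt0// mulr_gt0.
have [t [T [/andP[t0 tT] tTe mT mt]]] := quantile_pair m om0 mg gM eta0.
have T0 : 0 <= T by exact: le_trans tT.
have hP0 A : measurable A -> (m A <= (V / 2)%:E -> 0%:E * m A <= Per m A)%E.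
  by move=> _ _; rewrite mul0e per_ge0.
have omP1 A : measurable A -> (m A <= om%:E -> (0 + 1)%:E * m A <= Per m A)%E.
  by move=> mA mAo; rewrite add0r mul1e; exact: omP.
have := coarea_sqr mfin (lexx 0) ler01 hP0 omP1 lg gM T0 mV mT.
rewrite mul0r add0r mul1r; set XX := \int[m]_x Num.max _ _ => hX.
have bX : @bmf _ (borel X) R (fun x => Num.max (g x ^+ 2 - T ^+ 2) 0).
  by apply: bmf_max; [apply: bmfB => //; exact: bmf_cst|exact: bmf_cst].
have bZ (a : R) f' : @bmf _ (borel X) R f' -> @bmf _ (borel X) R (fun x => a * f' x).
  by move=> bf; apply: bmfM => //; exact: bmf_cst.
have hX2 : XX <= 4^-1 * N + 4 * E.
  apply: le_trans hX _; rewrite -!RintZ// -RintD//; [|exact: bZ|exact: bZ].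
  apply: Rint_le => //.
  - by apply: lipschitz_bmf_sl; exact: lipschitz_sqr gM'.
  - by apply: bmfD; exact: bZ.
  move=> x; have := sl_sqr_le x lg; have /andP[gx0 _] := gM x; rewrite (ger0_norm gx0).
  move/le_trans; apply; rewrite indic_ite; case: ifPn => gx.
    have := sqr_ge0 (g x / 2 - 2 * sl g x); rewrite sqrrB; lra.
  have -> : g x = 0 by apply/eqP; rewrite eq_le gx0 leNgt gx.
  by rewrite mulr0 mul0r expr0n mulr0 mul0r mulr0 addr0.
have Hd : N <= T ^+ 2 * V + XX.
  rewrite /N /XX -Rint_cst -RintD; [|by []|exact: bmf_cst|by []].
  apply: Rint_le => //; first by apply: bmfD => //; exact: bmf_cst.
  move=> x; have : g x ^+ 2 - T ^+ 2 <= Num.max (g x ^+ 2 - T ^+ 2) 0 by rewrite le_max lexx.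
  lra.
have tTV : (T ^+ 2 - t ^+ 2) * V <= N / 8.
  have := ler_wpM2r (ltW V0) tTe.
  by have -> : N / (8 * V) * V = N / 8 by field; rewrite gt_eqF.
have k32 : k * N <= 32^-1 * N by rewrite ler_wpM2r ?(ltW N0)// ge_min lexx.
have NtV : N / 2 <= t ^+ 2 * V by move: Hd hX2 tTV k32 Elt; lra.
have tp : 0 < t.
  rewrite lt_neqAle t0 andbT eq_sym; apply: contraTneq NtV => ->.
  by rewrite expr0n mul0r -ltNge divr_gt0.
have mt' : (om%:E <= m [set x | t < g x]%R)%E by case: mt => // tt; move: tp; rewrite tt ltxx.
have := cE g M t lg gM tp mV mt'; rewrite -/E => hE.
have kc : k * N <= c * t ^+ 2.
  apply: (@le_trans _ _ (c / (2 * V) * N)); first by rewrite ler_wpM2r ?(ltW N0)// ge_min lexx orbT.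
  have -> : c / (2 * V) * N = c * (N / 2 / V) by field; rewrite gt_eqF.
  by rewrite ler_wpM2l ?(ltW c0)// ler_pdivrMr.
by move: (lt_le_trans Elt (le_trans kc hE)); rewrite ltxx.
Qed.

End one_sided.

End positive_gap.

(** * The Cheeger constant and the strict inequality *)

Section cheeger_constant_bounds.
Context (R : realType) (X : completeMetricType R).
Variable m : {measure set (borel X) -> \bar R}.
Hypothesis mfin : (m setT < +oo)%E.
Let V := fine (m setT).

Let half : (m setT / 2%:E = (V / 2)%:E)%E.
Proof. by rewrite -(fineK (mu_fin mfin measurableT)) inver pnatr_eq0/= -EFinM. Qed.

Lemma cheeger_ge0 : (0 <= cheeger_constant m)%E.
Proof.
apply: le_ereal_inf_tmp => _ [A [mA A0 _] <-].
by rewrite -(fineK (mu_fin mfin mA)) inver; case: ifP => _; rewrite mule_ge0 ?per_ge0// ?lee_fin ?invr_ge0 ?fine_ge0.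
Qed.

Lemma cheeger_le (A : set (borel X)) (h : R) : cheeger_constant m = h%:E ->
  measurable A -> (m A <= (V / 2)%:E)%E -> (h%:E * m A <= Per m A)%E.
Proof.
move=> hE mA AV; have [->|A0] := eqVneq (m A) 0%E; first by rewrite mule0 per_ge0.
have Ap : (0 < m A)%E by rewrite lt_neqAle eq_sym A0 measure_ge0.
have a0 : 0 < fine (m A) by rewrite fine_gt0// Ap ltey_eq mu_fin.
have : (cheeger_constant m <= Per m A / m A)%E.
  by apply: ereal_inf_lbound; exists A => //; split => //; rewrite half.
rewrite hE -(fineK (mu_fin mfin mA)) inver gt_eqF// => h1.
by rewrite -lee_pdivlMr.
Qed.

(** The coarea inequality for the distance to [z] in fact gives this for almost
    every radius. *)
Lemma finite_perimeter_ball (z : X) (d : R) : 0 < d ->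
  exists2 r, 0 < r < d & (Per m [set x | (mdist z x < r)%R] < +oo)%E.
Proof.
move=> d0; apply: contrapT => nP.
have Poo r : 0 < r < d -> Per m [set x | (mdist z x < r)%R] = +oo%E.
  move=> rd; apply/eqP; rewrite -leye_eq leNgt; apply/negP => h; apply: nP; exists r => //.
pose g x := - mdist z x.
have lg : lipschitz_in setT g.
  exists 1 => x y _ _; rewrite mul1r /g opprK addrC distrC -normrN opprB distrC.
  exact: mdist_distl.
have bs : @bmf _ (borel X) R (sl g) by exact: lipschitz_bmf_sl.
pose I := \int[m]_x sl g x.
have I0 : 0 <= I by apply: Rintegral_ge0 => x _; exact: sl_ge0.
pose c := (I + 1) / d; have c0 : 0 <= c by rewrite divr_ge0 ?addr_ge0// ltW.
pose psi (s : R) : \bar R := (if s \in `]- d, 0[ then c else 0)%:E.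
have mpsi : measurable_fun setT psi.
  apply/measurable_EFinP; apply: measurable_fun_ifT => //.
  rewrite (_ : (fun s : R => s \in _) = (fun s => (- d < s) && (s < 0))).
    by apply: measurable_and; apply: measurable_fun_ltr.
  by apply/funext => s; rewrite in_itv.
have psi0 s : (0 <= psi s)%E by rewrite lee_fin; case: ifP.
have psiP s : (psi s <= Per m [set x | (s < g x)%R])%E.
  rewrite /psi in_itv/=; case: ifPn => [/andP[ds s0]|_]; last exact: per_ge0.
  rewrite (_ : [set x | _] = [set x | mdist z x < - s]).
    by rewrite Poo ?leey// oppr_gt0 s0/= ltrNl.
  by apply/seteqP; split => x /=; rewrite /g ltrNr.
have := coarea_per mfin lg mpsi psi0 psiP.
have d0' : - d <= 0 by rewrite oppr_le0 ltW.
rewrite (integral_itv_ite c false true d0') -RintE// -/I lee_fin sub0r opprK /c divfK ?gt_eqF//.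
by rewrite gerDl ler10.
Qed.

(** One of two disjoint balls has at most half of the total measure. *)
Lemma cheeger_fin_num : msupport m = setT -> (exists x y : X, x <> y) ->
  cheeger_constant m \is a fin_num.
Proof.
move=> ms [x [y xy]]; rewrite ge0_fin_numE ?cheeger_ge0//.
have dxy : 0 < mdist x y.
  by rewrite mdist_gt0; exact/eqP.
pose d := mdist x y / 2; have d0 : 0 < d by rewrite divr_gt0.
pose U (z : X) : set (borel X) := [set w | mdist z w < d].
have mball (z : X) r : measurable ([set w | mdist z w < r] : set (borel X)).
  by apply: borel_open; exact: open_mball.
have [z Uz] : exists z, (m (U z) <= (V / 2)%:E)%E.
  apply: contrapT => nU.
  have big z : (V / 2 < fine (m (U z))).
    rewrite ltNge; apply/negP => h; apply: nU; exists z.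
    by rewrite -(fineK (mu_fin mfin (mball z d))) lee_fin.
  have dis : U x `&` U y = set0.
    apply/seteqP; split => w //= [xw yw]; have := metric_triangle x w y.
    by rewrite (metric_sym w y); move: xw yw; rewrite /U/= /d; lra.
  have : fine (m (U x `|` U y)) <= V.
    by apply: fine_mu_le => //; exact: measurableU (mball x d) (mball y d).
  have mUx := mu_fin mfin (mball x d); have mUy := mu_fin mfin (mball y d).
  have -> : m (U x `|` U y) = (m (U x) + m (U y))%E by exact: measureU (mball x d) (mball y d) dis.
  by rewrite fineD//; have := big x; have := big y; lra.
have [r /andP[r0 rd] Pr] := finite_perimeter_ball z d0.
set A : set (borel X) := [set w | _] in Pr.
have mA : measurable A by exact: mball.
have A0 : (0 < m A)%E.
  have : msupport m z by rewrite ms.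
  by apply; [exact: open_mball|rewrite /A/= mdistxx].
have a0 : 0 < fine (m A) by rewrite fine_gt0// A0 ltey_eq mu_fin.
apply: (@le_lt_trans _ _ (Per m A / m A)%E).
  apply: ereal_inf_lbound; exists A => //; split => //; rewrite half; apply: le_trans Uz.
  apply: le_measure; rewrite ?inE//; first exact: mball.
  by move=> w /=; rewrite /A/U/= => /lt_trans; apply.
rewrite -(fineK (mu_fin mfin mA)) inver gt_eqF//.
have Pf : Per m A \is a fin_num by rewrite ge0_fin_numE// per_ge0.
by rewrite -(fineK Pf) -EFinM ltry.
Qed.

End cheeger_constant_bounds.

Theorem theorem1p4 (R : realType) (X : completeMetricType R)
    (m : {measure set (borel X) -> \bar R}) (K : R)
    (hRCD : RCD_infty m K)
    (hfin : (m [set: X] < +oo)%E)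
    (hX : exists x y : X, x <> y) :
  (superlinear_profile m ->
     ((4^-1)%:E * cheeger_constant m ^+ 2 < lambda1 m)%E) /\
  ((diam [set: X] < +oo)%E \/ 0 < K -> superlinear_profile m).
Proof.
have [[sepX _ ms _] cd _] := hRCD; have [x0 _] := hX.
have mfin : (m setT < +oo)%E by exact: hfin.
have ball0 : (0 < m [set x | (mdist x0 x < 1)%R])%E.
  have : msupport m x0 by rewrite ms.
  by apply; [exact: open_mball|rewrite /= mdistxx].
have mpos : (0 < m setT)%E.
  by have : msupport m x0 by [rewrite ms]; apply => //; exact: openT.
have V0 : 0 < fine (m setT) by rewrite fine_gt0// mpos.
split; last first.
  move=> hKd; apply/(superlinear_profileP mfin mpos) => e e0.
  exact: (small_sets sepX mfin cd e0 ball0 hKd).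
move=> /(superlinear_profileP mfin mpos) prof.
have hf := cheeger_fin_num mfin ms hX; have hge := cheeger_ge0 mfin.
pose h := fine (cheeger_constant m).
have hE : cheeger_constant m = h%:E by rewrite fineK.
have h0 : 0 <= h by rewrite fine_ge0.
rewrite hE -EFin_expe -EFinM; have [hp|hn] := ltP 0 h; last first.
  have -> : h = 0 by apply/eqP; rewrite eq_le hn.
  have [om om0 omP] := prof 1 ltr01.
  have omP' A : measurable A -> (m A <= om%:E -> m A <= Per m A)%E.
    by move=> mA /(omP A mA); rewrite mul1e.
  have [k k0 gap] := onesided_positive sepX mfin cd x0 om0 omP' V0.
  apply: lt_le_trans (lambda1_ge mfin (ltW k0) gap ms V0).
  by rewrite expr0n mulr0 lte_fin.
have e0 : 0 < (h + h)^-1 by rewrite invr_gt0 addr_gt0.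
have [om om0 omP] := prof _ e0.
have omP' A : measurable A -> (m A <= om%:E -> (h + h)%:E * m A <= Per m A)%E.
  move=> mA /(omP A mA) /(lee_wpmul2l (_ : (0 <= (h + h)%:E)%E)).
  rewrite lee_fin addr_ge0// => /(_ isT) /le_trans; apply.
  by rewrite muleA -EFinM divff ?mul1e// gt_eqF// addr_gt0.
have hP A (mA : measurable A) := cheeger_le mfin hE mA.
have gap g M := @onesided_gap _ _ m h om g M mfin hp om0 hP omP'.
have th0 := cheeger_gain_gt0 (ltW V0) hp om0.
have c0 : 0 <= h ^+ 2 / 4 by rewrite divr_ge0 ?sqr_ge0.
apply: lt_le_trans (lambda1_ge mfin (addr_ge0 c0 (ltW th0)) gap ms V0).
by rewrite lte_fin; move: th0; lra.
Qed.
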